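(* Let $n\ge 2$ and let $U\subseteq\mathbb{R}^n=\mathbb{R}\times\mathbb{R}^{n-1}$ be an open subset such that the projection $p\colon U\to\mathbb{R}^{n-1}$, $(t,u)\mapsto u$, has connected fibers and its image $p(U)$ is star-shaped with respect to $0\in\mathbb{R}^{n-1}$. Then the natural ring homomorphism $$\wedge^\bullet\mathrm{span}_{\mathbb{R}}\{\partial_t,\,u_i\partial_{u_j}\}\longrightarrow H^\bullet_{book}(U),\qquad \mu\mapsto[\mu],$$ is onto and its kernel is the ideal generated by $E$, so it induces a ring isomorphism $$\frac{\wedge^\bullet\mathrm{span}_{\mathbb{R}}\{\partial_t,\,u_i\partial_{u_j}\}}{\langle E\rangle}\;\xrightarrow{\ \sim\ }\;H^\bullet_{book}(U).$$
   Context: $\mathbb{R}^n=\mathbb{R}\times\mathbb{R}^{n-1}$ has coordinates $(t,u_1,\dots,u_{n-1})$. $E=u_1\partial_{u_1}+\dots+u_{n-1}\partial_{u_{n-1}}$ is the Euler vector field of $\mathbb{R}^{n-1}$, regarded as a vector field on $\mathbb{R}^n$. The book Poisson structure is $\Lambda_{book}=\partial_t\wedge E$. For $U\subseteq\mathbb{R}^n$ open, $\mathfrak{X}^\bullet(U)$ is the algebra of smooth multivector fields on $U$, $d_{book}=[\Lambda_{book},\cdot]\colon\mathfrak{X}^\bullet(U)\to\mathfrak{X}^{\bullet+1}(U)$ is the Poisson differential (Schouten bracket), and $H^\bullet_{book}(U)$ is the cohomology of $(\mathfrak{X}^\bullet(U),d_{book})$, a ring under the wedge product. Here $\wedge^\bullet\mathrm{span}_{\mathbb{R}}\{\partial_t,u_i\partial_{u_j}\}$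 denotes the real subalgebra (with unit) of $(\mathfrak{X}^\bullet(U),\wedge)$ generated by the vector fields $\partial_t$ and $u_i\partial_{u_j}$, $i,j\in\{1,\dots,n-1\}$; thus wedge products are computed in $\mathfrak{X}^\bullet(U)$ (for instance $(u_1\partial_{u_1})\wedge(u_2\partial_{u_1})=0$). All its elements are $d_{book}$-closed. $\langle E\rangle$ is the ideal of this subalgebra generated by $E$. *)

(* Defs.v *)
From HB Require Import structures.
From mathcomp Require Import all_boot all_order all_algebra.
From mathcomp Require Import generic_quotient ring_quotient ring.
Set Implicit Arguments.
Unset Strict Implicit.
Unset Printing Implicit Defensive.
Import GRing.Theory Num.Theory.
Local Open Scope ring_scope.

Section ExteriorAlgebra.
Variables (n : nat) (K : comPzRingType).

(* The exterior algebra of K^n in coordinates: the coefficient a I of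
   a : extalg is the one of e_I = e_i1 ^ ... ^ e_ip for I = {i1 < ... < ip}.
   The alias keeps the ring structure below apart from the pointwise one. *)
Definition extalg := {ffun {set 'I_n} -> K}.
HB.instance Definition _ := GRing.Zmodule.on extalg.

Implicit Types (a b c : extalg) (I J L M : {set 'I_n}).

Definition inversions I J : nat := \sum_(i in I) \sum_(j in J) (j < i)%N.

(* e_I ^ e_J = shuffle_sign I J * e_(I :|: J) for disjoint I and J. *)
Definition shuffle_sign I J : K := (-1) ^+ inversions I J.

Definition wedge a b : extalg :=
  [ffun M : {set 'I_n} => \sum_(I : {set 'I_n} | I \subset M)
               shuffle_sign I (M :\: I) * (a I * b (M :\: I))].

Definition ext_one : extalg := [ffun I : {set 'I_n} => (I == set0)%:R].

Lemma inversions0l J : inversions set0 J = 0%N.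
Proof. by rewrite /inversions big_set0. Qed.

Lemma inversions0r I : inversions I set0 = 0%N.
Proof. by rewrite /inversions big1 // => i _; rewrite big_set0. Qed.

Lemma inversionsUl I J L : [disjoint I & J] ->
  inversions (I :|: J) L = (inversions I L + inversions J L)%N.
Proof.
move=> dIJ; rewrite /inversions -bigU //=.
by apply: eq_bigl => i; rewrite inE.
Qed.

Lemma inversionsUr I J L : [disjoint J & L] ->
  inversions I (J :|: L) = (inversions I J + inversions I L)%N.
Proof.
move=> dJL; rewrite /inversions -big_split; apply: eq_bigr => i _ /=.
by rewrite -bigU //=; apply: eq_bigl => j; rewrite inE.
Qed.

Lemma wedge1l : left_id ext_one wedge.
Proof.
move=> a; apply/ffunP => M; rewrite ffunE (bigD1 set0) ?sub0set //= big1.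
  rewrite ffunE eqxx setD0 /shuffle_sign inversions0l expr0 !mul1r addr0 //.
by move=> I /andP[_ /negPf nI]; rewrite ffunE nI mul0r mulr0.
Qed.

Lemma wedge1r : right_id ext_one wedge.
Proof.
move=> a; apply/ffunP => M; rewrite ffunE (bigD1 M) //= big1.
  rewrite ffunE setDv eqxx /shuffle_sign inversions0r expr0 mul1r mulr1 addr0 //.
move=> I /andP[sIM nI]; rewrite ffunE setD_eq0 [M \subset I](_ : _ = false) ?mulr0 //.
by apply: contra_neqF nI => sMI; apply/eqP; rewrite eqEsubset sIM.
Qed.

Lemma wedgeDl : left_distributive wedge +%R.
Proof.
move=> a b c; apply/ffunP => M; rewrite !ffunE -big_split; apply: eq_bigr => I _.
by rewrite ffunE mulrDl mulrDr.
Qed.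

Lemma wedgeDr : right_distributive wedge +%R.
Proof.
move=> a b c; apply/ffunP => M; rewrite !ffunE -big_split; apply: eq_bigr => I _.
by rewrite ffunE mulrDr mulrDr.
Qed.

Lemma wedgeA : associative wedge.
Proof.
move=> a b c; apply/ffunP => M; rewrite !ffunE.
have -> : \sum_(L : {set 'I_n} | L \subset M)
    shuffle_sign L (M :\: L) * (wedge a b L * c (M :\: L)) =
  \sum_(L : {set 'I_n} | L \subset M) \sum_(I : {set 'I_n} | I \subset L)
    shuffle_sign L (M :\: L) * (shuffle_sign I (L :\: I) *
       (a I * b (L :\: I)) * c (M :\: L)).
  by apply: eq_bigr => L _; rewrite ffunE mulr_suml mulr_sumr.
rewrite (exchange_big_dep (fun I => I \subset M)) /=; last first.
  by move=> L I sLM sIL; exact: subset_trans sIL sLM.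
apply: eq_bigr => I sIM; rewrite ffunE !mulr_sumr.
rewrite [RHS](reindex_onto (fun J => I :|: J) (fun L => L :\: I)) /=; last first.
  by move=> L /andP[_ sIL]; apply/setP => x; rewrite !inE; case: (boolP (x \in I)) => // /(subsetP sIL) ->.
apply: eq_big => [J|J sJ].
  rewrite subUset sIM subsetUl andbT subsetD /=.
  case: (J \subset M) => //=; rewrite setDUl setDv set0U.
  by apply/idP/idP => [/disjoint_setI0 h|/eqP <-]; [apply/eqP/setDidPl; rewrite disjoint_sym -setI_eq0 setIC h | rewrite disjoints_subset setDE subsetIr].
move: sJ; rewrite subsetD => /andP[sJM dJI].
have dIJ : [disjoint I & J] by rewrite disjoint_sym.
have -> : (I :|: J) :\: I = J.
  by rewrite setDUl setDv set0U; apply/setDidPl.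
rewrite setDDl /shuffle_sign.
set M' := M :\: (I :|: J).
have -> : M :\: I = J :|: M'.
  apply/setP => x; rewrite !inE; case: (boolP (x \in J)) => [xJ|] /=.
    by rewrite (subsetP sJM) // (disjointFr dJI).
  by rewrite orbF.
have dJM : [disjoint J & M'].
  by rewrite disjoints_subset; apply/subsetP => x xJ; rewrite !inE xJ orbT.
rewrite inversionsUl // inversionsUr // !exprD; ring.
Qed.

HB.instance Definition _ := GRing.Zmodule_isPzRing.Build extalg
  wedgeA wedge1l wedge1r wedgeDl wedgeDr.

End ExteriorAlgebra.

Section ExteriorOperations.
Variables (n : nat) (K : comPzRingType).
Local Notation X := (extalg n K).
Implicit Types (f g : K) (a b c v : X) (I J L M : {set 'I_n}) (i j k : 'I_n).

(* K in degree 0. *)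
Definition ext_fun f : X := [ffun I : {set 'I_n} => if I == set0 then f else 0].

Definition ext_basis i : X := [ffun I : {set 'I_n} => (I == [set i])%:R].

Definition hpart (p : nat) a : X :=
  [ffun I : {set 'I_n} => if #|I| == p then a I else 0].

Definition grade_inv a : X := [ffun I : {set 'I_n} => (-1) ^+ #|I| * a I].

(* The right derivative in the odd variable e_i: for i outside I, e_I ^ e_i is
   mapped to e_I, and e_(i |: I) = (-1) ^+ #{j in I | i < j} * e_I ^ e_i. *)
Definition rcontract i a : X :=
  [ffun I : {set 'I_n} => if i \in I then 0
     else (-1) ^+ inversions I [set i] * a (i |: I)].

Lemma ext_fun_mull f a I : (ext_fun f * a) I = f * a I.
Proof.
rewrite /GRing.mul /= ffunE (bigD1 set0) ?sub0set //= big1.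
  by rewrite ffunE eqxx setD0 /shuffle_sign inversions0l expr0 !mul1r addr0.
by move=> J /andP[_ /negPf nJ]; rewrite ffunE nJ mul0r mulr0.
Qed.

Lemma ext_fun_mulr f a I : (a * ext_fun f) I = f * a I.
Proof.
rewrite /GRing.mul /= ffunE (bigD1 I) //= big1.
  by rewrite ffunE setDv eqxx /shuffle_sign inversions0r expr0 mul1r addr0 mulrC.
move=> J /andP[sJI nJ]; rewrite ffunE setD_eq0 [I \subset J](_ : _ = false).
  by rewrite !mulr0.
by apply: contra_neqF nJ => sIJ; apply/eqP; rewrite eqEsubset sJI.
Qed.

Lemma ext_fun_comm f a : ext_fun f * a = a * ext_fun f.
Proof. by apply/ffunP => I; rewrite ext_fun_mull ext_fun_mulr. Qed.

Lemma ext_funM f g : ext_fun (f * g) = ext_fun f * ext_fun g.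
Proof.
by apply/ffunP => I; rewrite ext_fun_mull !ffunE; case: ifP => // _; rewrite mulr0.
Qed.

Lemma ext_fun0 : ext_fun 0 = 0.
Proof. by apply/ffunP => I; rewrite !ffunE; case: ifP. Qed.

Lemma ext_fun1 : ext_fun 1 = 1.
Proof. by apply/ffunP => I; rewrite !ffunE; case: ifP. Qed.

Lemma grade_invD a b : grade_inv (a + b) = grade_inv a + grade_inv b.
Proof. by apply/ffunP => I; rewrite !ffunE mulrDr. Qed.

Lemma grade_inv0 : grade_inv 0 = 0.
Proof. by apply/ffunP => I; rewrite !ffunE mulr0. Qed.

Lemma grade_invN a : grade_inv (- a) = - grade_inv a.
Proof. by apply/ffunP => I; rewrite !ffunE mulrN. Qed.

Lemma grade_invK : involutive grade_inv.
Proof.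
by move=> a; apply/ffunP => I; rewrite !ffunE mulrA -exprD addnn -mul2n exprM sqrrN !expr1n mul1r.
Qed.

Lemma grade_invM a b : grade_inv (a * b) = grade_inv a * grade_inv b.
Proof.
apply/ffunP => M; rewrite /GRing.mul /= !ffunE big_distrr /=.
apply: eq_bigr => I sIM; rewrite !ffunE.
have -> : #|M| = (#|I| + #|M :\: I|)%N by rewrite cardsD (setIidPr sIM) subnKC // subset_leq_card.
by rewrite exprD; ring.
Qed.

Lemma grade_inv_sum (T : Type) (r : seq T) (P : pred T) (F : T -> X) :
  grade_inv (\sum_(i <- r | P i) F i) = \sum_(i <- r | P i) grade_inv (F i).
Proof.
elim/big_rec2: _ => [|t x y _ <-]; last by rewrite grade_invD.
by apply/ffunP => I; rewrite !ffunE mulr0.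
Qed.

Lemma grade_inv_fun f : grade_inv (ext_fun f) = ext_fun f.
Proof.
apply/ffunP => I; rewrite !ffunE; case: ifP => [/eqP ->|_]; last by rewrite mulr0.
by rewrite cards0 expr0 mul1r.
Qed.

Lemma grade_inv_basis i : grade_inv (ext_basis i) = - ext_basis i.
Proof.
apply/ffunP => I; rewrite !ffunE; case: eqP => [->|_]; last by rewrite mulr0 oppr0.
by rewrite cards1 expr1 mulN1r.
Qed.

Lemma rcontractD i a b : rcontract i (a + b) = rcontract i a + rcontract i b.
Proof.
by apply/ffunP => I; rewrite !ffunE; case: ifP => _; rewrite ?addr0 // mulrDr.
Qed.

Lemma rcontractN i a : rcontract i (- a) = - rcontract i a.
Proof.
by apply/ffunP => I; rewrite !ffunE; case: ifP => _; rewrite ?oppr0 // mulrN.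
Qed.

Lemma rcontract_sum i (T : Type) (r : seq T) (P : pred T) (F : T -> X) :
  rcontract i (\sum_(t <- r | P t) F t) = \sum_(t <- r | P t) rcontract i (F t).
Proof.
elim/big_rec2: _ => [|t x y _ <-]; last by rewrite rcontractD.
by apply/ffunP => I; rewrite !ffunE; case: ifP; rewrite ?mulr0.
Qed.

Lemma rcontract_grade_inv i a : rcontract i (grade_inv a) = - grade_inv (rcontract i a).
Proof.
apply/ffunP => I; rewrite !ffunE; case: ifP => iI; first by rewrite mulr0 oppr0.
by rewrite cardsU1 iI exprD expr1; ring.
Qed.

Lemma rcontract_fun i f : rcontract i (ext_fun f) = 0.
Proof.
apply/ffunP => I; rewrite !ffunE; case: ifP => // _.
rewrite [_ == set0](_ : _ = false) ?mulr0 //.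
by apply/negP => /eqP/setP/(_ i); rewrite !inE eqxx.
Qed.

Lemma rcontract_basis i j : rcontract i (ext_basis j) = (i == j)%:R.
Proof.
have -> : ((i == j)%:R : X) = ext_fun (i == j)%:R.
  by case: eqP; rewrite ?ext_fun0 ?ext_fun1.
apply/ffunP => I; rewrite !ffunE.
case: ifP => iI.
  by case: eqP => // I0; move: iI; rewrite I0 inE.
case: (eqVneq I set0) => [->|/set0Pn[k kI]].
  rewrite setU0 inversions0l expr0 mul1r; congr (_%:R); congr nat_of_bool.
  by apply/eqP/eqP => [/setP/(_ i)|->] //; rewrite !inE eqxx => /esym/eqP.
case: eqP => [/setP e|_]; last by rewrite mulr0.
have /eqP ij : i == j by rewrite -(in_set1 i j) -e !inE eqxx.
have /eqP kj : k == j by rewrite -(in_set1 k j) -e !inE kI orbT.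
by move: iI; rewrite ij -kj kI.
Qed.

Lemma inversions_swap i J : i \notin J ->
  (inversions J [set i] + inversions [set i] J)%N = #|J|.
Proof.
move=> iJ; rewrite /inversions big_set1 -sum1_card -big_split /=.
apply: eq_bigr => j jJ; rewrite big_set1.
have : j != i :> nat by apply: contraNneq iJ => /ord_inj <-.
by case: ltngtP.
Qed.

Lemma rcontractM i a b :
  rcontract i (a * b) = a * rcontract i b + rcontract i a * grade_inv b.
Proof.
apply/ffunP => M; rewrite /GRing.mul /= !ffunE.
case: ifP => iM.
  rewrite (bigID (fun I : {set 'I_n} => i \in I)) /=.
  rewrite [X in _ + X + _]big1 ?addr0; last first.
    by move=> I /andP[sIM iI]; rewrite ffunE inE iI iM /= !mulr0.
  rewrite [X in _ = _ + X](bigID (fun I : {set 'I_n} => i \in I)) /=.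
  rewrite [X in _ = _ + (X + _)]big1 ?add0r; last first.
    by move=> I /andP[sIM iI]; rewrite ffunE iI mul0r mulr0.
  rewrite (reindex_onto (fun I => i |: I) (fun I => I :\ i)) /=; last first.
    by move=> I /andP[_ iI]; rewrite setD1K.
  rewrite -[LHS](subrr (\sum_(I : {set 'I_n} | (I \subset M) && (i \notin I))
    shuffle_sign K I (M :\: I) *
      (rcontract i a I * grade_inv b (M :\: I)))).
  rewrite addrC -sumrN; congr (_ + _); apply: eq_big => [I|I].
    rewrite setU11 andbT subUset sub1set iM /=; case: (boolP (i \in I)) => iI.
      rewrite andbF; apply/esym/negbTE/negP => /andP[_ /eqP e].
      by move: iI; rewrite -e !inE eqxx.
    by rewrite setU1K // eqxx.
  case/andP=> sIM niI; rewrite !ffunE (negPf niI).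
  set J := M :\: (i |: I).
  have niJ : i \notin J by rewrite !inE eqxx.
  have -> : M :\: I = i |: J.
    by apply/setP => x; rewrite !inE; case: eqP => [->|]; rewrite ?niI ?iM.
  rewrite (negPf niJ) cardsU1 niJ.
  have d1 : [disjoint [set i] & I] by rewrite disjoints1.
  have d2 : [disjoint [set i] & J] by rewrite disjoints1.
  rewrite /shuffle_sign inversionsUl // inversionsUr // -(inversions_swap niJ).
  rewrite !exprD expr1.
  have sq q : (-1) ^+ q * (-1) ^+ q = 1 :> K.
    by rewrite -exprD addnn -mul2n exprM sqrrN !expr1n.
  have := sq (inversions I [set i]).
  move: ((-1) ^+ inversions I [set i]) => s hs.
  set x := (-1) ^+ inversions [set i] J; set y := (-1) ^+ inversions I J.
  set z := (-1) ^+ inversions J [set i].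
  by transitivity ((s * s) * (x * y * (a (i |: I) * (z * b (i |: J))))); [ring | rewrite hs; ring].
have niM : i \notin M by rewrite iM.
rewrite big_distrr /= (bigID (fun I : {set 'I_n} => i \in I)) /= addrC.
congr (_ + _).
  apply: eq_big => [I|I /andP[sI niI]].
    apply/andP/idP => [[sI niI]|sI].
      apply/subsetP => x xI; move: (subsetP sI x xI); rewrite !inE.
      by case/orP => // /eqP xi; move: niI; rewrite -xi xI.
    split; first exact: subset_trans sI (subsetUr _ _).
    by apply: contra niM => /(subsetP sI).
  have sIM : I \subset M.
    apply/subsetP => x xI; move: (subsetP sI x xI); rewrite !inE.
    by case/orP => // /eqP xi; move: niI; rewrite -xi xI.
  rewrite ffunE inE (negPf niM) andbF.
  have -> : (i |: M) :\: I = i |: (M :\: I).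
    apply/setP => x; rewrite !inE; case: eqP => [->|] //=; by rewrite niI.
  have dM : [disjoint [set i] & M :\: I] by rewrite disjoints1 !inE (negPf niM) andbF.
  rewrite /shuffle_sign inversionsUr //.
  have eM : M = I :|: (M :\: I) by rewrite -[LHS](setID M I) (setIidPr sIM).
  rewrite {1}eM inversionsUl; last first.
    by rewrite disjoints_subset; apply/subsetP => x xI; rewrite !inE xI.
  rewrite !exprD.
  have sq q : (-1) ^+ q * (-1) ^+ q = 1 :> K.
    by rewrite -exprD addnn -mul2n exprM sqrrN !expr1n.
  have := sq (inversions I [set i]).
  move: ((-1) ^+ inversions I [set i]) => s hs.
  set x := (-1) ^+ inversions (M :\: I) [set i]; set y := (-1) ^+ inversions I _.
  rewrite -[RHS]mul1r -hs; ring.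
rewrite (reindex_onto (fun I => i |: I) (fun I => I :\ i)) /=; last first.
  by move=> I /andP[_ iI]; rewrite setD1K.
apply: eq_big => [I|I].
  apply/andP/idP => [[/andP[sI _] /eqP <-]|sI].
    by apply/subsetP => x; rewrite !inE => /andP[xi /orP[/eqP e|xI]]; [move: xi; rewrite e eqxx | move: (subsetP sI x); rewrite !inE (negPf xi) /= => ->; rewrite ?xI ?orbT].
  have niI : i \notin I by apply: contra niM => /(subsetP sI).
  by split; [rewrite setUS // setU11 | rewrite setU1K].
case/andP => /andP[sI _] /eqP e.
have niI : i \notin I by rewrite -e !inE eqxx.
have sIM : I \subset M.
  apply/subsetP => x xI; have := subsetP sI x; rewrite !inE xI orbT => /(_ isT).
  by case/orP => // /eqP xi; move: niI; rewrite -xi xI.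
rewrite !ffunE (negPf niI).
have -> : (i |: M) :\: (i |: I) = M :\: I.
  apply/setP => x; rewrite !inE; case: eqP => [->|] //=; by rewrite (negPf niM) andbF.
have dI : [disjoint [set i] & I] by rewrite disjoints1.
rewrite /shuffle_sign inversionsUl //.
have eM : M = I :|: (M :\: I) by rewrite -[LHS](setID M I) (setIidPr sIM).
have niD : i \notin M :\: I by rewrite !inE (negPf niM) andbF.
rewrite {1}eM inversionsUl; last first.
  by rewrite disjoints_subset; apply/subsetP => x xI; rewrite !inE xI.
by rewrite -(inversions_swap niD) !exprD; ring.
Qed.

Lemma ext_basis_comm i a : ext_basis i * a = grade_inv a * ext_basis i.
Proof.
apply/ffunP => M; rewrite /GRing.mul /= !ffunE.
case: (boolP (i \in M)) => iM; last first.
  rewrite !big1 // => I sIM; rewrite !ffunE; case: eqP => e; rewrite ?mul0r ?mulr0 //.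
    by have := set11 i; rewrite -e inE (negPf iM) andbF.
  by have := subsetP sIM i; rewrite e inE (negPf iM) eqxx => /(_ isT).
rewrite (bigD1 [set i]) ?sub1set //= big1; last first.
  by move=> I /andP[_ /negPf nI]; rewrite ffunE nI mul0r mulr0.
rewrite (bigD1 (M :\ i)) ?subsetDl //= big1; last first.
  move=> I /andP[sIM nI]; rewrite !ffunE; case: eqP => e; rewrite ?mulr0 //.
  by case/eqP: nI; rewrite -e setDDr setDv set0U (setIidPr sIM).
rewrite !ffunE setDDr setDv set0U (setIidPr _) ?sub1set // !eqxx !addr0 mul1r mulr1.
have niD : i \notin M :\ i by rewrite !inE eqxx.
rewrite -(inversions_swap niD) /shuffle_sign exprD !mulrA.
by rewrite -exprD addnn -mul2n exprM sqrrN !expr1n mul1r.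
Qed.

(* Satisfied by the elements of degree 1. *)
Definition odd_comm v := forall a, v * a = grade_inv a * v.

Lemma odd_commD v w : odd_comm v -> odd_comm w -> odd_comm (v + w).
Proof. by move=> hv hw a; rewrite mulrDl mulrDr hv hw. Qed.

Lemma odd_commN v : odd_comm v -> odd_comm (- v).
Proof. by move=> hv a; rewrite mulNr mulrN hv. Qed.

Lemma odd_comm_fun f v : odd_comm v -> odd_comm (ext_fun f * v).
Proof. by move=> hv a; rewrite -mulrA hv mulrA ext_fun_comm !mulrA. Qed.

Lemma odd_comm_sum (T : Type) (r : seq T) (P : pred T) (F : T -> X) :
  (forall t, odd_comm (F t)) -> odd_comm (\sum_(t <- r | P t) F t).
Proof.
move=> h; apply: (big_ind odd_comm) => //; last exact: odd_commD.
by move=> a; rewrite mul0r mulr0.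
Qed.

Lemma even_comm v w a : odd_comm v -> odd_comm w -> v * w * a = a * (v * w).
Proof. by move=> hv hw; rewrite -mulrA hw mulrA hv grade_invK mulrA. Qed.

Definition homogeneous (p : nat) a := forall I, #|I| != p -> a I = 0.

Lemma homogeneousM p q a b :
  homogeneous p a -> homogeneous q b -> homogeneous (p + q) (a * b).
Proof.
move=> ha hb M nM; rewrite /GRing.mul /= ffunE big1 // => I sIM.
have cM : #|M| = (#|I| + #|M :\: I|)%N.
  by rewrite cardsD (setIidPr sIM) subnKC // subset_leq_card.
case: (eqVneq #|I| p) => [eI|/ha ->]; last by rewrite mul0r mulr0.
rewrite hb ?mulr0 //; apply: contraNneq nM => e.
by rewrite cM eI e.
Qed.

Lemma homogeneous_fun f : homogeneous 0 (ext_fun f).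
Proof. by move=> I; rewrite ffunE cards_eq0 => /negPf ->. Qed.

Lemma homogeneous_basis i : homogeneous 1 (ext_basis i).
Proof. by move=> I nI; rewrite ffunE; case: (eqVneq I [set i]) nI => // ->; rewrite cards1. Qed.

Lemma homogeneous_sum p (T : Type) (r : seq T) (P : pred T) (F : T -> X) :
  (forall t, homogeneous p (F t)) -> homogeneous p (\sum_(t <- r | P t) F t).
Proof. by move=> h I nI; rewrite sum_ffunE big1 // => t _; exact: h. Qed.

Lemma hpart_homogeneous p a : homogeneous p a -> hpart p a = a.
Proof.
by move=> h; apply/ffunP => I; rewrite ffunE; case: ifPn => // nI; rewrite h.
Qed.

Section Schouten.
Variable D : 'I_n -> K -> K.
Hypothesis DD : forall i f g, D i (f + g) = D i f + D i g.
Hypothesis DM : forall i f g, D i (f * g) = D i f * g + f * D i g.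

(* D i stands for the partial derivative in the i-th coordinate. *)
Definition cderiv i a : X := [ffun I : {set 'I_n} => D i (a I)].

(* The bilinear extension of the coordinate formula
     [A, B] = \sum_i dA/de_i ^ dB/dx_i
              - (-1)^((p-1)(q-1)) \sum_i dB/de_i ^ dA/dx_i
   for A, B of degrees p, q, where d/de_i are right derivatives.  It extends
   the Lie bracket of vector fields, [X, f] = X(f), and satisfies
   [A, B ^ C] = [A, B] ^ C + (-1)^((p-1)q) B ^ [A, C].  The exponent
   (p+1)(q+1) has the parity of (p-1)(q-1) and no truncated subtraction. *)
Definition schouten_gen a b : X :=
  \sum_i rcontract i a * cderiv i b
  - \sum_(p < n.+1) \sum_(q < n.+1) (-1) ^+ (p.+1 * q.+1) *
      \sum_i rcontract i (hpart q b) * cderiv i (hpart p a).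

Lemma D0 i : D i 0 = 0.
Proof. by apply: (addIr (D i 0)); rewrite -DD !add0r. Qed.


Lemma DN i f : D i (- f) = - D i f.
Proof. by apply/eqP; rewrite eq_sym -subr_eq0 -opprD -DD subrr D0 oppr0. Qed.

Lemma Dsum i (T : Type) (r : seq T) (P : pred T) (F : T -> K) :
  D i (\sum_(t <- r | P t) F t) = \sum_(t <- r | P t) D i (F t).
Proof. by elim/big_rec2: _ => [|t x y _ <-]; rewrite ?D0 ?DD. Qed.

Lemma Dsign i q f : D i ((-1) ^+ q * f) = (-1) ^+ q * D i f.
Proof. by rewrite -signr_odd; case: (odd q); rewrite ?expr1 ?expr0 ?mulN1r ?mul1r ?DN. Qed.

Lemma cderivD i a b : cderiv i (a + b) = cderiv i a + cderiv i b.
Proof. by apply/ffunP => I; rewrite !ffunE DD. Qed.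

Lemma cderiv0 i : cderiv i 0 = 0.
Proof. by apply/ffunP => I; rewrite !ffunE D0. Qed.

Lemma cderiv_sum i (T : Type) (r : seq T) (P : pred T) (F : T -> X) :
  cderiv i (\sum_(t <- r | P t) F t) = \sum_(t <- r | P t) cderiv i (F t).
Proof. by elim/big_rec2: _ => [|t x y _ <-]; rewrite ?cderiv0 ?cderivD. Qed.

Lemma cderivM i a b : cderiv i (a * b) = cderiv i a * b + a * cderiv i b.
Proof.
apply/ffunP => M; rewrite /GRing.mul /= !ffunE Dsum -big_split.
by apply: eq_bigr => I _; rewrite !ffunE Dsign DM mulrDr.
Qed.

Lemma cderiv_fun i f : cderiv i (ext_fun f) = ext_fun (D i f).
Proof. by apply/ffunP => I; rewrite !ffunE; case: ifP; rewrite ?D0. Qed.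

Lemma cderiv_basis i j : cderiv i (ext_basis j) = 0.
Proof.
have D10 : D i 1 = 0.
  by have := DM i 1 1; rewrite !mulr1 mul1r => /eqP; rewrite -subr_eq subrr => /eqP.
by apply/ffunP => I; rewrite !ffunE; case: eqP; rewrite ?D0.
Qed.

Lemma cderiv_grade_inv i a : cderiv i (grade_inv a) = grade_inv (cderiv i a).
Proof. by apply/ffunP => I; rewrite !ffunE Dsign. Qed.

Lemma schouten_genD a b c :
  schouten_gen a (b + c) = schouten_gen a b + schouten_gen a c.
Proof.
have hD q : hpart q (b + c) = hpart q b + hpart q c.
  by apply/ffunP => I; rewrite !ffunE; case: ifP; rewrite ?addr0.
rewrite /schouten_gen addrACA -opprD; congr (_ - _).
  by rewrite -big_split; apply: eq_bigr => i _; rewrite cderivD mulrDr.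
rewrite -big_split; apply: eq_bigr => p _; rewrite -big_split; apply: eq_bigr => q _.
rewrite /= -mulrDr; congr (_ * _); rewrite -big_split; apply: eq_bigr => i _.
by rewrite hD rcontractD mulrDl.
Qed.

Lemma mulX_sign q a I : ((-1) ^+ q * a) I = (-1) ^+ q * a I.
Proof.
by rewrite -!(signr_odd _ q); case: (odd q); rewrite ?expr1 ?expr0 ?mulN1r ?mul1r ?ffunE.
Qed.

Lemma schouten_bivector v b : hpart 2 v = v ->
  schouten_gen v b = \sum_i rcontract i v * cderiv i b
                     - \sum_i grade_inv (rcontract i b) * cderiv i v.
Proof.
move=> v2; rewrite /schouten_gen; congr (_ - _).
have hv p : p != 2%N -> hpart p v = 0.
  move=> np; rewrite -v2; apply/ffunP => I; rewrite !ffunE.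
  by case: eqP => // ->; rewrite (negPf np).
case: (leqP 2 n) => [n2|n2]; last first.
  have v0 : v = 0.
    rewrite -v2; apply/ffunP => I; rewrite !ffunE; case: eqP => // cI.
    by have := max_card (mem I); rewrite cI card_ord leqNgt n2.
  rewrite !big1 // => [i _|p _]; first by rewrite v0 cderiv0 mulr0.
  rewrite big1 // => q _; rewrite big1 ?mulr0 // => i _.
  have -> : hpart p v = 0 by rewrite v0; apply/ffunP => I; rewrite !ffunE; case: ifP.
  by rewrite cderiv0 mulr0.
have lt2 : (2 < n.+1)%N by [].
rewrite (bigD1 (Ordinal lt2)) //= [X in _ + X]big1 ?addr0; last first.
  move=> p np; rewrite big1 // => q _; rewrite big1 ?mulr0 // => i _.
  by rewrite hv ?cderiv0 ?mulr0.
under eq_bigr => q _ do rewrite mulr_sumr.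
rewrite exchange_big; apply: eq_bigr => i _ /=.
under eq_bigr => q _ do rewrite v2 mulrA.
rewrite -mulr_suml; congr (_ * _); apply/ffunP => I; rewrite sum_ffunE !ffunE.
under eq_bigr => q _ do rewrite mulX_sign.
have lI : (#|i |: I| < n.+1)%N by rewrite ltnS -[X in (_ <= X)%N]card_ord max_card.
rewrite (bigD1 (Ordinal lI)) //= big1 ?addr0; last first.
  move=> q nq; rewrite !ffunE; case: ifP => _; rewrite ?mulr0 //.
  case: eqP => [e|_]; last by rewrite !mulr0.
  by case/eqP: nq; apply: val_inj; rewrite /= e.
rewrite !ffunE eqxx; case: ifP => iI; first by rewrite !mulr0.
by congr (_ * _); rewrite cardsU1 iI -signr_odd oddM /= negbK signr_odd.
Qed.

Lemma schouten_derivation v b c : hpart 2 v = v ->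
    (forall i, odd_comm (rcontract i v)) ->
    (forall i a, cderiv i v * a = a * cderiv i v) ->
  schouten_gen v (b * c) = schouten_gen v b * c + grade_inv b * schouten_gen v c.
Proof.
move=> v2 h1 h2; rewrite !schouten_bivector // mulrBl mulrBr addrACA -opprD.
congr (_ - _); rewrite !mulr_suml !mulr_sumr -big_split; apply: eq_bigr => i _ /=.
  by rewrite cderivM mulrDr !mulrA (h1 _ b).
rewrite rcontractM grade_invD !grade_invM grade_invK mulrDl addrC -!mulrA.
by rewrite -(h2 _ c).
Qed.

End Schouten.
End ExteriorOperations.

(* Imported only here: the set notations of classical_sets shadow those of
   finset, which the exterior algebra uses. *)
From mathcomp Require Import all_classical all_reals all_analysis.
Import numFieldNormedType.Exports.
Local Open Scope quotient_scope.
Local Open Scope classical_set_scope.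

(* ring_quotient only quotients commutative rings. *)
Record tsideal (S : pzRingType) := TsIdeal {
  tsideal_set :> S -> Prop;
  tsideal_0 : tsideal_set 0;
  tsideal_B : forall x y, tsideal_set x -> tsideal_set y -> tsideal_set (x - y);
  tsideal_l : forall r x, tsideal_set x -> tsideal_set (r * x);
  tsideal_r : forall r x, tsideal_set x -> tsideal_set (x * r) }.

Section QuotientRing.
Variables (S : pzRingType) (I : tsideal S).

Definition tsideal_pred : {pred S} := fun x => `[< I x >].

Lemma tsideal_zmod_closed : zmod_closed tsideal_pred.
Proof.
split; first exact/asboolP/tsideal_0.
by move=> x y /asboolP hx /asboolP hy; apply/asboolP/tsideal_B.
Qed.
HB.instance Definition _ := GRing.isZmodClosed.Build S tsideal_pred tsideal_zmod_closed.

Definition tsquot := {ideal_quot tsideal_pred}.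
HB.instance Definition _ := GRing.Zmodule.on tsquot.

Definition tsquot_pi (x : S) : tsquot := \pi_({ideal_quot tsideal_pred}) x.

Lemma tsquot_eq x y : (tsquot_pi x = tsquot_pi y) <-> I (x - y).
Proof.
rewrite /tsquot_pi; split=> [/eqP|h].
  by rewrite -Quotient.idealrBE => /asboolP.
by apply/eqP; rewrite -Quotient.idealrBE; apply/asboolP.
Qed.

Lemma tsquot_piB : {morph tsquot_pi : x y / x - y}.
Proof. by move=> x y; rewrite /tsquot_pi !raddfB. Qed.

Lemma tsquot_piD : {morph tsquot_pi : x y / x + y}.
Proof. by move=> x y; rewrite /tsquot_pi !raddfD. Qed.

Lemma tsquot_surj (h : tsquot) : exists x, tsquot_pi x = h.
Proof. by exists (repr h); rewrite /tsquot_pi reprK. Qed.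

Definition tsquot_one : tsquot := tsquot_pi 1.
Definition tsquot_mul (g h : tsquot) : tsquot := tsquot_pi (repr g * repr h).

Lemma tsquot_mulE x y : tsquot_mul (tsquot_pi x) (tsquot_pi y) = tsquot_pi (x * y).
Proof.
have hr z : I (repr (tsquot_pi z) - z) by apply/tsquot_eq; rewrite /tsquot_pi reprK.
apply/tsquot_eq; move: (hr x) (hr y); set x' := repr _; set y' := repr _ => hx hy.
have -> : x' * y' - x * y = (x' - x) * y' - (x * (y - y')).
  by rewrite mulrBl mulrBr opprB addrA subrK.
have hN z : I z -> I (- z).
  by move=> hz; rewrite -sub0r; apply: tsideal_B => //; exact: tsideal_0.
move/hN: hy; rewrite opprB => hy; by apply: tsideal_B; [exact: tsideal_r | exact: tsideal_l].
Qed.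

Lemma tsquot_mulA : associative tsquot_mul.
Proof.
move=> f g h; case: (tsquot_surj f) (tsquot_surj g) (tsquot_surj h) => [x <-] [y <-] [z <-].
by rewrite !tsquot_mulE mulrA.
Qed.

Lemma tsquot_mul1l : left_id tsquot_one tsquot_mul.
Proof. by move=> f; have [x <-] := tsquot_surj f; rewrite tsquot_mulE mul1r. Qed.

Lemma tsquot_mul1r : right_id tsquot_one tsquot_mul.
Proof. by move=> f; have [x <-] := tsquot_surj f; rewrite tsquot_mulE mulr1. Qed.

Lemma tsquot_mulDl : left_distributive tsquot_mul +%R.
Proof.
move=> f g h; case: (tsquot_surj f) (tsquot_surj g) (tsquot_surj h) => [x <-] [y <-] [z <-].
by rewrite -tsquot_piD !tsquot_mulE mulrDl tsquot_piD.
Qed.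

Lemma tsquot_mulDr : right_distributive tsquot_mul +%R.
Proof.
move=> f g h; case: (tsquot_surj f) (tsquot_surj g) (tsquot_surj h) => [x <-] [y <-] [z <-].
by rewrite -tsquot_piD !tsquot_mulE mulrDr tsquot_piD.
Qed.

Lemma tsquot_mul0l : left_zero 0 tsquot_mul.
Proof.
move=> g; apply: (addIr (tsquot_mul 0 g)).
by rewrite -tsquot_mulDl !add0r.
Qed.

Lemma tsquot_mul0r : right_zero 0 tsquot_mul.
Proof.
move=> g; apply: (addIr (tsquot_mul g 0)).
by rewrite -tsquot_mulDr !add0r.
Qed.

HB.instance Definition _ := GRing.Nmodule_isPzSemiRing.Build tsquot
  tsquot_mulA tsquot_mul1l tsquot_mul1r tsquot_mulDl tsquot_mulDr
  tsquot_mul0l tsquot_mul0r.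

Lemma tsquot_pi_monoid : monoid_morphism tsquot_pi.
Proof. by split=> // x y; rewrite -tsquot_mulE. Qed.

HB.instance Definition _ := GRing.isZmodMorphism.Build S tsquot tsquot_pi tsquot_piB.
HB.instance Definition _ := GRing.isMonoidMorphism.Build S tsquot tsquot_pi tsquot_pi_monoid.
End QuotientRing.

(* The least two-sided ideal containing e. *)
Inductive generated_tsideal_set (S : pzRingType) (e : S) : S -> Prop :=
| generated_tsideal_self : generated_tsideal_set e e
| generated_tsideal_0 : generated_tsideal_set e 0
| generated_tsideal_B x y : generated_tsideal_set e x -> generated_tsideal_set e y ->
    generated_tsideal_set e (x - y)
| generated_tsideal_l r x : generated_tsideal_set e x -> generated_tsideal_set e (r * x)
| generated_tsideal_r r x : generated_tsideal_set e x -> generated_tsideal_set e (x * r).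

Definition generated_tsideal (S : pzRingType) (e : S) : tsideal S :=
  @TsIdeal S (generated_tsideal_set e) (generated_tsideal_0 e)
    (@generated_tsideal_B S e) (@generated_tsideal_l S e) (@generated_tsideal_r S e).

Section SmoothFunctions.
Variables (R : realType) (n : nat) (U : set 'rV[R]_n).

(* zext extends a function on U by 0; at a point of the open set U neither the
   continuity nor the derivatives of zext f depend on the values outside U. *)
Local Notation zext := ('valL_(0 : R)).

Definition partial (i : 'I_n) (f : U -> R) : U -> R :=
  fun x => 'D_('e_i) (zext f) (\val x).

Fixpoint Ck (k : nat) (f : U -> R) : Prop :=
  (forall x : U, {for \val x, continuous (zext f)}) /\
  (if k is k'.+1 then
     (forall (i : 'I_n) (x : U),
        derivable (zext f) (\val x) 'e_i) /\
     (forall i : 'I_n, Ck k' (partial i f))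
   else True).

Definition smooth (f : U -> R) : Prop := forall k, Ck k f.

Hypothesis oU : open U.

Lemma valL0_sub (f : U -> R) (x : U) : zext f (\val x) = f x.
Proof. by rewrite /valL_ /= oinv_set_val valK. Qed.

Lemma valL0E (f : U -> R) y (Uy : y \in U) : zext f y = f (SigSub Uy).
Proof. by rewrite -valL0_sub SubK. Qed.

Lemma valL0B (f g : U -> R) : zext (f - g) = zext f - zext g.
Proof.
apply/funext => y /=; rewrite oinv_set_val !fctE /= oinv_set_val.
by case: insub => //=; rewrite subr0.
Qed.

Lemma valL0D (f g : U -> R) : zext (f + g) = zext f + zext g.
Proof.
apply/funext => y /=; rewrite oinv_set_val !fctE /= oinv_set_val.
by case: insub => //=; rewrite addr0.
Qed.

Lemma valL0M (f g : U -> R) : zext (f * g) = zext f * zext g.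
Proof.
apply/funext => y /=; rewrite oinv_set_val !fctE /= oinv_set_val.
by case: insub => //=; rewrite mulr0.
Qed.

Lemma CkW k f : Ck k.+1 f -> Ck k f.
Proof. by elim: k f => [|k IH] f [cf [df pf]]; split=> //; split=> // i; exact: IH. Qed.

Lemma Ck_cont k f (x : U) : Ck k f -> {for \val x, continuous (zext f)}.
Proof. by case: k => [|k] []. Qed.

Lemma CkB k f g : Ck k f -> Ck k g -> Ck k (f - g).
Proof.
elim: k f g => [|k IH] f g [cf hf] [cg hg]; rewrite /= valL0B; split=> //.
- by move=> x; apply: (@continuousB _ _ _ _ _ _ (cf x) (cg x)).
- by move=> x; apply: (@continuousB _ _ _ _ _ _ (cf x) (cg x)).
case: hf hg => df pf [dg pg]; split=> i; first by move=> x; apply: derivableB; [exact: df | exact: dg].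
suff -> : partial i (f - g) = partial i f - partial i g by apply: IH; [exact: pf|exact: pg].
by apply/funext => x; rewrite /partial valL0B deriveB // !fctE.
Qed.

Lemma CkD k f g : Ck k f -> Ck k g -> Ck k (f + g).
Proof.
elim: k f g => [|k IH] f g [cf hf] [cg hg]; rewrite /= valL0D; split=> //.
- by move=> x; apply: (@continuousD _ _ _ _ _ _ (cf x) (cg x)).
- by move=> x; apply: (@continuousD _ _ _ _ _ _ (cf x) (cg x)).
case: hf hg => df pf [dg pg]; split=> i; first by move=> x; apply: derivableD; [exact: df | exact: dg].
suff -> : partial i (f + g) = partial i f + partial i g by apply: IH; [exact: pf|exact: pg].
by apply/funext => x; rewrite /partial valL0D deriveD // !fctE.
Qed.

Lemma partialM i f g : 
  (forall x : U, derivable (zext f) (\val x) 'e_i) ->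
  (forall x : U, derivable (zext g) (\val x) 'e_i) ->
  partial i (f * g) = partial i f * g + f * partial i g.
Proof.
move=> df dg; apply/funext => x; rewrite /partial valL0M deriveM //.
by rewrite !valL0_sub !fctE addrC; congr (_ + _); rewrite /GRing.scale /= mulrC.
Qed.

Lemma CkM k f g : Ck k f -> Ck k g -> Ck k (f * g).
Proof.
elim: k f g => [|k IH] f g hf hg; rewrite /= valL0M; split=> //.
- by move=> x; apply: (@continuousM _ _ _ _ _ (Ck_cont hf) (Ck_cont hg)).
- by move=> x; apply: (@continuousM _ _ _ _ _ (Ck_cont hf) (Ck_cont hg)).
move: (CkW hf) (CkW hg) => wf wg.
case: hf hg => _ [df pf] [_ [dg pg]]; split=> i; first by move=> x; apply: derivableM; [exact: df | exact: dg].
rewrite partialM; [|by move=> x; exact: df|by move=> x; exact: dg].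
by apply: CkD; apply: IH => //; [exact: pf|exact: pg].
Qed.

Lemma near_restr (F : 'rV[R]_n -> R) (x : U) :
  \forall y \near (\val x : 'rV[R]_n), F y = zext (F \o \val : U -> R) y.
Proof.
near=> y; have Uy : y \in U.
  by rewrite inE; near: y; apply: open_nbhs_nbhs; split=> //; exact: set_valP.
by rewrite valL0E.
Unshelve. all: by end_near. Qed.

Lemma restr_derivable (F : 'rV[R]_n -> R) i (x : U) :
  derivable F (\val x) 'e_i ->
  derivable (zext (F \o \val : U -> R)) (\val x) 'e_i.
Proof. exact: (near_eq_derivable (near_restr F x)). Qed.

Lemma partial_restr (F : 'rV[R]_n -> R) i (x : U) :
  partial i (F \o \val) x = 'D_('e_i) F (\val x).
Proof. exact: (esym (near_eq_derive _ (near_restr F x))). Qed.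

Lemma restr_cont (F : 'rV[R]_n -> R) (x : U) :
  {for \val x, continuous F} ->
  {for \val x, continuous (zext (F \o \val : U -> R))}.
Proof.
move=> cF; rewrite /prop_for /continuous_at valL0_sub.
exact: cvg_trans (near_eq_cvg (near_restr F x)) cF.
Qed.

Lemma partial_cst i (c : R) : partial i (fun=> c) = fun=> 0.
Proof. by apply/funext => x; rewrite (partial_restr (cst c)) derive_cst. Qed.

Lemma smooth_cst (c : R) : smooth (fun=> c).
Proof.
move=> k; elim: k c => [|k IH] c; split=> //.
- by move=> x; apply: (restr_cont (F := cst c)); exact: cst_continuous.
- by move=> x; apply: (restr_cont (F := cst c)); exact: cst_continuous.
split=> i; first by move=> x; apply: (restr_derivable (F := cst c)); exact: derivable_cst.
by rewrite partial_cst.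
Qed.

Definition coord (j : 'I_n) : U -> R := fun x => \val x 0 j.

Lemma derivable_coord (j : 'I_n) (x v : 'rV[R]_n) :
  derivable (fun y : 'rV[R]_n => y 0 j) x v.
Proof.
by apply: diff_derivable; exact: differentiable_coord.
Qed.

Lemma derive_coord (j : 'I_n) (x v : 'rV[R]_n) :
  'D_v (fun y : 'rV[R]_n => y 0 j) x = v 0 j.
Proof.
rewrite /derive; apply/cvg_lim => //.
apply: (@cvg_trans _ (cst (v 0 j) @ 0^')); last exact: cvg_cst.
apply: near_eq_cvg; near=> h.
rewrite /= !mxE /= addrK /GRing.scale /= mulKf //.
by near: h; exact: nbhs_dnbhs_neq.
Unshelve. all: by end_near. Qed.

Lemma partial_coord i j : partial i (coord j) = fun=> (i == j)%:R.
Proof.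
apply/funext => x; rewrite (partial_restr (fun y => y 0 j)) derive_coord !mxE eqxx.
by rewrite eq_sym.
Qed.

Lemma smooth_coord j : smooth (coord j).
Proof.
have cc (x : U) : {for \val x, continuous (zext (coord j))}.
  by apply: (restr_cont (F := fun y => y 0 j)); exact: coord_continuous.
case=> [|k]; split=> //; split=> i.
  by move=> x; apply: (restr_derivable (F := fun y => y 0 j)); exact: derivable_coord.
by rewrite partial_coord; exact: smooth_cst.
Qed.

End SmoothFunctions.

Section SmoothRing.
Variables (R : realType) (n : nat) (U : set 'rV[R]_n) (oU : open U).

(* Openness is needed for constants to be smooth; carrying oU in the predicate
   makes it available to the ring structure. *)
Definition smooth_pred (_ : open U) : {pred U -> R} := fun f => `[< smooth f >].

Lemma smooth_subring_closed : subring_closed (smooth_pred oU).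
Proof.
split=> [|f g /asboolP hf /asboolP hg|f g /asboolP hf /asboolP hg]; apply/asboolP.
- exact: (smooth_cst oU).
- by move=> k; exact: CkB.
- by move=> k; exact: CkM.
Qed.
HB.instance Definition _ :=
  GRing.isSubringClosed.Build (U -> R) (smooth_pred oU) smooth_subring_closed.

(* The ring of smooth functions on U. *)
Record smooth_fun := SmoothFun {
  smooth_val :> U -> R;
  smooth_valP : smooth_val \in smooth_pred oU }.
HB.instance Definition _ := [isSub for smooth_val].
HB.instance Definition _ := [Choice of smooth_fun by <:].
HB.instance Definition _ := GRing.SubChoice_isSubComPzRing.Build _ _ smooth_fun smooth_subring_closed.

Lemma smooth_funP (f : smooth_fun) : smooth f.
Proof. exact/asboolP/smooth_valP. Qed.

Lemma partial_smooth i (f : smooth_fun) : partial i f \in smooth_pred oU.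
Proof. by apply/asboolP => k; have [_ [_ pf]] := smooth_funP f k.+1; exact: pf. Qed.

Definition smooth_partial i (f : smooth_fun) : smooth_fun :=
  SmoothFun (partial_smooth i f).

Definition smooth_const (c : R) : smooth_fun :=
  SmoothFun (asboolT (smooth_cst oU c)).

Definition smooth_coordinate (j : 'I_n) : smooth_fun :=
  SmoothFun (asboolT (smooth_coord oU j)).

Lemma smooth_partialD i f g :
  smooth_partial i (f + g) = smooth_partial i f + smooth_partial i g.
Proof.
have [_ [df _]] := smooth_funP f 1; have [_ [dg _]] := smooth_funP g 1.
apply: val_inj => /=; apply/funext => x.
by rewrite /partial valL0D deriveD.
Qed.

Lemma smooth_partialM i f g :
  smooth_partial i (f * g) = smooth_partial i f * g + f * smooth_partial i g.
Proof.
have [_ [df _]] := smooth_funP f 1; have [_ [dg _]] := smooth_funP g 1.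
by apply: val_inj; apply: partialM => x; [exact: df|exact: dg].
Qed.

Lemma smooth_partial_const i c : smooth_partial i (smooth_const c) = 0.
Proof. by apply: val_inj; exact: partial_cst. Qed.

Lemma smooth_partial_coord i j :
  smooth_partial i (smooth_coordinate j) = (i == j)%:R.
Proof.
apply: val_inj => /=; rewrite partial_coord //.
by case: eqP => _.
Qed.

(* The algebra X(U) of multivector fields, i.e. the direct sum of all X^k(U);
   the coefficient at I is the one of d/dx_i1 ^ ... ^ d/dx_ip. *)
Definition multivector := extalg n smooth_fun.
HB.instance Definition _ := GRing.PzRing.on multivector.

Definition schouten (a b : multivector) : multivector :=
  schouten_gen smooth_partial a b.

End SmoothRing.

Section Book.
Variables (R : realType) (m : nat) (U : set 'rV[R]_m.+1) (oU : open U).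
Local Notation X := (multivector oU).
Local Notation tI := (ord0 : 'I_m.+1).
Local Notation uI j := (lift ord0 j : 'I_m.+1).

(* 'rV_m.+1 is R x R^m: the coordinate t has index ord0, and u_j has index
   lift ord0 j. *)
Definition proj_u (x : 'rV[R]_m.+1) : 'rV[R]_m := \row_j x 0 (uI j).

Definition d_t : X := ext_basis (smooth_fun oU) tI.
Definition d_u (j : 'I_m) : X := ext_basis (smooth_fun oU) (uI j).
Definition u_ (j : 'I_m) : X := ext_fun _ (smooth_coordinate oU (uI j)).
Definition euler : X := \sum_(j < m) u_ j * d_u j.
Definition book : X := d_t * euler.
Definition d_book : X -> X := schouten book.

Let DD := @smooth_partialD R m.+1 U oU.
Let DM := @smooth_partialM R m.+1 U oU.

Lemma d_tK : odd_comm d_t.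
Proof. by move=> a; exact: ext_basis_comm. Qed.

Lemma u_d_uK i j : odd_comm (u_ i * d_u j).
Proof. by apply: odd_comm_fun => a; exact: ext_basis_comm. Qed.

Lemma book_homogeneous : hpart 2 book = book.
Proof.
apply: hpart_homogeneous; apply: (@homogeneousM _ _ 1 1); first exact: homogeneous_basis.
apply: homogeneous_sum => j.
by apply: (@homogeneousM _ _ 0 1); [exact: homogeneous_fun|exact: homogeneous_basis].
Qed.

Lemma rcontract_euler i : rcontract i euler = \sum_(j < m) u_ j * (i == uI j)%:R.
Proof.
rewrite rcontract_sum; apply: eq_bigr => j _.
by rewrite rcontractM rcontract_fun mul0r addr0 rcontract_basis.
Qed.

Lemma rcontract_book i :
  rcontract i book = d_t * rcontract i euler + (i == tI)%:R * grade_inv euler.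
Proof. by rewrite rcontractM rcontract_basis. Qed.

Lemma cderiv_book i : cderiv (@smooth_partial _ _ _ oU) i book =
  d_t * \sum_(j < m) (i == uI j)%:R * d_u j.
Proof.
rewrite cderivM // cderiv_basis // mul0r add0r; congr (_ * _).
rewrite cderiv_sum //; apply: eq_bigr => j _.
rewrite cderivM // cderiv_basis // mulr0 addr0 cderiv_fun // smooth_partial_coord.
by case: eqP => _; rewrite ?ext_fun1 ?ext_fun0.
Qed.

Lemma rcontract_bookK i : odd_comm (rcontract i book).
Proof.
rewrite rcontract_book; apply: odd_commD.
  rewrite rcontract_euler mulr_sumr; apply: odd_comm_sum => j.
  case: eqP => _; last by rewrite !mulr0 => a; rewrite mul0r mulr0.
  by rewrite mulr1 -ext_fun_comm; apply: odd_comm_fun; exact: d_tK.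
case: eqP => _; last by move=> a; rewrite !mul0r mulr0.
rewrite mul1r grade_inv_sum; apply: odd_comm_sum => j.
rewrite grade_invM grade_inv_fun grade_inv_basis mulrN; apply: odd_commN.
exact: u_d_uK.
Qed.

Lemma cderiv_bookK i a : cderiv (@smooth_partial _ _ _ oU) i book * a =
  a * cderiv (@smooth_partial _ _ _ oU) i book.
Proof.
rewrite cderiv_book even_comm //; first exact: d_tK.
apply: odd_comm_sum => j; case: eqP => _ b; first by rewrite mul1r; exact: ext_basis_comm.
by rewrite !mul0r mulr0.
Qed.

Lemma d_bookE a : d_book a =
  \sum_i rcontract i book * cderiv (@smooth_partial _ _ _ oU) i a
  - \sum_i grade_inv (rcontract i a) * cderiv (@smooth_partial _ _ _ oU) i book.
Proof. by apply: schouten_bivector => //; exact: book_homogeneous. Qed.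

Lemma d_bookM a b : d_book (a * b) = d_book a * b + grade_inv a * d_book b.
Proof.
apply: schouten_derivation => //; first exact: book_homogeneous.
  exact: rcontract_bookK.
exact: cderiv_bookK.
Qed.

Lemma grade_inv_book : grade_inv book = book.
Proof.
apply/ffunP => I; rewrite ffunE -book_homogeneous ffunE.
by case: eqP => [->|_]; rewrite ?mulr0 // sqrrN expr1n mul1r.
Qed.

Lemma d_book_grade_inv a : d_book (grade_inv a) = - grade_inv (d_book a).
Proof.
rewrite !d_bookE grade_invD grade_invN opprD opprK !grade_inv_sum.
congr (_ + _); last first.
  rewrite -sumrN; apply: eq_bigr => i _.
  rewrite rcontract_grade_inv grade_invN grade_invM !grade_invK mulNr opprK.
  by rewrite -cderiv_grade_inv // grade_inv_book.
rewrite -sumrN; apply: eq_bigr => i _; rewrite grade_invM cderiv_grade_inv //.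
by rewrite -{1}grade_inv_book rcontract_grade_inv mulNr.
Qed.

Lemma d_bookD a b : d_book (a + b) = d_book a + d_book b.
Proof. exact: schouten_genD. Qed.

Lemma d_book0 : d_book 0 = 0.
Proof. by apply: (addIr (d_book 0)); rewrite -d_bookD !add0r. Qed.

Lemma d_bookN a : d_book (- a) = - d_book a.
Proof. by apply/eqP; rewrite eq_sym -subr_eq0 -opprD -d_bookD subrr d_book0 oppr0. Qed.

Lemma d_book_const c : d_book (ext_fun _ (smooth_const oU c)) = 0.
Proof.
rewrite d_bookE !big1 ?subrr // => i _; first by rewrite rcontract_fun grade_inv0 mul0r.
by rewrite cderiv_fun // smooth_partial_const ext_fun0 mulr0.
Qed.

Lemma d_book_t : d_book d_t = 0.
Proof.
rewrite d_bookE big1 ?sub0r => [|i _]; last by rewrite cderiv_basis // mulr0.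
rewrite big1 ?oppr0 // => i _; rewrite rcontract_basis.
case: eqP => [->|_]; last first.
  by rewrite grade_inv0 mul0r.
rewrite cderiv_book big1 ?mulr0 // => j _.
by rewrite (_ : _ == _ = false) ?mul0r //; apply/negbTE/neq_lift.
Qed.

Lemma d_book_lin i j : d_book (u_ i * d_u j) = 0.
Proof.
rewrite d_bookE; apply/eqP; rewrite subr_eq0; apply/eqP.
transitivity (d_t * u_ i * d_u j).
  rewrite (bigD1 (uI i)) //= big1 ?addr0 => [|k nk].
    rewrite cderivM // cderiv_basis // mulr0 addr0 cderiv_fun // smooth_partial_coord.
    rewrite eqxx ext_fun1 mul1r rcontract_book lift_eqF mul0r addr0 rcontract_euler.
    rewrite (bigD1 i) //= eqxx mulr1 big1 ?addr0 // => k nk.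
    by rewrite (inj_eq lift_inj) eq_sym (negPf nk) mulr0.
  rewrite cderivM // cderiv_basis // mulr0 addr0 cderiv_fun // smooth_partial_coord.
  by rewrite (negPf nk) ext_fun0 mul0r mulr0.
apply/esym; rewrite (bigD1 (uI j)) //= big1 ?addr0 => [|k nk].
  rewrite rcontractM rcontract_fun mul0r addr0 rcontract_basis eqxx mulr1 grade_inv_fun.
  rewrite cderiv_book (bigD1 j) //= eqxx mul1r big1 ?addr0 => [|k nk].
    by rewrite mulrA ext_fun_comm.
  by rewrite (inj_eq lift_inj) eq_sym (negPf nk) mul0r.
rewrite rcontractM rcontract_fun mul0r addr0 rcontract_basis (negPf nk) mulr0.
by rewrite grade_inv0 mul0r.
Qed.

Definition cocycle_pred (_ : open U) : {pred X} := fun a => d_book a == 0.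

Lemma cocycle_subring_closed : subring_closed (cocycle_pred oU).
Proof.
rewrite /cocycle_pred; split=> [|a b /eqP ha /eqP hb|a b /eqP ha /eqP hb]; apply/eqP.
- have -> : (1 : X) = ext_fun _ (smooth_const oU 1) by rewrite -ext_fun1; congr ext_fun; exact: val_inj.
  exact: d_book_const.
- by rewrite d_bookD d_bookN ha hb subr0.
- by rewrite d_bookM ha hb mul0r mulr0 addr0.
Qed.
HB.instance Definition _ :=
  GRing.isSubringClosed.Build X (cocycle_pred oU) cocycle_subring_closed.

Record cocycle := Cocycle { cocycle_val :> X; cocycleP : cocycle_val \in cocycle_pred oU }.
HB.instance Definition _ := [isSub for cocycle_val].
HB.instance Definition _ := [Choice of cocycle by <:].
HB.instance Definition _ := GRing.SubChoice_isSubPzRing.Build _ _ cocycle cocycle_subring_closed.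

(* As d_book \o d_book = 0, these are all the elements of the image of d_book. *)
Definition boundary_set (z : cocycle) : Prop := exists a : X, val z = d_book a.

Lemma boundary0 : boundary_set 0.
Proof. by exists 0; rewrite d_book0. Qed.

Lemma boundaryB x y : boundary_set x -> boundary_set y -> boundary_set (x - y).
Proof. by move=> [a ha] [b hb]; exists (a - b); rewrite d_bookD d_bookN -ha -hb. Qed.

Lemma d_cocycle (z : cocycle) : d_book (val z) = 0.
Proof. exact/eqP/cocycleP. Qed.

Lemma boundary_l r x : boundary_set x -> boundary_set (r * x).
Proof.
move=> [a ha]; exists (grade_inv (val r) * a).
rewrite d_bookM grade_invK -ha /=.
suff -> : d_book (grade_inv (val r)) = 0 by rewrite mul0r add0r.
by rewrite d_book_grade_inv d_cocycle grade_inv0 oppr0.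
Qed.

Lemma boundary_r r x : boundary_set x -> boundary_set (x * r).
Proof.
by move=> [a ha]; exists (a * val r); rewrite d_bookM d_cocycle mulr0 addr0 -ha.
Qed.

Definition boundary : tsideal cocycle :=
  @TsIdeal _ boundary_set boundary0 boundaryB boundary_l boundary_r.

(* The cohomology of the total complex.  As d_book is homogeneous of degree 1,
   it is the direct sum of the H^k, with the wedge product. *)
Definition H_book := tsquot boundary.
HB.instance Definition _ := GRing.PzRing.on H_book.

(* The real subalgebra with unit of X(U) generated by d_t and the u_i d_(u_j);
   linear_const gives the unit and the scalars. *)
Inductive linear_multivector : X -> Prop :=
| linear_const c : linear_multivector (ext_fun _ (smooth_const oU c))
| linear_t : linear_multivector d_t
| linear_u i j : linear_multivector (u_ i * d_u j)
| linear_add a b : linear_multivector a -> linear_multivector b -> linear_multivector (a + b)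
| linear_mul a b : linear_multivector a -> linear_multivector b -> linear_multivector (a * b).

Definition linear_pred (_ : open U) : {pred X} := fun a => `[< linear_multivector a >].

Lemma linear_subring_closed : subring_closed (linear_pred oU).
Proof.
have l1 c : linear_multivector (ext_fun _ (smooth_const oU c)) by exact: linear_const.
have e1 : ext_fun _ (smooth_const oU 1) = 1 :> X.
  by rewrite -ext_fun1; congr ext_fun; exact: val_inj.
have eN : ext_fun _ (smooth_const oU (-1)) = -1 :> X.
  rewrite -e1; apply/ffunP => I; rewrite !ffunE; case: eqP => _; rewrite ?oppr0 //.
  exact: val_inj.
split=> [|a b /asboolP ha /asboolP hb|a b /asboolP ha /asboolP hb]; apply/asboolP.
- by rewrite -e1.
- by apply: linear_add => //; rewrite -mulN1r -eN; apply: linear_mul.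
- exact: linear_mul.
Qed.
HB.instance Definition _ :=
  GRing.isSubringClosed.Build X (linear_pred oU) linear_subring_closed.

Record linear_alg := LinearAlg {
  linear_val :> X; linear_valP : linear_val \in linear_pred oU }.
HB.instance Definition _ := [isSub for linear_val].
HB.instance Definition _ := [Choice of linear_alg by <:].
HB.instance Definition _ := GRing.SubChoice_isSubPzRing.Build _ _ linear_alg linear_subring_closed.

Lemma linear_cocycle a : linear_multivector a -> d_book a = 0.
Proof.
elim=> [c||i j|b c _ hb _ hc|b c _ hb _ hc].
- exact: d_book_const.
- exact: d_book_t.
- exact: d_book_lin.
- by rewrite d_bookD hb hc addr0.
- by rewrite d_bookM hb hc mul0r mulr0 addr0.
Qed.

Lemma linear_algP (mu : linear_alg) : linear_val mu \in cocycle_pred oU.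
Proof. by apply/eqP/linear_cocycle/asboolP/linear_valP. Qed.

(* mu |-> [mu] *)
Definition book_class (mu : linear_alg) : H_book := tsquot_pi boundary (Cocycle (linear_algP mu)).

Lemma book_class_zmod : zmod_morphism book_class.
Proof. by move=> a b; rewrite /book_class -raddfB; congr tsquot_pi; exact: val_inj. Qed.

Lemma book_class_monoid : monoid_morphism book_class.
Proof.
split=> [|a b]; rewrite /book_class.
  by rewrite -[RHS](rmorph1 (tsquot_pi boundary)); congr tsquot_pi; exact: val_inj.
by rewrite -[RHS](rmorphM (tsquot_pi boundary)); congr tsquot_pi; exact: val_inj.
Qed.

HB.instance Definition _ := GRing.isZmodMorphism.Build linear_alg H_book book_class book_class_zmod.
HB.instance Definition _ := GRing.isMonoidMorphism.Build linear_alg H_book book_class book_class_monoid.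

Lemma euler_linear : euler \in linear_pred oU.
Proof.
apply: (@rpred_sum _ (linear_pred oU)) => j _; exact/asboolP/linear_u.
Qed.
Definition linear_euler : linear_alg := LinearAlg euler_linear.

Definition linear_mod_euler := tsquot (generated_tsideal linear_euler).
HB.instance Definition _ := GRing.PzRing.on linear_mod_euler.
End Book.


Definition star_shaped0 (R : realType) (m : nat) (A : set 'rV[R]_m) : Prop :=
  A 0 /\ forall (v : 'rV[R]_m) (s : R), A v -> 0 <= s <= 1 -> A (s *: v).

(* Main.v *)
(* Write a multivector field as a = a0 + d_t a1 with a0, a1 free of d_t, let
   T = d/dt act on coefficients and let L = [E, .], so that L (f e_M) =
   (E f - q f) e_M when e_M has q factors d_u.  Then d_book a =
   d_t L a - E T a, and L and T commute with each other and with the wedge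
   products by d_t and E.  The linear multivectors are the kernel of T and L:
   a smooth solution of E f = q f near u = 0 is a homogeneous polynomial of
   degree q.

   Three facts are used.
   (1) T is onto C^inf(U): on the part of U above a small ball of the u-space
   one integrates from a constant time, and a partition of unity in u glues.
   (2) On C^inf(U), E x = 0 implies x = E y, provided the top coefficient of x
   vanishes at u = 0; if T x = 0 one can take T y = 0.  Near u = 0 this is the
   homotopy of the Koszul complex composed with the inverse of E + w, which is
   f |-> int_0^1 s^(w-1) f(s u) ds; away from u = 0 one divides by a
   coordinate; a partition of unity glues.
   (3) On ker T, that is, on functions of u in the star-shaped set p(U), every
   x is h + L y with L h = 0, and ker L meets the image of L in 0.

   A cocycle satisfies E T a0 = 0 and L a0 + E T a1 = 0.  By (2) and (1),
   T a0 = E T c, so up to a coboundary T a0 = 0; by (2) and (3) one may then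
   assume L a0 = 0, hence E T a1 = 0.  After correcting the top coefficient of
   a1 by a coboundary the same argument makes T a1 = 0 and L a1 = 0.  Run
   backwards, it shows that a linear multivector which is a coboundary is a
   multiple of E by a linear one. *)
Require Import Defs.
From HB Require Import structures.
From mathcomp Require Import all_boot all_order all_algebra.
From mathcomp Require Import ring.
Import GRing.Theory Num.Theory.
Set Implicit Arguments.
Unset Strict Implicit.
Unset Printing Implicit Defensive.
Local Open Scope ring_scope.

(** * Exterior algebra *)

(** Only p(U) is star-shaped: scaling u leaves U, so the radial integrals do not act on C^inf(U).
    They are available in two situations, on all functions on a ball centred at a point with u = 0,
    and on functions of u alone, which live on R x p(U). Hence the algebra is done over a
    commutative ring [K] with commuting derivations and a family [S w], the inverse of E + w + 1 on
    a class [C] of elements; the analysis only supplies instances of [C] and [S]. For C = ker T the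
    homotopy also keeps the solution in ker T, which gluing local solutions of E x = 0 does not
    provide. The condition on the top coefficient is the one obstruction in the Koszul complex of
    u_1, ..., u_m: its cohomology sits in top degree, where it is the functions modulo the ideal of
    the u_j. The predicate [Z] (vanishing at u = 0) replaces that ideal. The ideal of E enters the
    answer because E = d_book(-t). *)

Section ExteriorBasis.
Variables (n : nat) (K : comPzRingType).
Local Notation X := (extalg n K).
Local Notation e_ := (@ext_basis n K).
Implicit Types (a b : X) (I J M : {set 'I_n}) (i j : 'I_n) (f : K).

Lemma signK k : (-1) ^+ k * (-1) ^+ k = 1 :> K.
Proof. by rewrite -exprD addnn -mul2n exprM sqrrN !expr1n. Qed.

Lemma mul_basisr a i M :
  (a * e_ i) M = if i \in M then (-1) ^+ inversions (M :\ i) [set i] * a (M :\ i) else 0.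
Proof.
rewrite /GRing.mul /= ffunE; case: ifPn => iM; last first.
  rewrite big1 // => I sIM; rewrite ffunE; case: eqP => e; rewrite ?mulr0 //.
  by have := set11 i; rewrite -e inE (negPf iM) andbF.
rewrite (bigD1 (M :\ i)) ?subsetDl //= big1 ?addr0; last first.
  move=> I /andP[sIM nI]; rewrite ffunE; case: eqP => e; rewrite ?mulr0 //.
  by case/eqP: nI; rewrite -e setDDr setDv set0U (setIidPr sIM).
by rewrite ffunE setDDr setDv set0U (setIidPr _) ?sub1set // eqxx mulr1.
Qed.

Lemma mul_basisl a i M :
  (e_ i * a) M = if i \in M then (-1) ^+ inversions [set i] (M :\ i) * a (M :\ i) else 0.
Proof.
rewrite ext_basis_comm mul_basisr; case: ifP => // iM; rewrite ffunE mulrA -exprD.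
have niM : i \notin M :\ i by rewrite !inE eqxx.
by rewrite -(inversions_swap niM) addnA exprD exprD signK mul1r.
Qed.

(** The sign in [rcontract] is the one for which multiplying back on the right leaves none. *)
Lemma rcontract_mul_basis a i M : (rcontract i a * e_ i) M = if i \in M then a M else 0.
Proof.
rewrite mul_basisr; case: ifP => // iM; rewrite ffunE !inE eqxx /=.
by rewrite mulrA signK mul1r setD1K.
Qed.

Lemma extD a b M : (a + b) M = a M + b M. Proof. exact: ffunE. Qed.
Lemma extN a M : (- a) M = - a M. Proof. exact: ffunE. Qed.
Lemma ext0 M : (0 : X) M = 0. Proof. exact: ffunE. Qed.

Definition omits i a := forall M, i \in M -> a M = 0.
Definition without i a : X := [ffun M : {set 'I_n} => if i \in M then 0 else a M].
(** The left derivative, as opposed to [rcontract]: it reads off a1 in a = a0 + d_t a1, where d_t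
    stands on the left. *)
Definition lcontract i a : X :=
  [ffun M : {set 'I_n} => if i \in M then 0 else (-1) ^+ inversions [set i] M * a (i |: M)].

Lemma without_omits i a : omits i (without i a).
Proof. by move=> M iM; rewrite ffunE iM. Qed.

Lemma lcontract_omits i a : omits i (lcontract i a).
Proof. by move=> M iM; rewrite ffunE iM. Qed.

Lemma omits_without i a : omits i a -> without i a = a.
Proof. by move=> h; apply/ffunP => M; rewrite ffunE; case: ifP => // /h. Qed.

Lemma withoutD i a b : without i (a + b) = without i a + without i b.
Proof. by apply/ffunP => M; rewrite !ffunE; case: ifP; rewrite ?addr0. Qed.

Lemma without_mul_basis i a : without i (e_ i * a) = 0.
Proof. by apply/ffunP => M; rewrite [LHS]ffunE [RHS]ffunE mul_basisl; case: ifP => // ->. Qed.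

Lemma lcontractD i a b : lcontract i (a + b) = lcontract i a + lcontract i b.
Proof. by apply/ffunP => M; rewrite !ffunE; case: ifP; rewrite ?addr0 // mulrDr. Qed.

Lemma omits_lcontract i a : omits i a -> lcontract i a = 0.
Proof.
by move=> h; apply/ffunP => M; rewrite !ffunE; case: ifP => // _; rewrite h ?setU11 // mulr0.
Qed.

Lemma lcontract_mul_basis i a : lcontract i (e_ i * a) = without i a.
Proof.
apply/ffunP => M; rewrite [LHS]ffunE [RHS]ffunE; case: ifPn => // iM.
by rewrite mul_basisl setU11 setU1K // mulrA signK mul1r.
Qed.

Lemma split_basis i a : a = without i a + e_ i * lcontract i a.
Proof.
apply/ffunP => M; rewrite [RHS]ffunE [without i a M]ffunE mul_basisl.
case: ifP => iM; last by rewrite addr0.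
by rewrite ffunE !inE eqxx /= mulrA signK mul1r setD1K // add0r.
Qed.

Lemma split_basis0 i a b : omits i a -> omits i b -> a + e_ i * b = 0 -> a = 0 /\ b = 0.
Proof.
move=> ha hb e; split.
  have := congr1 (without i) e; rewrite withoutD without_mul_basis addr0 omits_without // => ->.
  by apply/ffunP => M; rewrite !ffunE; case: ifP.
have := congr1 (lcontract i) e.
rewrite lcontractD lcontract_mul_basis omits_lcontract // add0r omits_without // => ->.
by apply/ffunP => M; rewrite !ffunE mulr0; case: ifP.
Qed.

Lemma omitsD i a b : omits i a -> omits i b -> omits i (a + b).
Proof. by move=> ha hb M iM; rewrite ffunE ha // hb // addr0. Qed.

Lemma omits0 i : omits i 0.
Proof. by move=> M _; rewrite ffunE. Qed.

Lemma omitsN i a : omits i a -> omits i (- a).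
Proof. by move=> ha M iM; rewrite ffunE ha // oppr0. Qed.

Lemma omits_sum i (T : Type) (r : seq T) (P : pred T) (F : T -> X) :
  (forall t, omits i (F t)) -> omits i (\sum_(t <- r | P t) F t).
Proof.
by move=> h; apply: (big_ind (omits i)) => //; [exact: omits0|exact: omitsD].
Qed.

Lemma omitsM i a b : omits i a -> omits i b -> omits i (a * b).
Proof.
move=> ha hb M iM; rewrite /GRing.mul /= ffunE big1 // => I sIM.
have [iI|niI] := boolP (i \in I); first by rewrite ha // mul0r mulr0.
by rewrite hb ?mulr0 // !inE niI.
Qed.

Lemma omits_fun i f : omits i (ext_fun n f).
Proof. by move=> M iM; rewrite ffunE; case: eqP iM => // ->; rewrite inE. Qed.

Lemma omits_basis i j : i != j -> omits i (e_ j).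
Proof.
move=> ij M iM; rewrite ffunE; case: eqP iM => // ->; rewrite inE.
by rewrite (negPf ij).
Qed.

Lemma without_mul i a b : omits i b -> without i (a * b) = without i a * b.
Proof.
move=> hb; rewrite [in LHS](split_basis i a) mulrDl withoutD -mulrA without_mul_basis addr0.
by rewrite omits_without //; apply: omitsM => //; exact: without_omits.
Qed.

Definition monomial f M : X := [ffun J : {set 'I_n} => if J == M then f else 0].

Lemma monomial_sum a : a = \sum_(M : {set 'I_n}) monomial (a M) M.
Proof.
apply/ffunP => J; rewrite sum_ffunE (bigD1 J) //= big1 ?addr0 => [|M nM]; first by rewrite ffunE eqxx.
by rewrite ffunE eq_sym (negPf nM).
Qed.

Lemma monomial0 f : monomial f set0 = ext_fun n f.
Proof. by []. Qed.

(** Peels off one factor of e_M; this drives the induction on #|M| in [Lin_monomial]. *)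
Lemma monomial_basis f M i : i \in M ->
  monomial f M = ext_fun n ((-1) ^+ inversions [set i] (M :\ i)) * (e_ i * monomial f (M :\ i)).
Proof.
move=> iM; apply/ffunP => J; rewrite ext_fun_mull mul_basisl [monomial _ _ J]ffunE [monomial _ _ _]ffunE.
have [->|nJ] := eqVneq J M; first by rewrite iM eqxx mulrA signK mul1r.
case: ifP => iJ; rewrite ?mulr0 // ifF ?mulr0 //.
by apply: contraNF nJ => /eqP e; rewrite -(setD1K iJ) e setD1K.
Qed.

Lemma ext_fun_basisC f i a : e_ i * (ext_fun n f * a) = ext_fun n f * (e_ i * a).
Proof. by rewrite mulrA -ext_fun_comm mulrA. Qed.

Lemma ext_funD f g : ext_fun n (f + g) = ext_fun n f + ext_fun n g.
Proof. by apply/ffunP => I; rewrite !ffunE; case: ifP; rewrite ?addr0. Qed.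

Lemma ext_fun_sum (T : Type) (r : seq T) (P : pred T) (F : T -> K) :
  ext_fun n (\sum_(t <- r | P t) F t) = \sum_(t <- r | P t) ext_fun n (F t).
Proof. by elim/big_rec2: _ => [|t x y _ <-]; rewrite ?ext_fun0 ?ext_funD. Qed.

Lemma ext_fun_monomial f g M : ext_fun n f * monomial g M = monomial (f * g) M.
Proof. by apply/ffunP => J; rewrite ext_fun_mull !ffunE; case: ifP; rewrite ?mulr0. Qed.

Section WeightedDerivation.
Variables (D : K -> K) (wt : {set 'I_n} -> nat).
Hypothesis DD : forall f g, D (f + g) = D f + D g.
Hypothesis DM : forall f g, D (f * g) = D f * g + f * D g.
Hypothesis wtD : forall I M, I \subset M -> wt M = (wt I + wt (M :\: I))%N.

(** Models a bracket [E, .]: the vector field [D] acts on coefficients and each e_M has a weight.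
    Additivity of [wt] on disjoint unions ([wtD]) is what makes this a derivation of the wedge
    product. *)
Definition wderiv a : X := [ffun M : {set 'I_n} => D (a M) - (wt M)%:R * a M].

Lemma wderivD a b : wderiv (a + b) = wderiv a + wderiv b.
Proof. by apply/ffunP => M; rewrite !ffunE DD mulrDr opprD addrACA. Qed.

Lemma wderivM a b : wderiv (a * b) = wderiv a * b + a * wderiv b.
Proof.
(* [Dsum] and [Dsign] are stated for a family of derivations; [D] is used as a family indexed by
   'I_1. *)
apply/ffunP => M; rewrite /GRing.mul /= !ffunE (@Dsum 1 K (fun=> D) (fun=> DD) ord0).
rewrite mulr_sumr -sumrB -big_split; apply: eq_bigr => I sIM /=.
rewrite !ffunE /shuffle_sign (@Dsign 1 K (fun=> D) (fun=> DD) ord0) DM (wtD sIM) natrD; ring.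
Qed.

Lemma wderiv0 : wderiv 0 = 0.
Proof. by apply: (addIr (wderiv 0)); rewrite -wderivD !add0r. Qed.

Lemma wderivN a : wderiv (- a) = - wderiv a.
Proof. by apply: (addIr (wderiv a)); rewrite -wderivD !addNr wderiv0. Qed.

Lemma wderiv_sum (T : Type) (r : seq T) (P : pred T) (F : T -> X) :
  wderiv (\sum_(t <- r | P t) F t) = \sum_(t <- r | P t) wderiv (F t).
Proof. by elim/big_rec2: _ => [|t x y _ <-]; rewrite ?wderiv0 ?wderivD. Qed.

Lemma D10 : D 1 = 0.
Proof. by have := DM 1 1; rewrite !mulr1 mul1r => /eqP; rewrite -subr_eq subrr eq_sym => /eqP. Qed.

Lemma D00 : D 0 = 0.
Proof. by apply: (addIr (D 0)); rewrite -DD !add0r. Qed.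

Lemma wderiv_fun f : wt set0 = 0%N -> wderiv (ext_fun n f) = ext_fun n (D f).
Proof.
by move=> w0; apply/ffunP => M; rewrite !ffunE; case: eqP => [->|_]; rewrite ?w0 ?mul0r ?mulr0 ?D00 subr0.
Qed.

Lemma wderiv_basis i : wderiv (e_ i) = - (ext_fun n (wt [set i])%:R * e_ i).
Proof.
apply/ffunP => M; rewrite [LHS]ffunE [RHS]ffunE ext_fun_mull !ffunE.
by case: eqP => [->|_]; rewrite ?D10 ?D00 ?mulr0 ?mulr1 ?sub0r ?oppr0.
Qed.

Lemma wderiv_omits i a : omits i a -> omits i (wderiv a).
Proof. by move=> h M iM; rewrite ffunE h // D00 mulr0 subr0. Qed.
End WeightedDerivation.

End ExteriorBasis.

Section ExteriorMap.
Variables (n : nat) (K K' : comPzRingType) (phi : {rmorphism K -> K'}).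
Implicit Types (a b : extalg n K).

(** Change of coefficient ring, used for restriction to a smaller open set and for evaluation at a
    point. *)
Definition ext_map a : extalg n K' := [ffun M : {set 'I_n} => phi (a M)].

Lemma ext_mapD a b : ext_map (a + b) = ext_map a + ext_map b.
Proof. by apply/ffunP => M; rewrite !ffunE rmorphD. Qed.

Lemma ext_mapM a b : ext_map (a * b) = ext_map a * ext_map b.
Proof.
apply/ffunP => M; rewrite /GRing.mul /= !ffunE rmorph_sum; apply: eq_bigr => I _.
by rewrite !ffunE !rmorphM /shuffle_sign rmorphXn rmorphN1.
Qed.

Lemma ext_map0 : ext_map 0 = 0.
Proof. by apply/ffunP => M; rewrite !ffunE rmorph0. Qed.

Lemma ext_map_sum (T : Type) (r : seq T) (P : pred T) (F : T -> extalg n K) :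
  ext_map (\sum_(t <- r | P t) F t) = \sum_(t <- r | P t) ext_map (F t).
Proof. by elim/big_rec2: _ => [|t x y _ <-]; rewrite ?ext_map0 ?ext_mapD. Qed.

Lemma ext_map_fun f : ext_map (ext_fun n f) = ext_fun n (phi f).
Proof. by apply/ffunP => M; rewrite !ffunE; case: ifP; rewrite ?rmorph0. Qed.

Lemma ext_map_basis i : ext_map (ext_basis K i) = ext_basis K' i.
Proof. by apply/ffunP => M; rewrite !ffunE rmorph_nat. Qed.

End ExteriorMap.

(** * The book differential over a ring with derivations *)

Section BookAlgebra.
Variables (m : nat) (K : comPzRingType).
Local Notation X := (extalg m.+1 K).
Local Notation uI j := (lift ord0 j : 'I_m.+1).
Variables (D : 'I_m.+1 -> K -> K) (u : 'I_m -> K).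
Hypothesis DD : forall i f g, D i (f + g) = D i f + D i g.
Hypothesis DM : forall i f g, D i (f * g) = D i f * g + f * D i g.
Hypothesis DC : forall i j f, D i (D j f) = D j (D i f).
Hypothesis Du : forall i j, D i (u j) = (i == uI j)%:R.
Implicit Types (a b x y : X) (M I : {set 'I_m.+1}) (i : 'I_m.+1) (j k : 'I_m) (f g h : K).

Definition et : X := ext_basis K ord0.
Definition eu : X := \sum_(j < m) ext_fun m.+1 (u j) * ext_basis K (uI j).
Definition eul f := \sum_(j < m) u j * D (uI j) f.
(** Minus the weight of e_M under [E, .]: E commutes with d_t, while [E, d_u] = - d_u for each
    coordinate field in u. *)
Definition udeg M := #|M :\ ord0|.
(* Bracket with the Euler field E. *)
Definition lie a : X := wderiv eul udeg a.
Definition dtime a : X := cderiv D ord0 a.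

Lemma D_0 i : D i 0 = 0. Proof. exact: D0. Qed.
Lemma D_N i f : D i (- f) = - D i f. Proof. exact: DN. Qed.
Lemma D_1 i : D i 1 = 0. Proof. exact: D10. Qed.

Lemma D_sum i (T : Type) (r : seq T) (P : pred T) (F : T -> K) :
  D i (\sum_(t <- r | P t) F t) = \sum_(t <- r | P t) D i (F t).
Proof. exact: Dsum. Qed.

Lemma D_nat i p : D i p%:R = 0.
Proof. by elim: p => [|p IH]; rewrite ?D_0 // mulrS DD IH D_1 addr0. Qed.

Lemma eulD f g : eul (f + g) = eul f + eul g.
Proof. by rewrite -big_split; apply: eq_bigr => j _; rewrite DD mulrDr. Qed.

Lemma eulM f g : eul (f * g) = eul f * g + f * eul g.
Proof.
by rewrite mulr_suml mulr_sumr -big_split; apply: eq_bigr => j _ /=; rewrite DM; ring.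
Qed.

Lemma eul0 : eul 0 = 0. Proof. exact: D00 eulD. Qed.
Lemma eulN f : eul (- f) = - eul f.
Proof. by apply: (addIr (eul f)); rewrite -eulD !addNr eul0. Qed.

Lemma eul_sum (T : Type) (r : seq T) (P : pred T) (F : T -> K) :
  eul (\sum_(t <- r | P t) F t) = \sum_(t <- r | P t) eul (F t).
Proof. by elim/big_rec2: _ => [|t x y _ <-]; rewrite ?eul0 ?eulD. Qed.

Lemma eul_u j : eul (u j) = u j.
Proof.
rewrite /eul (bigD1 j) //= Du eqxx mulr1 big1 ?addr0 // => k kj.
by rewrite Du (inj_eq lift_inj) (negPf kj) mulr0.
Qed.

(** The commutator [d_u, E] = d_u: a derivative in u lowers an eigenvalue of E by one, which is the
    inductive step in [eul_kernel_disjoint] and [Lin_monomial]. *)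
Lemma D_eul j f : D (uI j) (eul f) = eul (D (uI j) f) + D (uI j) f.
Proof.
rewrite /eul D_sum; under eq_bigr => k _ do rewrite DM Du (DC (uI j)).
rewrite big_split addrC; congr (_ + _); rewrite (bigD1 j) //= eqxx mul1r big1 ?addr0 // => k kj.
by rewrite (inj_eq lift_inj) eq_sym (negPf kj) mul0r.
Qed.

Lemma D_time_eul f : D ord0 (eul f) = eul (D ord0 f).
Proof.
rewrite /eul D_sum; apply: eq_bigr => k _; rewrite DM Du (DC ord0).
by rewrite (negPf (neq_lift _ _)) mul0r add0r.
Qed.

Lemma udegD I M : I \subset M -> udeg M = (udeg I + udeg (M :\: I))%N.
Proof.
move=> sIM; rewrite /udeg; have -> : (M :\: I) :\ ord0 = (M :\ ord0) :\: (I :\ ord0).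
  by apply/setP => i; rewrite !inE; case: (i == ord0).
have s : I :\ ord0 \subset M :\ ord0 by exact: setSD.
by rewrite -[LHS](cardsID (I :\ ord0)) (setIidPr s).
Qed.

Lemma sum_mem_lift M : (\sum_(j < m) (uI j \in M) = udeg M)%N.
Proof.
rewrite /udeg -sum1_card [RHS]big_mkcond big_ord_recl !inE eqxx /= add0n.
by apply: eq_bigr => j _; rewrite !inE eq_sym (negPf (neq_lift _ _)) /=; case: (_ \in M).
Qed.

Lemma lieD a b : lie (a + b) = lie a + lie b. Proof. exact: (wderivD udeg eulD). Qed.
Lemma lieM a b : lie (a * b) = lie a * b + a * lie b. Proof. exact: (wderivM eulD eulM udegD). Qed.
Lemma lie0 : lie 0 = 0. Proof. exact: (wderiv0 udeg eulD). Qed.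
Lemma lieN a : lie (- a) = - lie a. Proof. exact: (wderivN udeg eulD). Qed.
Lemma udeg0 : udeg set0 = 0%N. Proof. by rewrite /udeg set0D cards0. Qed.

Lemma lie_fun f : lie (ext_fun m.+1 f) = ext_fun m.+1 (eul f).
Proof. exact: (wderiv_fun eulD _ udeg0). Qed.

Lemma lie_et : lie et = 0.
Proof.
rewrite /lie (wderiv_basis udeg eulD eulM) (_ : udeg _ = 0%N) ?ext_fun0 ?mul0r ?oppr0 //.
by rewrite /udeg setDv cards0.
Qed.

Lemma lie_linear j k : lie (ext_fun m.+1 (u j) * ext_basis K (uI k)) = 0.
Proof.
rewrite lieM lie_fun eul_u /lie (wderiv_basis udeg eulD eulM) (_ : udeg _ = 1%N); last first.
  rewrite /udeg (_ : [set uI k] :\ ord0 = [set uI k]) ?cards1 //.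
  by apply/setDidPl; rewrite disjoint_sym disjoints1 inE neq_lift.
by rewrite ext_fun1 mul1r mulrN addrN.
Qed.

Lemma lie_eu : lie eu = 0.
Proof. by rewrite /lie (wderiv_sum udeg eulD) big1 // => j _; exact: lie_linear. Qed.

Lemma lie_eum a : lie (eu * a) = eu * lie a.
Proof. by rewrite lieM lie_eu mul0r add0r. Qed.

Lemma lie_etm a : lie (et * a) = et * lie a.
Proof. by rewrite lieM lie_et mul0r add0r. Qed.

Lemma lie_omits a : omits ord0 a -> omits ord0 (lie a).
Proof. exact: (wderiv_omits udeg eulD). Qed.

Lemma dtimeD a b : dtime (a + b) = dtime a + dtime b. Proof. exact: cderivD. Qed.
Lemma dtime0 : dtime 0 = 0. Proof. exact: cderiv0. Qed.
Lemma dtimeN a : dtime (- a) = - dtime a.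
Proof. by apply: (addIr (dtime a)); rewrite -dtimeD !addNr dtime0. Qed.

Lemma dtime_eu : dtime eu = 0.
Proof.
rewrite /dtime cderiv_sum // big1 // => j _; rewrite cderivM // cderiv_basis // mulr0 addr0.
by rewrite cderiv_fun // Du (negPf (neq_lift _ _)) ext_fun0 mul0r.
Qed.

Lemma dtime_eum a : dtime (eu * a) = eu * dtime a.
Proof. by rewrite /dtime cderivM // -/(dtime eu) dtime_eu mul0r add0r. Qed.

Lemma dtime_etm a : dtime (et * a) = et * dtime a.
Proof. by rewrite /dtime cderivM // cderiv_basis // mul0r add0r. Qed.

Lemma dtime_omits a : omits ord0 a -> omits ord0 (dtime a).
Proof. by move=> h M iM; rewrite ffunE h // D_0. Qed.

Lemma dtime_lie a : dtime (lie a) = lie (dtime a).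
Proof.
apply/ffunP => M; rewrite !ffunE DD D_N D_time_eul DM D_nat mul0r add0r.
by congr (_ - _ * _).
Qed.

Lemma eu_odd : odd_comm eu.
Proof. by apply: odd_comm_sum => j; apply: odd_comm_fun => a; exact: ext_basis_comm. Qed.

Lemma grade_inv_eu : grade_inv eu = - eu.
Proof.
rewrite grade_inv_sum -sumrN; apply: eq_bigr => j _.
by rewrite grade_invM grade_inv_fun grade_inv_basis mulrN.
Qed.

Lemma et_eu : et * eu = - (eu * et).
Proof. by rewrite ext_basis_comm grade_inv_eu mulNr. Qed.

Lemma et_et : et * et = 0.
Proof.
apply/ffunP => M; rewrite mul_basisl [RHS]ffunE; case: ifP => // iM; rewrite ffunE.
by case: eqP => [e|_]; rewrite ?mulr0 //; have := set11 (ord0 : 'I_m.+1); rewrite -e !inE eqxx.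
Qed.

Lemma eu_omits : omits ord0 eu.
Proof.
by apply: omits_sum => j; apply: omitsM; [exact: omits_fun|apply: omits_basis; exact: neq_lift].
Qed.

Lemma mul_eu a M : (a * eu) M = \sum_(j < m | uI j \in M)
  u j * ((-1) ^+ inversions (M :\ uI j) [set uI j] * a (M :\ uI j)).
Proof.
rewrite mulr_sumr sum_ffunE [RHS]big_mkcond; apply: eq_bigr => j _.
rewrite mulrA -ext_fun_comm -mulrA ext_fun_mull mul_basisr.
by case: ifP => _; rewrite ?mulr0.
Qed.

Lemma rcontract_eu j : rcontract (uI j) eu = ext_fun m.+1 (u j).
Proof.
rewrite rcontract_sum (bigD1 j) //= big1 => [|k kj].
  by rewrite rcontractM rcontract_fun mul0r addr0 rcontract_basis eqxx mulr1 addr0.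
by rewrite rcontractM rcontract_fun mul0r addr0 rcontract_basis (inj_eq lift_inj) eq_sym (negPf kj) mulr0.
Qed.

(** Differentiating E x = 0 in the odd variable d_u_j exhibits u_j x as a multiple of E:
    multiplication by u_j is homotopic to zero on the Koszul complex. This solves the equation
    wherever u_j is invertible. *)
Lemma koszul_divide j x : eu * x = 0 ->
  ext_fun m.+1 (u j) * x = eu * - rcontract (uI j) (grade_inv x).
Proof.
rewrite eu_odd; set y := grade_inv x => yE.
have : rcontract (uI j) (y * eu) = 0.
  by rewrite yE; apply/ffunP => M; rewrite !ffunE mulr0; case: ifP.
rewrite rcontractM rcontract_eu grade_inv_eu mulrN => /eqP; rewrite subr_eq0 => /eqP e.
rewrite eu_odd grade_invN mulNr -mulrN -grade_inv_eu -grade_invM -e grade_invM grade_invK.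
by rewrite grade_inv_fun ext_fun_comm.
Qed.

Lemma sum_rcontract_basis a M :
  (\sum_(j < m) rcontract (uI j) a * ext_basis K (uI j)) M = (udeg M)%:R * a M.
Proof.
rewrite sum_ffunE -sum_mem_lift natr_sum mulr_suml; apply: eq_bigr => j _.
by rewrite rcontract_mul_basis; case: (_ \in M); rewrite ?mul1r ?mul0r.
Qed.

Lemma sum_u_cderiv a M :
  (\sum_(j < m) ext_fun m.+1 (u j) * cderiv D (uI j) a) M = eul (a M).
Proof. by rewrite sum_ffunE; apply: eq_bigr => j _; rewrite ext_fun_mull ffunE. Qed.

(** These are the two sums that the coordinate formula of the Schouten bracket produces in
    [d_book_dbook]. *)
Lemma lie_expand a : lie a = \sum_(j < m) ext_fun m.+1 (u j) * cderiv D (uI j) a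
  - \sum_(j < m) rcontract (uI j) a * ext_basis K (uI j).
Proof.
by apply/ffunP => M; rewrite extD extN sum_rcontract_basis sum_u_cderiv ffunE.
Qed.

(** The divergence in u. If a multivector P in u is identified with the form obtained by contracting
    du_1 ... du_m with P, this is up to sign the de Rham differential and multiplication by E is
    contraction with E; [hom_eu] is then Cartan's formula for the Lie derivative along E. *)
Definition hom a : X := \sum_(j < m) rcontract (uI j) (cderiv D (uI j) a).

(* The Koszul homotopy: hom (x eu) + (hom x) eu = (Euler + m - degree) x. *)
Lemma hom_eu x M : x * eu = 0 ->
  (hom x * eu) M = eul (x M) + m%:R * x M - (udeg M)%:R * x M.
Proof.
move=> xE.
have E2 j : cderiv D (uI j) eu = ext_basis K (uI j).
  rewrite cderiv_sum // (bigD1 j) //= big1 => [|k kj].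
    by rewrite cderivM // cderiv_basis // mulr0 addr0 cderiv_fun // Du eqxx ext_fun1 mul1r addr0.
  rewrite cderivM // cderiv_basis // mulr0 addr0 cderiv_fun // Du (inj_eq lift_inj) eq_sym (negPf kj).
  by rewrite ext_fun0 mul0r.
have : hom (x * eu) = 0.
  rewrite xE /hom big1 // => j _; rewrite cderiv0 //.
  by apply/ffunP => N; rewrite !ffunE mulr0; case: ifP.
have -> : hom (x * eu) = \sum_(j < m) (ext_fun m.+1 (u j) * cderiv D (uI j) x) - hom x * eu
    + (\sum_(j < m) x - \sum_(j < m) rcontract (uI j) x * ext_basis K (uI j)).
  rewrite /hom mulr_suml -!sumrB -big_split; apply: eq_bigr => j _ /=.
  rewrite cderivM // rcontractD !rcontractM rcontract_eu E2 rcontract_basis eqxx mulr1.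
  by rewrite grade_inv_eu grade_inv_basis !mulrN ext_fun_comm.
have hC : (\sum_(j < m) x) M = m%:R * x M.
  by rewrite sum_ffunE sumr_const card_ord mulr_natl.
move=> /(congr1 (fun a : X => a M)).
rewrite !(extD, extN) sum_u_cderiv hC sum_rcontract_basis ext0 => /eqP; rewrite addrAC addrA subr_eq0 => /eqP <-.
by [].
Qed.

Definition comps (C : K -> Prop) a := forall M, C (a M).

(** * Koszul complex of E, given an inverse of E + w + 1 *)

Section Koszul.
Variables (C : K -> Prop) (S : nat -> K -> K) (Z : K -> Prop).
Hypothesis C0 : C 0.
Hypothesis CN : forall f, C f -> C (- f).
Hypothesis CD : forall f g, C f -> C g -> C (f + g).
Hypothesis Cu : forall j, C (u j).
Hypothesis CM : forall f g, C f -> C g -> C (f * g).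
Hypothesis CP : forall j f, C f -> C (D (uI j) f).
Hypothesis CS : forall w f, C f -> C (S w f).
Hypothesis SD : forall w f g, C f -> C g -> S w (f + g) = S w f + S w g.
Hypothesis Su : forall w j f, C f -> u j * S w.+1 f = S w (u j * f).
Hypothesis Seul : forall w f, C f -> w.+1%:R * S w f + \sum_(j < m) u j * S w.+1 (D (uI j) f) = f.
Hypothesis Sdiv : forall f, C f -> Z f -> \sum_(j < m) u j * S 0 (D (uI j) f) = f.

Lemma Csign (k : nat) f : C f -> C ((-1) ^+ k * f).
Proof. by move=> Cf; rewrite -signr_odd; case: (odd k); rewrite ?mulN1r ?mul1r //; exact: CN. Qed.

Lemma Csum (I : Type) (r : seq I) (P : pred I) (F : I -> K) :
  (forall t, C (F t)) -> C (\sum_(t <- r | P t) F t).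
Proof. by move=> h; apply: (big_ind C). Qed.

Lemma Cnat (k : nat) f : C f -> C (k%:R * f).
Proof. by move=> Cf; elim: k => [|k IH]; rewrite ?mul0r // mulrS mulrDl mul1r; exact: CD. Qed.

Lemma S0 w : S w 0 = 0.
Proof. by apply: (addIr (S w 0)); rewrite -SD // !add0r. Qed.

Lemma SN w f : C f -> S w (- f) = - S w f.
Proof. by move=> Cf; apply: (addIr (S w f)); rewrite -SD ?addNr ?S0 //; exact: CN. Qed.

Lemma Ssign w (k : nat) f : C f -> S w ((-1) ^+ k * f) = (-1) ^+ k * S w f.
Proof. by move=> Cf; rewrite -signr_odd; case: (odd k); rewrite ?mulN1r ?mul1r // SN. Qed.

Lemma Snat w (k : nat) f : C f -> S w (k%:R * f) = k%:R * S w f.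
Proof.
move=> Cf; elim: k => [|k IH]; rewrite ?mul0r ?S0 // mulrS !mulrDl !mul1r SD ?IH //.
exact: Cnat.
Qed.

Lemma Ssum w (I : Type) (r : seq I) (P : pred I) (F : I -> K) : (forall t, C (F t)) ->
  S w (\sum_(t <- r | P t) F t) = \sum_(t <- r | P t) S w (F t).
Proof.
move=> h; elim: r => [|t r IH]; first by rewrite !big_nil S0.
by rewrite !big_cons; case: ifP => _ //; rewrite SD ?IH //; exact: Csum.
Qed.

(** Moving [u j] inside the integral by [Su] turns [Seul] into the statement that [S w] is a left
    inverse of eul + w + 1. *)
Lemma Seul' w f : C f -> S w (eul f) = f - w.+1%:R * S w f.
Proof.
move=> Cf; apply/eqP; rewrite eq_sym subr_eq addrC -{1}(Seul w Cf); apply/eqP; congr (_ + _).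
rewrite Ssum => [|j]; last by apply: CM => //; exact: CP.
by apply: eq_bigr => j _; rewrite Su //; exact: CP.
Qed.

Lemma Ceul f : C f -> C (eul f).
Proof. by move=> Cf; apply: Csum => j; apply: CM => //; exact: CP. Qed.

Lemma udeg_omits M : ord0 \notin M -> udeg M = #|M|.
Proof. by move=> nM; rewrite /udeg (cardsD1 ord0 M) (negPf nM) add0n. Qed.

Lemma card_omits M : ord0 \notin M -> (#|M| <= m)%N.
Proof.
move=> nM; have := max_card (mem (ord0 |: M)); rewrite cardsU1 nM card_ord add1n.
by rewrite ltnS.
Qed.

Lemma omits_top M : ord0 \notin M -> #|M| = m -> M = ~: [set ord0].
Proof.
move=> nM cM; apply/eqP; rewrite eqEcard cM cardsC1 card_ord leqnn andbT.
by apply/subsetP => i iM; rewrite !inE; apply: contraNneq nM => <-.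
Qed.

Lemma Chom x : comps C x -> comps C (hom x).
Proof.
move=> Cx M; rewrite /hom sum_ffunE; apply: Csum => j; rewrite ffunE; case: ifP => // _.
by apply: Csign; rewrite ffunE; exact: CP.
Qed.

(** Meant for y = hom x. A coefficient of degree q - 1 gets one more than the weight w = m - q - 1
    that inverts eul + m - q, since [Su] lowers the weight when [u j] enters the integral. The
    predecessor is truncated only for #|M| = m, where [hom x] has no coefficient. *)
Definition kosz y : X :=
  [ffun M : {set 'I_m.+1} => if ord0 \in M then 0 else S (m - #|M|).-1 (y M)].

Lemma hom_top x M j : ord0 \notin M -> #|M| = m -> uI j \in M ->
  hom x (M :\ uI j) = (-1) ^+ inversions (M :\ uI j) [set uI j] * D (uI j) (x M).
Proof.
move=> nM cM jM; have inM k : uI k \in M.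
  by rewrite (omits_top nM cM) !inE eq_sym neq_lift.
rewrite /hom sum_ffunE (bigD1 j) //= big1 ?addr0 => [|k kj].
  by rewrite ffunE !inE eqxx /= ffunE setD1K.
by rewrite ffunE !inE inM andbT (inj_eq lift_inj) kj.
Qed.

(** Below the top degree [hom_eu] reads (hom x) E = (eul + w + 1) x with w = m - q - 1, and [S w]
    inverts this operator. In top degree the operator is eul itself; Hadamard's formula [Sdiv] takes
    over, at the price of the condition [Z]. *)
Lemma koszul_right x : omits ord0 x -> comps C x -> x * eu = 0 -> Z (x (~: [set ord0])) ->
  exists y, [/\ omits ord0 y, comps C y & x = y * eu].
Proof.
move=> ox Cx xE Zx; have Ch := Chom Cx.
exists (kosz (hom x)); split=> [M iM|M|]; first by rewrite ffunE iM.
  by rewrite ffunE; case: ifP => // _; exact: CS.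
have ok : omits ord0 (kosz (hom x)) by move=> M iM; rewrite ffunE iM.
apply/ffunP => M; have [iM|nM] := boolP (ord0 \in M).
  by rewrite ox // (omitsM ok eu_omits).
rewrite mul_eu; have := card_omits nM; rewrite leq_eqVlt => /orP[/eqP cM|cM].
  transitivity (\sum_(j < m) u j * S 0 (D (uI j) (x M))).
    by rewrite Sdiv // (omits_top nM cM).
  rewrite [RHS]big_mkcond; apply: eq_bigr => j _.
  have jM : uI j \in M by rewrite (omits_top nM cM) !inE eq_sym neq_lift.
  rewrite jM ffunE !inE (negPf nM) andbF hom_top // Ssign; last exact: CP.
  rewrite mulrA signK mul1r; congr (_ * S _ _).
  have := cardsD1 (uI j) M; rewrite jM cM add1n; move: #|_ :\ _| => c ->.
  by rewrite subSnn.
have [w hw] : exists w, (m - #|M| = w.+1)%N by exists (m - #|M|).-1; rewrite prednK // subn_gt0.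
transitivity (S w ((hom x * eu) M)).
  rewrite hom_eu // (udeg_omits nM) -addrA -mulrBl -natrB ?(ltnW cM) // hw.
  by rewrite SD ?Snat ?Seul' ?subrK //; [exact: Ceul|exact: Cnat].
rewrite mul_eu [in LHS]big_mkcond [RHS]big_mkcond Ssum => [|j]; last first.
  by case: ifP => // _; apply: CM => //; apply: Csign.
apply: eq_bigr => j _; case: ifP => jM; rewrite ?S0 //.
rewrite -Su ?Ssign //; last by apply: Csign.
congr (_ * (_ * _)); rewrite ffunE !inE (negPf nM) andbF; congr (S _ _).
have := cardsD1 (uI j) M; rewrite jM add1n => e; rewrite e in hw cM.
by rewrite -subnS hw.
Qed.

Lemma koszul x : omits ord0 x -> comps C x -> eu * x = 0 -> Z (x (~: [set ord0])) ->
    (forall f, Z f -> Z (- f)) ->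
  exists y, [/\ omits ord0 y, comps C y & x = eu * y].
Proof.
move=> ox Cx xE Zx ZN; have [|M|||y [oy Cy e]] := @koszul_right (grade_inv x).
- by move=> M iM; rewrite ffunE ox // mulr0.
- by rewrite ffunE; apply: Csign.
- by rewrite -eu_odd.
- by rewrite ffunE -signr_odd; case: (odd _); rewrite ?mulN1r ?mul1r //; exact: ZN.
exists (- y); split=> [M iM|M|].
- by rewrite extN oy // oppr0.
- by rewrite extN; exact: CN.
by rewrite eu_odd grade_invN mulNr -[LHS]grade_invK e grade_invM grade_inv_eu mulrN.
Qed.

End Koszul.

(** * Cocycles and coboundaries of d_t L - E T *)

Section Cohomology.
Hypothesis m_gt0 : (0 < m)%N.
Let C f := D ord0 f = 0.
Variables (S : nat -> K -> K) (Z : K -> Prop) (tau : K).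
Hypothesis CS : forall w f, C f -> C (S w f).
Hypothesis SD : forall w f g, C f -> C g -> S w (f + g) = S w f + S w g.
Hypothesis Su : forall w j f, C f -> u j * S w.+1 f = S w (u j * f).
Hypothesis Seul : forall w f, C f -> w.+1%:R * S w f + \sum_(j < m) u j * S w.+1 (D (uI j) f) = f.
Hypothesis Sdiv : forall f, C f -> Z f -> \sum_(j < m) u j * S 0 (D (uI j) f) = f.
Hypothesis SP : forall w j f, C f -> D (uI j) (S w f) = S w.+1 (D (uI j) f).
(* Z f stands for: f vanishes where all the u j vanish. *)
Hypothesis Z0 : Z 0.
Hypothesis ZD : forall f g, Z f -> Z g -> Z (f + g).
Hypothesis ZM : forall f g, Z f -> Z (g * f).
Hypothesis Zu : forall j, Z (u j).
Hypothesis Ztime : forall f, Z f -> Z (D ord0 f).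
Hypothesis Zconst : forall f, C f -> exists c, (forall i, D i c = 0) /\ Z (f - c).
Hypothesis inv_nat : forall p, exists r, (forall i, D i r = 0) /\ r * p.+1%:R = 1.
Hypothesis Dtau : forall i, D i tau = (i == ord0)%:R.
Hypothesis primitive : forall f, exists g, D ord0 g = f.
Hypothesis koszul_all : forall x, omits ord0 x -> eu * x = 0 -> Z (x (~: [set ord0])) ->
  exists y, omits ord0 y /\ x = eu * y.

Local Notation top := (~: [set (ord0 : 'I_m.+1)]).

Lemma C_0 : C 0. Proof. exact: D_0. Qed.
Lemma C_N f : C f -> C (- f). Proof. by rewrite /C D_N => ->; rewrite oppr0. Qed.
Lemma C_D f g : C f -> C g -> C (f + g). Proof. by rewrite /C DD => -> ->; rewrite addr0. Qed.
Lemma C_M f g : C f -> C g -> C (f * g).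
Proof. by rewrite /C DM => -> ->; rewrite mul0r mulr0 addr0. Qed.
Lemma C_u j : C (u j). Proof. by rewrite /C Du (negPf (neq_lift _ _)). Qed.
Lemma C_P j f : C f -> C (D (uI j) f). Proof. by rewrite /C DC => ->; rewrite D_0. Qed.
Lemma C_eul f : C f -> C (eul f). Proof. by rewrite /C D_time_eul => ->; rewrite eul0. Qed.

Lemma C_sum (I : Type) (r : seq I) (P : pred I) (F : I -> K) :
  (forall t, C (F t)) -> C (\sum_(t <- r | P t) F t).
Proof. by move=> h; apply: (big_ind C) => //; [exact: C_0|exact: C_D]. Qed.

Lemma Zsum (I : Type) (r : seq I) (P : pred I) (F : I -> K) :
  (forall t, Z (F t)) -> Z (\sum_(t <- r | P t) F t).
Proof. by move=> h; apply: (big_ind Z). Qed.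

Lemma ZN f : Z f -> Z (- f). Proof. by rewrite -mulN1r; exact: ZM. Qed.

Lemma Z_eul f : Z (eul f).
Proof. by apply: Zsum => j; rewrite mulrC; exact: ZM. Qed.

Lemma nat_cancel p f : p.+1%:R * f = 0 -> f = 0.
Proof.
by have [r [_ rp]] := inv_nat p => e; rewrite -[f]mul1r -rp -mulrA e mulr0.
Qed.

Lemma Z_nat p f : Z (p.+1%:R * f) -> Z f.
Proof.
by have [r [_ rp]] := inv_nat p => /(ZM r); rewrite mulrA rp mul1r.
Qed.

(* A partial derivative g of a function killed by eul satisfies eul g = - g,
   so g = S 0 (eul g + g) = 0. *)
Lemma ker_eul f : C f -> eul f = 0 -> forall j, D (uI j) f = 0.
Proof.
move=> Cf ef j; set g := D (uI j) f.
have Cg : C g by exact: C_P.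
have eg : eul g = - g by apply/eqP; rewrite -addr_eq0 -D_eul ef D_0.
have := Seul 0 Cg; rewrite mulr1n mul1r => <-.
rewrite (eq_bigr (fun k => S 0 (u k * D (uI k) g))) => [|k _]; last by rewrite Su //; exact: C_P.
have <- : S 0 (eul g) = \sum_(k < m) S 0 (u k * D (uI k) g).
  by apply: (Ssum C_0 C_D SD) => k; apply: C_M; [exact: C_u|exact: C_P].
by rewrite eg (SN C_0 C_N SD) // addrN.
Qed.

(** Put h = eul f - q f. For q > 0 every u-derivative of h has the same form with q - 1, hence is 0
    by induction, and q h = eul h = 0. For q = 0 this last equation is empty: there h = eul f has no
    u-derivatives by [ker_eul], and it vanishes at u = 0. *)
Lemma eul_kernel_disjoint q f : C f -> eul (eul f - q%:R * f) = q%:R * (eul f - q%:R * f) ->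
  eul f - q%:R * f = 0.
Proof.
elim: q f => [|q IH] f Cf; first rewrite !mul0r subr0 => e.
  rewrite -(Sdiv (C_eul Cf) (Z_eul f)) big1 // => j _.
  by rewrite (ker_eul (C_eul Cf) e) (S0 C_0 SD) mulr0.
set h := eul f - _ => e.
have Dh j : D (uI j) h = 0.
  have Dn p : D (uI j) (p%:R * f) = p%:R * D (uI j) f by rewrite DM D_nat mul0r add0r.
  have hE : D (uI j) h = eul (D (uI j) f) - q%:R * D (uI j) f.
    by rewrite DD D_N Dn D_eul mulrS; ring.
  rewrite hE; apply: IH; first exact: C_P.
  rewrite -hE; apply: (addIr (D (uI j) h)).
  by rewrite -D_eul e DM D_nat mul0r add0r mulrS; ring.
apply: (@nat_cancel q); rewrite -e /eul big1 // => j _; by rewrite Dh mulr0.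
Qed.

(** Taylor expansion at u = 0, one order at a time: f = c + \sum_j u_j S 0 (D_j f) with c constant.
    Multiplication by u_j turns a splitting for q into one for q + 1, because (eul - q - 1)(u_j g) =
    u_j (eul - q) g. *)
Lemma eul_split q f : C f -> exists h g,
  [/\ C h, C g, f = h + (eul g - q%:R * g) & eul h = q%:R * h].
Proof.
have main f0 : C f0 -> exists c, [/\ forall i, D i c = 0, C c, eul c = 0 &
    f0 = c + \sum_(j < m) u j * S 0 (D (uI j) f0)].
  move=> Cf; have [c [Dc Zc]] := Zconst Cf; exists c; split=> //.
    by rewrite /eul big1 // => j _; rewrite Dc mulr0.
  have Cfc : C (f0 - c) by apply: C_D => //; apply: C_N; exact: Dc.
  rewrite -{1}[f0](subrK c) -[in LHS](Sdiv Cfc Zc) addrC; congr (_ + _).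
  by apply: eq_bigr => j _; rewrite DD D_N Dc subr0.
(* [S 0] inverts eul + 1, and eul (u_j g) = u_j (eul g + g). *)
have eulS j f0 : C f0 -> eul (u j * S 0 f0) = u j * f0.
  move=> Cf; rewrite eulM eul_u -mulrDr; congr (_ * _).
  rewrite -[RHS](Seul 0 Cf) mulr1n mul1r; congr (_ + _).
  by apply: eq_bigr => k _; rewrite SP.
elim: q f => [|q IH] f Cf; have [c [Dc Cc ec fE]] := main f Cf.
  exists c, (\sum_(j < m) u j * S 0 (S 0 (D (uI j) f))); split=> //.
  - by apply: C_sum => j; apply: C_M; [exact: C_u|do 2 apply: CS; exact: C_P].
  - rewrite mul0r subr0 eul_sum [in LHS]fE; congr (_ + _); apply: eq_bigr => j _.
    by rewrite eulS //; apply: CS; exact: C_P.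
  - by rewrite mul0r.
have hg j : exists p : K * K, [/\ C p.1, C p.2, S 0 (D (uI j) f) = p.1 + (eul p.2 - q%:R * p.2)
    & eul p.1 = q%:R * p.1].
  by have [|h [g hg]] := IH (S 0 (D (uI j) f)); [apply: CS; exact: C_P|exists (h, g)].
have [p hp] := fin_all_exists hg.
have [r [Dr rq]] := inv_nat q.
have Cr : C r by exact: Dr.
have er : eul r = 0 by rewrite /eul big1 // => j _; rewrite Dr mulr0.
(* With r = 1 / (q + 1), the term - r c accounts for the constant: eul - (q + 1) maps it to c. *)
exists (\sum_(j < m) u j * (p j).1), (\sum_(j < m) u j * (p j).2 - r * c); split.
- by apply: C_sum => j; apply: C_M; [exact: C_u|have [] := hp j].
- apply: C_D; last by apply: C_N; exact: C_M.
  by apply: C_sum => j; apply: C_M; [exact: C_u|have [] := hp j].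
- have cE : q.+1%:R * (r * c) = c by rewrite mulrA (mulrC _ r) rq mul1r.
  rewrite eulD eulN eulM er ec mul0r mulr0 addr0 subr0 mulrBr cE [LHS]fE.
  suff -> : \sum_(j < m) u j * S 0 (D (uI j) f) = \sum_(j < m) u j * (p j).1
      + (eul (\sum_(j < m) u j * (p j).2) - q.+1%:R * \sum_(j < m) u j * (p j).2) by ring.
  rewrite eul_sum mulr_sumr -sumrB -big_split; apply: eq_bigr => j _ /=.
  by have [_ _ -> _] := hp j; rewrite eulM eul_u mulrS; ring.
rewrite eul_sum mulr_sumr; apply: eq_bigr => j _; have [_ _ _ e] := hp j.
by rewrite eulM eul_u e mulrS; ring.
Qed.

Lemma comps_time x : dtime x = 0 <-> comps C x.
Proof.
split=> [h M|h]; first by have := congr1 (fun a : X => a M) h; rewrite !ffunE.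
by apply/ffunP => M; rewrite !ffunE h.
Qed.

Lemma lieE x M : lie x M = eul (x M) - (udeg M)%:R * x M.
Proof. exact: ffunE. Qed.

Lemma dtimeE x M : dtime x M = D ord0 (x M).
Proof. exact: ffunE. Qed.

Lemma lie_kernel_disjoint x : dtime x = 0 -> lie (lie x) = 0 -> lie x = 0.
Proof.
move=> /comps_time Cx e; apply/ffunP => M; rewrite ext0 lieE.
apply: eul_kernel_disjoint => //.
by have := congr1 (fun a : X => a M) e; rewrite !lieE ext0 => /eqP; rewrite subr_eq0 => /eqP.
Qed.

Lemma without_dtime x : without ord0 (dtime x) = dtime (without ord0 x).
Proof. by apply/ffunP => M; rewrite !ffunE; case: ifP; rewrite ?D_0. Qed.

Lemma without_lie x : without ord0 (lie x) = lie (without ord0 x).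
Proof. by apply/ffunP => M; rewrite !ffunE; case: ifP; rewrite ?eul0 ?mulr0 ?subr0. Qed.

Lemma without0 : without ord0 (0 : X) = 0.
Proof. by apply/ffunP => M; rewrite !ffunE; case: ifP. Qed.

Lemma lie_split x : omits ord0 x -> dtime x = 0 -> exists y z,
  [/\ omits ord0 z, omits ord0 y, dtime y = 0 & dtime z = 0] /\ x = y + lie z /\ lie y = 0.
Proof.
move=> ox /comps_time Cx.
have hp M : exists p : K * K, [/\ C p.1, C p.2, x M = p.1 + (eul p.2 - (udeg M)%:R * p.2)
    & eul p.1 = (udeg M)%:R * p.1].
  by have [h [g hg]] := eul_split (udeg M) (Cx M); exists (h, g).
have [p {}hp] := fin_all_exists hp.
pose y : X := [ffun M => (p M).1]; pose z : X := [ffun M => (p M).2].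
have Ty : dtime y = 0 by apply/comps_time => M; rewrite ffunE; have [] := hp M.
have Tz : dtime z = 0 by apply/comps_time => M; rewrite ffunE; have [] := hp M.
exists (without ord0 y), (without ord0 z); split; first split; try exact: without_omits.
- by rewrite -without_dtime Ty without0.
- by rewrite -without_dtime Tz without0.
split; last first.
  rewrite -without_lie (_ : lie y = 0) ?without0 //; apply/ffunP => M; rewrite lieE ext0 !ffunE.
  by have [_ _ _ ->] := hp M; rewrite subrr.
rewrite -without_lie -withoutD -[LHS](omits_without ox); congr (without _ _); apply/ffunP => M.
by rewrite extD lieE !ffunE; have [] := hp M.
Qed.

Lemma time_primitive_ext x : omits ord0 x -> exists y, omits ord0 y /\ dtime y = x.
Proof.
move=> ox; have [y hy] := fin_all_exists (fun M => primitive (x M)).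
exists (without ord0 [ffun M => y M]); split; first exact: without_omits.
rewrite -without_dtime -[RHS](omits_without ox); congr (without _ _).
by apply/ffunP => M; rewrite dtimeE ffunE hy.
Qed.

Lemma koszul_time x : omits ord0 x -> dtime x = 0 -> eu * x = 0 -> Z (x top) ->
  exists y, [/\ omits ord0 y, dtime y = 0 & x = eu * y].
Proof.
move=> ox /comps_time Cx xE Zx.
have [y [oy /comps_time Cy e]] := koszul C_0 C_N C_D C_u C_M C_P CS SD Su Seul Sdiv ox Cx xE Zx ZN.
by exists y.
Qed.

Lemma eu_eu : eu * eu = 0.
Proof.
have e : eu * eu = - (eu * eu) by rewrite {1}eu_odd grade_inv_eu mulNr.
apply/ffunP => M; rewrite ext0; apply: (@nat_cancel 1).
have := congr1 (fun a : X => a M) e; rewrite extN => /eqP; rewrite -addr_eq0 => /eqP <-.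
by rewrite mulr_natl mulr2n.
Qed.

Lemma Z_eum y : Z ((eu * y) top).
Proof.
by rewrite eu_odd mul_eu; apply: Zsum => j; rewrite mulrC; exact: ZM.
Qed.

Lemma udeg_top : udeg top = m.
Proof. by rewrite udeg_omits ?cardsC1 ?card_ord // !inE eqxx. Qed.

(** In top degree L is eul - m, and eul f always vanishes at u = 0; so m f does, and f itself as m >
    0. *)
Lemma Z_lie_top x : Z (lie x top) -> Z (x top).
Proof.
rewrite lieE udeg_top => h; have [p mp] : exists p, m = p.+1 by exists m.-1; rewrite prednK.
apply: (@Z_nat p); rewrite -mp -[_ * _]opprK; apply: ZN.
have := ZD h (ZN (Z_eul (x top))); by rewrite addrAC subrr add0r.
Qed.

Definition dbook x : X := et * lie x - eu * dtime x.

Lemma dbookD x y : dbook (x + y) = dbook x + dbook y.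
Proof. by rewrite /dbook lieD dtimeD !mulrDr opprD addrACA. Qed.

Lemma dbook0 : dbook 0 = 0.
Proof. by rewrite /dbook lie0 dtime0 !mulr0 subrr. Qed.

Lemma dbookN x : dbook (- x) = - dbook x.
Proof. by apply: (addIr (dbook x)); rewrite -dbookD !addNr dbook0. Qed.

Lemma dbook_et x : dbook (et * x) = et * (eu * dtime x).
Proof.
by rewrite /dbook lie_etm dtime_etm !mulrA et_et mul0r sub0r et_eu mulNr.
Qed.

Lemma dbook_dbook x : dbook (dbook x) = 0.
Proof.
rewrite {2}/dbook dbookD dbookN dbook_et /dbook dtime_lie lie_eum dtime_eum.
by rewrite [eu * (eu * _)]mulrA eu_eu mul0r subr0 subrr.
Qed.

Lemma et_split_eq0 a b : omits ord0 a -> omits ord0 b -> a + et * b = 0 -> a = 0 /\ b = 0.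
Proof. exact: split_basis0. Qed.

Lemma eum_omits a : omits ord0 a -> omits ord0 (eu * a).
Proof. by apply: omitsM; exact: eu_omits. Qed.

Lemma dbook_split a b : dbook (a + et * b) = - (eu * dtime a) + et * (lie a + eu * dtime b).
Proof. by rewrite dbookD dbook_et /dbook mulrDr addrA; congr (_ + _); exact: addrC. Qed.

Lemma cocycle_part a b : omits ord0 a -> omits ord0 b -> dbook (a + et * b) = 0 ->
  exists x y z, [/\ omits ord0 y, dtime x = 0, lie x = 0 & a + et * b = x + et * y + dbook z].
Proof.
move=> oa ob; rewrite dbook_split => /et_split_eq0[].
- by apply: omitsN; apply: eum_omits; exact: dtime_omits.
- by apply: omitsD; [exact: lie_omits|apply: eum_omits; exact: dtime_omits].
move=> /eqP; rewrite oppr_eq0 => /eqP ea eb.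
have Za : Z (a top).
  apply: Z_lie_top; have -> : lie a = - (eu * dtime b) by apply/eqP; rewrite -addr_eq0 eb.
  by rewrite extN; apply: ZN; exact: Z_eum.
have [|c [oc ec]] := koszul_all (dtime_omits oa) ea; first by rewrite dtimeE; exact: Ztime.
have [c' [oc' ec']] := time_primitive_ext oc.
(* Subtracting E c' costs a coboundary and a term in d_t: if T z = c', then E c' = d_t L z - dbook
   z. *)
pose x := a - eu * c'.
have ox : omits ord0 x by apply: omitsD => //; apply: omitsN; exact: eum_omits.
have Tx : dtime x = 0 by rewrite dtimeD dtimeN dtime_eum ec' ec subrr.
have Lx : lie x = - (eu * (dtime b + lie c')).
  rewrite lieD lieN lie_eum mulrDr opprD; congr (_ - _).
  by apply/eqP; rewrite -addr_eq0 eb.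
have [||||g [og Tg eg]] := @koszul_time (lie x).
- exact: lie_omits.
- by rewrite dtime_lie Tx lie0.
- by rewrite Lx mulrN mulrA eu_eu mul0r oppr0.
- by rewrite Lx extN; apply: ZN; exact: Z_eum.
(* Now L x = E g with g = h + L d and L h = 0. Subtracting E d from x leaves L x' = E h, which is
   both in the image and in the kernel of L. *)
have [h [d [[od oh Th Td] [gE Lh]]]] := lie_split og Tg.
pose x' := x - eu * d.
have Tx' : dtime x' = 0 by rewrite dtimeD dtimeN dtime_eum Tx Td mulr0 subrr.
have Lx'E : lie x' = eu * h by rewrite lieD lieN lie_eum eg gE mulrDr addrK.
have Lx' : lie x' = 0.
  by apply: lie_kernel_disjoint => //; rewrite Lx'E lie_eum Lh mulr0.
have [z [oz ez]] := time_primitive_ext (omitsD oc' od).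
exists x', (b + lie z), (- z); split=> //.
  by apply: omitsD => //; exact: lie_omits.
rewrite dbookN /dbook opprB ez /x' /x [et * (b + _)]mulrDr mulrDr -[a - _ - _]addrA -opprD.
by rewrite -[RHS]addrA [(_ + _) + (_ - _)]addrACA addrN addr0 addrACA addNr addr0.
Qed.

(** The top coefficient of T b need not vanish at u = 0, as [koszul_all] demands, so b is first
    changed by a coboundary. *)
Lemma cocycle_time_part b : omits ord0 b -> eu * dtime b = 0 ->
  exists x z, [/\ dtime x = 0, lie x = 0 & et * b = et * x + dbook z].
Proof.
move=> ob eb; have [p mp] : exists p, m = p.+1 by exists m.-1; rewrite prednK.
have [r [Dr rp]] := inv_nat p.
have rm : r * m%:R = 1 by rewrite mp.
(* L acts on the top coefficient as eul - m and r = 1 / m, so adding L y to b leaves eul (b_top / m)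
   there, which vanishes at u = 0. Since E y = 0, d_t L y is the coboundary of y. *)
pose y := monomial (r * b top) top.
have eu_y : eu * y = 0.
  apply/ffunP => M; rewrite eu_odd mul_eu ext0 big1 // => j jM.
  rewrite !ffunE ifF ?mulr0 //; apply/negP => /eqP e.
  have : uI j \in M :\ uI j by rewrite e !inE eq_sym neq_lift.
  by rewrite !inE eqxx.
have oy : omits ord0 y by move=> M iM; rewrite ffunE; case: eqP iM => // ->; rewrite !inE eqxx.
pose b' := b + lie y.
have ob' : omits ord0 b' by apply: omitsD => //; exact: lie_omits.
have eb' : eu * dtime b' = 0.
  by rewrite dtimeD mulrDr eb add0r dtime_lie -lie_eum -dtime_eum eu_y dtime0 lie0.
have Zb' : Z (b' top).
  rewrite extD lieE udeg_top ffunE eqxx addrCA mulrA (mulrC _ r) rm mul1r subrr addr0.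
  exact: Z_eul.
have [|c [oc ec]] := koszul_all (dtime_omits ob') eb'; first by rewrite dtimeE; exact: Ztime.
have [c' [oc' ec']] := time_primitive_ext oc.
(* A second primitive in time, because dbook (d_t w) = d_t E T w = d_t E c'. *)
have [w [ow ew]] := time_primitive_ext oc'.
pose x := b' - eu * c'.
have ox : omits ord0 x by apply: omitsD => //; apply: omitsN; exact: eum_omits.
have Tx : dtime x = 0 by rewrite dtimeD dtimeN dtime_eum ec' ec subrr.
have [h [d [[od oh Th Td] [xE Lh]]]] := lie_split ox Tx.
exists h, (d + et * w - y); split=> //.
have dy : dbook y = et * lie y by rewrite /dbook -dtime_eum eu_y dtime0 subr0.
have dd : dbook d = et * lie d by rewrite /dbook Td mulr0 subr0.
have hd : h + lie d = b + lie y - eu * c' by rewrite -xE.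
rewrite !dbookD dbookN dbook_et ew dy dd !addrA -mulrDr hd !mulrDr mulrN.
by rewrite subrK addrK.
Qed.

Theorem book_cocycle a : dbook a = 0 ->
  exists x z, [/\ dtime x = 0, lie x = 0 & a = x + dbook z].
Proof.
move=> da; rewrite (split_basis ord0 a) -/et in da *.
have [x [y [z [oy Tx Lx e]]]] := cocycle_part (@without_omits _ _ ord0 a) (@lcontract_omits _ _ ord0 a) da.
(* As x is closed, the cocycle condition reduces to d_t E T y = 0. *)
have [||x' [z' [Tx' Lx' e']]] := @cocycle_time_part y => //.
  have dx : dbook x = 0 by rewrite /dbook Tx Lx !mulr0 subrr.
  have := da; rewrite e dbookD [dbook (x + _)]dbookD dbook_dbook dx addr0 dbook_et.
  move=> /et_split_eq0[] //.
    exact: omits0.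
  by apply: eum_omits; exact: dtime_omits.
exists (x + et * x'), (z' + z); split.
- by rewrite dtimeD Tx dtime_etm Tx' mulr0 addr0.
- by rewrite lieD Lx lie_etm Lx' mulr0 addr0.
by rewrite e e' dbookD !addrA.
Qed.

(** For z = b + d_t c the two parts of a are a0 = - E T b and a1 = L b + E T c, and each must become
    E h with h in ker T and ker L. For a1 the obstacle is that b need not be in ker T. *)
Theorem book_boundary a z : dtime a = 0 -> lie a = 0 -> a = dbook z ->
  exists h : X, [/\ dtime h = 0, lie h = 0 & a = eu * h].
Proof.
move=> Ta La; rewrite (split_basis ord0 z) -/et dbook_split.
set b := without ord0 z; set c := lcontract ord0 z.
have ob : omits ord0 b by exact: without_omits.
have oc : omits ord0 c by exact: lcontract_omits.
set a0 := - _; set a1 := lie b + _ => aE.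
have oa0 : omits ord0 a0 by apply: omitsN; apply: eum_omits; exact: dtime_omits.
have oa1 : omits ord0 a1.
  by apply: omitsD; [exact: lie_omits|apply: eum_omits; exact: dtime_omits].
have [Ta0 Ta1] : dtime a0 = 0 /\ dtime a1 = 0.
  by apply: et_split_eq0; [exact: dtime_omits|exact: dtime_omits|rewrite -dtime_etm -dtimeD -aE].
have [La0 La1] : lie a0 = 0 /\ lie a1 = 0.
  by apply: et_split_eq0; [exact: lie_omits|exact: lie_omits|rewrite -lie_etm -lieD -aE].
(* If y - L w = E (h + L d) with L h = 0, then y - E h = L (w + E d) lies in the image and in the
   kernel of L, hence is 0. *)
have descend (y w : X) : omits ord0 y -> dtime y = 0 -> lie y = 0 -> dtime w = 0 -> omits ord0 w ->
    eu * (y - lie w) = 0 -> Z ((y - lie w) top) ->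
    exists h : X, [/\ omits ord0 h, dtime h = 0, lie h = 0 & y = eu * h].
  move=> oy Ty Ly Tw ow Ey Zy; have [||//|//|g [og Tg gE]] := @koszul_time (y - lie w).
  - by apply: omitsD => //; apply: omitsN; exact: lie_omits.
  - by rewrite dtimeD dtimeN dtime_lie Ty Tw lie0 subrr.
  have [h [d [[od oh Th Td] [gE' Lh]]]] := lie_split og Tg.
  exists h; split=> //; apply/eqP; rewrite -subr_eq0.
  have e : y - eu * h = lie (w + eu * d).
    by rewrite lieD lie_eum -[y](subrK (lie w)) gE gE' mulrDr addrAC [eu * h + _]addrC addrK addrC.
  rewrite e lie_kernel_disjoint //; first by rewrite dtimeD dtime_eum Tw Td mulr0 addr0.
  by rewrite -e lieD lieN lie_eum Ly Lh mulr0 subrr.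
have [|||||||h [oh Th Lh a0E]] := @descend a0 0 => //.
- exact: dtime0.
- exact: omits0.
- by rewrite lie0 subr0 mulrN mulrA eu_eu mul0r oppr0.
- by rewrite lie0 subr0 extN; apply: ZN; exact: Z_eum.
have etau : eul tau = 0.
  by rewrite /eul big1 // => j _; rewrite Dtau eq_sym (negPf (neq_lift _ _)) mulr0.
(* [tau] is the coordinate t. As - E T b = a0 = E h, adding t h gives E T b' = 0, and L b is
   unchanged because L kills t and h. *)
pose b' := b + ext_fun m.+1 tau * h.
have ob' : omits ord0 b' by apply: omitsD => //; apply: omitsM => //; exact: omits_fun.
have Tb' : dtime b' = dtime b + h.
  rewrite dtimeD; congr (_ + _); rewrite /dtime cderivM // -/(dtime h) Th mulr0 addr0.
  by rewrite cderiv_fun // Dtau eqxx ext_fun1 mul1r.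
have Lb' : lie b' = lie b.
  by rewrite lieD lieM lie_fun etau Lh ext_fun0 mul0r mulr0 !addr0.
have Eb' : eu * dtime b' = 0.
  by rewrite Tb' mulrDr -a0E addrN.
have Za1 : Z (a1 top) by apply: Z_lie_top; rewrite La1 ext0.
have Zb' : Z (b' top).
  apply: Z_lie_top; rewrite Lb' -[lie b](addrK (eu * dtime c)) -/a1 extD extN.
  by apply: ZD => //; apply: ZN; exact: Z_eum.
have [|g [og gE]] := koszul_all (dtime_omits ob') Eb'; first by rewrite dtimeE; exact: Ztime.
have [g' [og' g'E]] := time_primitive_ext og.
(* T b' = E g = E T g', so w is in ker T, and L w differs from L b by the multiple E L g' of E. *)
pose w := b' - eu * g'.
have xE : a1 - lie w = eu * (dtime c + lie g').
  by rewrite /w lieD lieN Lb' lie_eum /a1 mulrDr opprB addrC addrA subrK addrC.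
have [|||||||h' [oh' Th' Lh' a1E]] := @descend a1 w => //.
- by rewrite dtimeD dtimeN dtime_eum gE g'E subrr.
- by apply: omitsD => //; apply: omitsN; exact: eum_omits.
- by rewrite xE mulrA eu_eu mul0r.
- by rewrite xE; exact: Z_eum.
exists (h - et * h'); split.
- by rewrite dtimeD dtimeN dtime_etm Th Th' mulr0 subrr.
- by rewrite lieD lieN lie_etm Lh Lh' mulr0 subrr.
by rewrite aE a0E a1E mulrDr mulrN !mulrA et_eu mulNr.
Qed.

(** * The kernel of T and L consists of linear multivector fields *)

Section LinearElements.
Variable Lin : X -> Prop.
Hypothesis LinD : forall a b, Lin a -> Lin b -> Lin (a + b).
Hypothesis LinM : forall a b, Lin a -> Lin b -> Lin (a * b).
Hypothesis Lin_const : forall c, (forall i, D i c = 0) -> Lin (ext_fun m.+1 c).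
Hypothesis Lin_et : Lin et.
Hypothesis Lin_u : forall j k, Lin (ext_fun m.+1 (u j) * ext_basis K (uI k)).

Lemma Lin_sum (I : Type) (r : seq I) (P : pred I) (F : I -> X) :
  (forall t, Lin (F t)) -> Lin (\sum_(t <- r | P t) F t).
Proof.
move=> h; apply: (big_ind Lin) => //; rewrite -(@ext_fun0 m.+1 K); apply: Lin_const.
by move=> i; rewrite D_0.
Qed.

Lemma D_sign i (k : nat) : D i ((-1) ^+ k) = 0.
Proof. by rewrite -signr_odd; case: (odd k); rewrite ?D_N D_1 ?oppr0. Qed.

(** Euler's formula f = (1/q) \sum_l u_l D_l f supplies each of the q factors d_u with a linear
    coefficient: for a factor d_u_j of e_M, f e_M is up to a constant the sum over l of (u_l d_u_j)
    (D_l f) e_(M - j), and D_l f has degree q - 1. The induction ends with a constant, so f is never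
    written as a polynomial. *)
Lemma Lin_monomial f M : C f -> eul f = (udeg M)%:R * f -> Lin (monomial f M).
Proof.
elim: {M}#|M| {-2}M f (erefl #|M|) => [|k IH] M f cM Cf ef.
  move: cM ef => /eqP; rewrite cards_eq0 => /eqP ->; rewrite udeg0 mul0r monomial0 => ef.
  have [c [Dc Zc]] := Zconst Cf.
  have Cfc : C (f - c) by apply: C_D => //; apply: C_N; exact: Dc.
  rewrite -[f](subrK c) -(Sdiv Cfc Zc) big1 ?add0r => [|j _]; first exact: Lin_const.
  by rewrite DD D_N Dc subr0 (ker_eul Cf ef) (S0 C_0 SD) mulr0.
have card_D1 i : i \in M -> #|M :\ i| = k.
  by move=> iM; move: cM; rewrite (cardsD1 i) iM add1n => -[].
have [tM|tM] := boolP (ord0 \in M).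
  rewrite (monomial_basis f tM); apply: LinM.
    by apply: Lin_const => i; rewrite D_sign.
  apply: LinM => //; apply: IH => //; first exact: card_D1.
  by rewrite ef /udeg setDDl setUid.
have /set0Pn[i iM] : M != set0 by rewrite -cards_eq0 cM.
have [j ij _] : {j | i = uI j & unlift ord0 i = Some j}.
  by apply: unlift_some; apply: contraNneq tM => ->.
rewrite ij in iM *.
have uM : udeg M = (udeg (M :\ uI j)).+1.
  rewrite !udeg_omits //; last by rewrite !inE (negPf tM) andbF.
  by rewrite (cardsD1 (uI j) M) iM.
rewrite (monomial_basis f iM); apply: LinM.
  by apply: Lin_const => k'; rewrite D_sign.
have [r [Dr rq]] := inv_nat (udeg (M :\ uI j)).
have fE : f = r * eul f by rewrite ef uM mulrA rq mul1r.
have -> : ext_basis K (uI j) * monomial f (M :\ uI j) = ext_fun m.+1 r *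
    \sum_(l < m) (ext_fun m.+1 (u l) * ext_basis K (uI j)) * monomial (D (uI l) f) (M :\ uI j).
  rewrite [in LHS]fE -ext_fun_monomial ext_fun_basisC; congr (_ * _).
  have -> : monomial (eul f) (M :\ uI j) = \sum_(l < m) ext_fun m.+1 (u l) * monomial (D (uI l) f) (M :\ uI j).
    apply/ffunP => N; rewrite sum_ffunE ffunE; case: eqP => [e|ne].
      by apply: eq_bigr => l _; rewrite ext_fun_mull ffunE e eqxx.
    by rewrite big1 // => l _; rewrite ext_fun_mull ffunE; case: eqP => // _; rewrite mulr0.
  by rewrite mulr_sumr; apply: eq_bigr => l _; rewrite ext_fun_basisC mulrA.
apply: LinM; first exact: Lin_const.
apply: Lin_sum => l; apply: LinM => //; apply: IH; first exact: card_D1.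
  exact: C_P.
apply: (addIr (D (uI l) f)); rewrite -D_eul ef DM D_nat mul0r add0r uM mulrS.
by rewrite mulrDl mul1r addrC.
Qed.

Lemma Lin_kernel a : dtime a = 0 -> lie a = 0 -> Lin a.
Proof.
move=> /comps_time Ca La; rewrite (monomial_sum a); apply: Lin_sum => M; apply: Lin_monomial => //.
by have := congr1 (fun b : X => b M) La; rewrite lieE ext0 => /eqP; rewrite subr_eq0 => /eqP.
Qed.

End LinearElements.

End Cohomology.

End BookAlgebra.

(* Imported only here: the set notations of classical_sets shadow those of
   finset, which the exterior algebra uses. *)
From mathcomp Require Import all_classical all_reals all_analysis.
From mathcomp Require Import lra.
Import Order.TTheory.
Import numFieldNormedType.Exports.
Local Open Scope classical_set_scope.

(** * Germs of smooth functions *)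

Section Lines.
Variables (R : realType) (V : normedModType R).
Implicit Types (F : V -> R) (x v : V).

Lemma derivable_line F x v (h0 : R) :
  derivable F (x + h0 *: v) v = derivable (fun s : R => F (x + s *: v)) h0 1.
Proof.
rewrite /derivable; apply: (congr1 (fun q => cvg (q @ 0^'))); apply/funext => h /=.
by rewrite [h *: 1]mulr1 scalerDl (addrCA (h *: v)).
Qed.

Lemma derive_line F x v (h0 : R) :
  'D_v F (x + h0 *: v) = 'D_1 (fun s : R => F (x + s *: v)) h0.
Proof.
rewrite /derive; apply: (congr1 (fun q => lim (q @ 0^'))); apply/funext => h /=.
by rewrite [h *: 1]mulr1 scalerDl (addrCA (h *: v)).
Qed.

Lemma is_derive_line F x v (h0 : R) (l : R) :
  is_derive (x + h0 *: v) v F l <-> is_derive h0 1 (fun s : R => F (x + s *: v)) l.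
Proof.
split=> -[d e]; apply: DeriveDef.
- by rewrite -derivable_line.
- by rewrite -derive_line.
- by rewrite derivable_line.
- by rewrite derive_line.
Qed.

Lemma is_derive_at F x v l :
  is_derive x v F l <-> is_derive (0 : R) 1 (fun s : R => F (x + s *: v)) l.
Proof. by rewrite -is_derive_line scale0r addr0. Qed.

Lemma is_derive_comp F x v (g : R -> R) (l c : R) :
  is_derive x v F l -> is_derive (F x) 1 g c -> is_derive x v (g \o F) (c * l).
Proof.
rewrite !is_derive_at; set phi := fun s : R => F (x + s *: v).
move=> [dF eF]; have <- : phi 0 = F x by rewrite /phi scale0r addr0.
move=> [dg eg]; apply: DeriveDef.
  have /derivable1_diffP dphi := dF; have /derivable1_diffP dg1 := dg.
  by apply/derivable1_diffP; exact: (differentiable_comp dphi dg1).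
by rewrite -derive1E (derive1_comp dF dg) !derive1E eF eg.
Qed.

End Lines.

Section Germs.
Variables (R : realType) (n : nat).
Local Notation V := 'rV[R]_n.
Implicit Types (F G : V -> R) (x : V).

(** Only the germ of [F] at x matters, so functions on different open sets can be compared and
    glued. Nothing is claimed at points near x: where a neighbourhood is needed, as in
    [is_derive_direction] and [smooth_atM], [smooth_at] is assumed near x. *)
Fixpoint CkAt (k : nat) F x : Prop :=
  {for x, continuous F} /\
  (if k is k'.+1 then forall i, derivable F x 'e_i /\ CkAt k' ('D_('e_i) F) x else True).

Definition smooth_at F x := forall k, CkAt k F x.

Lemma near_derive F G x (v : V) :
  (\forall y \near x, F y = G y) -> \forall y \near x, 'D_v F y = 'D_v G y.
Proof.
move=> FG; have := near_join FG; apply: filterS => y.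
exact: near_eq_derive.
Qed.

Lemma CkAt_near k F G x : (\forall y \near x, F y = G y) -> CkAt k F x -> CkAt k G x.
Proof.
elim: k F G => [|k IH] F G FG [cF dF]; split=> //.
- by rewrite /prop_for /continuous_at -(nbhs_singleton FG); exact: cvg_trans (near_eq_cvg FG) cF.
- by rewrite /prop_for /continuous_at -(nbhs_singleton FG); exact: cvg_trans (near_eq_cvg FG) cF.
move=> i; have [d c] := dF i; split; first exact: (near_eq_derivable FG).
exact: IH (near_derive _ FG) c.
Qed.

Lemma smooth_at_near F G x : (\forall y \near x, F y = G y) -> smooth_at F x -> smooth_at G x.
Proof. by move=> FG sF k; exact: CkAt_near FG (sF k). Qed.

Lemma smooth_at_cont F x : smooth_at F x -> {for x, continuous F}.
Proof. by move=> /(_ 0%N)[]. Qed.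

Lemma smooth_at_derivable F x i : smooth_at F x -> derivable F x 'e_i.
Proof. by move=> /(_ 1%N)[_ /(_ i)[]]. Qed.

Lemma smooth_at_derive F x i : smooth_at F x -> smooth_at ('D_('e_i) F) x.
Proof. by move=> sF k; have [_ /(_ i)[]] := sF k.+1. Qed.

Section OpenSet.
Variables (U : set V) (oU : open U).

Lemma open_near x : U x -> \forall y \near x, U y.
Proof. by move=> Ux; apply: open_nbhs_nbhs. Qed.

Lemma zextE (F : V -> R) x : U x -> 'valL_(0 : R) (F \o \val : U -> R) x = F x.
Proof. by move=> /mem_set Ux; rewrite valL0E. Qed.

Lemma zext_partial i (f : U -> R) x : U x ->
  'valL_(0 : R) (partial i f) x = 'D_('e_i) ('valL_(0 : R) f) x.
Proof. by move=> /mem_set Ux; rewrite valL0E. Qed.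

Lemma Ck_CkAt k (f : U -> R) : Ck k f <-> forall x, U x -> CkAt k ('valL_(0 : R) f) x.
Proof.
elim: k f => [|k IH] f; split.
- by move=> [c _] x /mem_set Ux; split=> //; exact: (c (SigSub Ux)).
- by move=> c; split=> // x; have [] := c _ (set_valP x).
- move=> [c [d p]] x Ux; split; first exact: (c (SigSub (mem_set Ux))).
  move=> i; split; first exact: (d i (SigSub (mem_set Ux))).
  have /IH/(_ x Ux) := p i; apply: CkAt_near.
  by have := open_near Ux; apply: filterS => y; exact: zext_partial.
- move=> c; split; first by move=> x; have [] := c _ (set_valP x).
  split=> i; first by move=> x; have [_ /(_ i)[]] := c _ (set_valP x).
  apply/IH => x Ux; have [_ /(_ i)[_]] := c x Ux; apply: CkAt_near.
  by have := open_near Ux; apply: filterS => y /(zext_partial i f) ->.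
Qed.

Lemma smoothP (f : U -> R) : smooth f <-> forall x, U x -> smooth_at ('valL_(0 : R) f) x.
Proof.
split=> [s x Ux k|s k]; first by have /Ck_CkAt := s k; exact.
by apply/Ck_CkAt => x Ux; exact: s.
Qed.

Definition zext (f : smooth_fun oU) : V -> R := 'valL_(0 : R) (smooth_val f).

Lemma zext_smooth (f : smooth_fun oU) x : U x -> smooth_at (zext f) x.
Proof. by have /smoothP := smooth_funP f; exact. Qed.

Lemma zext_val (f : smooth_fun oU) (x : U) : zext f (\val x) = f x.
Proof. exact: valL0_sub. Qed.

Lemma smooth_fun_eq (f g : smooth_fun oU) : (forall x, U x -> zext f x = zext g x) -> f = g.
Proof.
move=> e; apply: val_inj; apply/funext => x.
by have := e _ (set_valP x); rewrite !zext_val.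
Qed.

Lemma restr_smooth (F : V -> R) : (forall x, U x -> smooth_at F x) ->
  (F \o \val : U -> R) \in smooth_pred oU.
Proof.
move=> sF; apply/asboolP/smoothP => x Ux; apply: smooth_at_near (sF x Ux).
by have := open_near Ux; apply: filterS => y /zextE ->.
Qed.

Definition restr F (sF : forall x, U x -> smooth_at F x) : smooth_fun oU :=
  SmoothFun (restr_smooth sF).

Lemma zext_restr F (sF : forall x, U x -> smooth_at F x) x : U x -> zext (restr sF) x = F x.
Proof. exact: zextE. Qed.

Lemma zextD f g x : zext (f + g) x = zext f x + zext g x.
Proof. by rewrite /zext valL0D. Qed.

Lemma zextB f g x : zext (f - g) x = zext f x - zext g x.
Proof. by rewrite /zext valL0B. Qed.

Lemma zextM f g x : zext (f * g) x = zext f x * zext g x.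
Proof. by rewrite /zext valL0M. Qed.

Lemma zext0 x : zext 0 x = 0.
Proof. by rewrite -(subrr (0 : smooth_fun oU)) zextB subrr. Qed.

Lemma zextN f x : zext (- f) x = - zext f x.
Proof. by rewrite -sub0r zextB zext0 sub0r. Qed.

Lemma zext_sum (T : Type) (r : seq T) (P : pred T) (f : T -> smooth_fun oU) x :
  zext (\sum_(t <- r | P t) f t) x = \sum_(t <- r | P t) zext (f t) x.
Proof.
by elim/big_rec2: _ => [|t a b _ <-]; rewrite ?zext0 ?zextD.
Qed.

Lemma zext_const c x : U x -> zext (smooth_const oU c) x = c.
Proof. exact: zextE. Qed.

Lemma zext_coordinate j x : U x -> zext (smooth_coordinate oU j) x = x 0 j.
Proof. exact: (zextE (fun y => y 0 j)). Qed.

Lemma zext_smooth_partial i f x : U x ->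
  zext (smooth_partial i f) x = 'D_('e_i) (zext f) x.
Proof. exact: zext_partial. Qed.

End OpenSet.

End Germs.

(** * Mean value theorem and directional derivatives *)

Section MeanValue.
Variables (R : realType) (V : normedModType R).
Implicit Types (F : V -> R) (x v : V).

Lemma mvt_line F x v (s : R) :
  (forall r : R, `|r| <= `|s| -> derivable F (x + r *: v) v) ->
  exists2 r : R, `|r| <= `|s| & F (x + s *: v) - F x = s * 'D_v F (x + r *: v).
Proof.
move=> dF; pose phi := fun r : R => F (x + r *: v).
have dphi (r : R) : `|r| <= `|s| -> is_derive r 1 phi ('D_v F (x + r *: v)).
  by move=> /dF dr; exact: (proj1 (is_derive_line F x v r _) (derivableP dr)).
have cphi (a b : R) : (forall r : R, r \in `[a, b]%R -> `|r| <= `|s|) ->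
    {within `[a, b], continuous phi}.
  move=> ab; apply: derivable_within_continuous => r rab; have [] := dphi r (ab r rab); exact.
have [s0|s0] := leP 0 s.
  have ins (r : R) : r \in `[0, s]%R -> `|r| <= `|s|.
    by rewrite in_itv /= => /andP[r0 rs]; rewrite !ger0_norm.
  have [|r rs e] := MVT_segment s0 _ (cphi _ _ ins) (df := fun r => 'D_v F (x + r *: v)).
    by move=> r /subset_itv_oo_cc /ins /dphi.
  by exists r; [exact: ins|move: e; rewrite /phi scale0r addr0 subr0 mulrC].
have ins (r : R) : r \in `[s, 0]%R -> `|r| <= `|s|.
  by rewrite in_itv /= => /andP[r0 rs]; rewrite !ler0_norm ?lerN2 // ltW.
have [|r rs e] := MVT_segment (ltW s0) _ (cphi _ _ ins) (df := fun r => 'D_v F (x + r *: v)).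
  by move=> r /subset_itv_oo_cc /ins /dphi.
exists r; first exact: ins.
by move: e; rewrite /phi scale0r addr0 sub0r mulrN mulrC => /eqP; rewrite -eqr_oppLR opprB => /eqP.
Qed.

(** The difference quotient along w + v is the one along w plus that of a step h v from x + h w; the
    mean value theorem and continuity of the derivative along v control the step. Adding coordinate
    directions one by one gives [is_derive_direction]. *)
Lemma is_derive_shift F x w v l :
  is_derive x w F l -> (\forall y \near x, derivable F y v) ->
  {for x, continuous ('D_v F)} -> is_derive x (w + v) F (l + 'D_v F x).
Proof.
move=> [dw <-] dv cv.
suff h : (fun h => h^-1 *: ((F \o shift x) (h *: (w + v)) - F x)) @ 0^' --> 'D_w F x + 'D_v F x.
  by apply: DeriveDef; [apply/cvg_ex; eexists; exact: h|exact/cvg_lim].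
have -> : (fun h => h^-1 *: ((F \o shift x) (h *: (w + v)) - F x)) =
    (fun h => h^-1 *: ((F \o shift x) (h *: w) - F x)) +
    (fun h => h^-1 * (F (x + h *: w + h *: v) - F (x + h *: w))).
  apply/funext => h; rewrite !fctE -[in RHS]mulrDr; congr (_ * _).
  by rewrite /= scalerDr [_ + x]addrC addrA [h *: w + x]addrC; ring.
apply: cvgD; first exact: dw.
apply/cvgrPdist_le => e e0.
have /cvgrPdist_le/(_ _ e0) ce := cv.
have /nbhs_ballP[d /= d0 hd] : \forall y \near x, derivable F y v /\ `|'D_v F x - 'D_v F y| <= e.
  by near do split.
have [M M0 hM] : exists2 M, 0 < M & forall h r : R, `|r| <= `|h| -> `|h| < M ->
    ball x d (x + h *: w + r *: v).
  (* The summand 1 keeps the denominator positive when w = v = 0. *)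
  exists (d / (`|w| + `|v| + 1)); first by rewrite divr_gt0 // ltr_wpDl // addr_ge0.
  move=> h r rh hM; rewrite -ball_normE /ball_ /= -addrA opprD addNKr normrN.
  rewrite (le_lt_trans (ler_normD _ _)) // !normrZ.
  rewrite ltr_pdivlMr in hM; last by rewrite ltr_wpDl // addr_ge0.
  apply: le_lt_trans hM; rewrite !mulrDr mulr1 -addrA lerD2l.
  by rewrite (@le_trans _ _ (`|h| * `|v|)) ?ler_wpM2r // lerDl.
near=> h.
have hM' : `|h| < M.
  by near: h; apply: dnbhs0_lt.
have h0 : h != 0 by near: h; exact: nbhs_dnbhs_neq.
have [|r rh ->] := @mvt_line F (x + h *: w) v h.
  by move=> r rh; have [] := hd _ (hM h r rh hM').
by rewrite mulKf //; have [] := hd _ (hM h r rh hM').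
Unshelve. all: by end_near. Qed.
End MeanValue.

Section Directional.
Variables (R : realType) (n : nat).
Local Notation V := 'rV[R]_n.

Lemma is_derive_scale (F : V -> R) x v (a l : R) :
  is_derive x v F l -> is_derive x (a *: v) F (a * l).
Proof.
move=> /(proj1 (is_derive_at F x v l)) h; apply: (proj2 (is_derive_at F x (a *: v) (a * l))).
have -> : (fun s : R => F (x + s *: (a *: v))) = (fun s : R => F (x + s *: v)) \o (fun s => s * a).
  by apply/funext => s /=; rewrite scalerA.
rewrite mulrC; apply: (is_derive_comp (l := a)).
  have -> : (fun s : R => s * a) = a *: (id : R -> R).
    by apply/funext => s; rewrite fctE mulrC.
  by rewrite -[X in is_derive _ _ _ X]mulr1; apply: is_deriveZ.
by rewrite mul0r.
Qed.

Lemma is_derive_direction (F : V -> R) x (v : V) : (\forall y \near x, smooth_at F y) ->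
  is_derive x v F (\sum_i v 0 i * 'D_('e_i) F x).
Proof.
move=> sF; rewrite [X in is_derive _ X](row_sum_delta v).
have sx := nbhs_singleton sF.
elim/big_rec2: _ => [|i l w _ h].
  by apply: DeriveDef; [exact: derivable0|exact: derive0].
rewrite addrC [X in is_derive _ _ _ X]addrC.
have dd (y : V) : smooth_at F y -> is_derive y (v 0 i *: 'e_i) F (v 0 i * 'D_('e_i) F y).
  by move=> sy; apply: is_derive_scale; apply: derivableP; exact: smooth_at_derivable.
have <- : 'D_(v 0 i *: 'e_i) F x = v 0 i * 'D_('e_i) F x by have [] := dd x sx.
apply: is_derive_shift => //; first by near=> y; apply: (@ex_derive _ _ _ _ _ _ _ (dd y _)); near: y.
have c : {for x, continuous (fun y => v 0 i * 'D_('e_i) F y)}.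
  by apply: continuousM; [exact: cst_continuous|exact/smooth_at_cont/smooth_at_derive].
rewrite /prop_for /continuous_at; have [_ ->] := dd x sx.
have e : \forall y \near x, v 0 i * 'D_('e_i) F y = 'D_(v 0 i *: 'e_i) F y.
  near=> y; have sy : smooth_at F y by near: y.
  by have [_ ->] := dd y sy.
exact: cvg_trans (near_eq_cvg e) c.
Unshelve. all: by end_near. Qed.
End Directional.

(** * Integration along a partial scaling *)

Section UnitIntegral.
Variable R : realType.
Implicit Types (f g F : R -> R).
Local Notation mu := (@lebesgue_measure R).

Definition int01 f : R := \int[mu]_(s in `[0, 1]) f s.
(** Continuity is two-sided even at 0 and 1; the integrands allow it because the scaled points are
    interior to an open set. *)
Definition cont01 f := forall s : R, 0 <= s <= 1 -> {for s, continuous f}.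

Lemma cont01_within f : cont01 f -> {within `[0, 1], continuous f}.
Proof.
move=> cf; apply: continuous_in_subspaceT => s; rewrite inE /= in_itv /=; exact: cf.
Qed.

Lemma cont01_integrable f : cont01 f -> mu.-integrable `[0, 1] (EFin \o f).
Proof.
by move=> cf; apply: continuous_compact_integrable; [exact: segment_compact|exact: cont01_within].
Qed.

Lemma cont01D f g : cont01 f -> cont01 g -> cont01 (fun s => f s + g s).
Proof. by move=> cf cg s hs; apply: continuousD; [exact: cf|exact: cg]. Qed.

Lemma cont01M f g : cont01 f -> cont01 g -> cont01 (fun s => f s * g s).
Proof. by move=> cf cg s hs; apply: continuousM; [exact: cf|exact: cg]. Qed.

Lemma cont01_cst c : cont01 (fun=> c).
Proof. by move=> s _; exact: cst_continuous. Qed.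

Lemma cont01X k : cont01 (fun s => s ^+ k).
Proof. by move=> s _; exact: exprn_continuous. Qed.

Lemma cont01_sum (I : Type) (r : seq I) (P : pred I) (f : I -> R -> R) :
  (forall i, cont01 (f i)) -> cont01 (fun s => \sum_(i <- r | P i) f i s).
Proof.
move=> cf; elim: r => [|i r IH].
  by under eq_fun => s do rewrite big_nil; exact: cont01_cst.
under eq_fun => s do rewrite big_cons.
by case: (P i) => //; apply: cont01D.
Qed.

Lemma eq_int01 f g : (forall s, 0 <= s <= 1 -> f s = g s) -> int01 f = int01 g.
Proof. by move=> e; apply: eq_Rintegral => s; rewrite inE /= in_itv /=; exact: e. Qed.

Lemma int01D f g : cont01 f -> cont01 g -> int01 (fun s => f s + g s) = int01 f + int01 g.
Proof. by move=> cf cg; apply: RintegralD => //; exact: cont01_integrable. Qed.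

Lemma int01Z c f : cont01 f -> int01 (fun s => c * f s) = c * int01 f.
Proof. by move=> cf; apply: RintegralZl => //; exact: cont01_integrable. Qed.

Lemma int01_sum (I : Type) (r : seq I) (P : pred I) (f : I -> R -> R) :
  (forall i, cont01 (f i)) ->
  int01 (fun s => \sum_(i <- r | P i) f i s) = \sum_(i <- r | P i) int01 (f i).
Proof.
move=> cf; elim: r => [|i r IH].
  rewrite big_nil (@eq_int01 _ (fun s => 0 * 1)) => [|s _]; last by rewrite big_nil mul0r.
  by rewrite int01Z ?mul0r //; exact: cont01_cst.
rewrite big_cons -IH; case: ifP => Pi.
  by rewrite -int01D //; [apply: eq_int01 => s _; rewrite big_cons Pi|exact: cont01_sum].
by apply: eq_int01 => s _; rewrite big_cons Pi.
Qed.

Lemma int01_norm_le f e : cont01 f -> (forall s, 0 <= s <= 1 -> `|f s| <= e) -> `|int01 f| <= e.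
Proof.
move=> cf fe; have mI : measurable (`[0, 1]%classic : set (measurableTypeR R)) by [].
have cnf : cont01 (fun s => `|f s|).
  by move=> s hs; apply: continuous_comp; [exact: cf|exact: norm_continuous].
apply: le_trans (le_normr_Rintegral mI (cont01_integrable cf)) _.
have <- : int01 (fun=> e) = e.
  have mu1 : mu `[0, 1]%classic = 1%E by rewrite lebesgue_measure_itv /= lte_fin ltr01 sube0.
  by rewrite /int01 Rintegral_cst // [X in fine X]mu1 mulr1.
apply: (le_Rintegral mI (cont01_integrable cnf) (cont01_integrable (@cont01_cst e))) => s.
by rewrite /= in_itv /=; exact: fe.
Qed.

Lemma int01_derive f F : cont01 f ->
  (forall s : R, 0 <= s <= 1 -> is_derive s 1 F (f s)) -> int01 f = F 1 - F 0.
Proof.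
move=> cf dF; rewrite /int01 /Rintegral (@continuous_FTC2 _ f F) //.
- exact: cont01_within.
- have c s : 0 <= s <= 1 -> {for s, continuous F}.
    move=> /dF [d _]; apply: differentiable_continuous; exact/derivable1_diffP.
  split.
  + by move=> s; rewrite in_itv /= => /andP[/ltW s0 /ltW s1]; case: (dF s); rewrite ?s0.
  + by apply: cvg_at_right_filter; apply: c; rewrite lexx ler01.
  + by apply: cvg_at_left_filter; apply: c; rewrite lexx ler01.
move=> s; rewrite in_itv /= => /andP[/ltW s0 /ltW s1]; rewrite derive1E.
by case: (dF s); rewrite ?s0.
Qed.

End UnitIntegral.

Section Scaling.
Variables (R : realType) (n : nat).
Local Notation V := 'rV[R]_n.
Variables (J : pred 'I_n) (c : V).
Implicit Types (x y : V) (s : R) (F : V -> R) (i : 'I_n).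

(** Homothety of centre [c] and ratio s in the coordinates of [J] alone. J = {t} gives primitives in
    time, J = the u-coordinates the inverse of E + w + 1, and a single coordinate serves for the
    symmetry of mixed partials. *)
Definition scaling s x : V := \row_i (if J i then c 0 i + s * (x 0 i - c 0 i) else x 0 i).
Definition scaling_dir x : V := \row_i (if J i then x 0 i - c 0 i else 0).

Lemma scaling_line s x : scaling s x = scaling 0 x + s *: scaling_dir x.
Proof. by apply/rowP => i; rewrite !mxE; case: ifP => _; ring. Qed.

Lemma scaling1 x : scaling 1 x = x.
Proof. by apply/rowP => i; rewrite !mxE; case: ifP => _; ring. Qed.

Lemma scaling_shift s x i (h : R) :
  scaling s (x + h *: 'e_i) = scaling s x + (h * s ^+ J i) *: 'e_i.
Proof.
apply/rowP => j; rewrite !mxE eqxx /=; case: (eqVneq j i) => [->|_].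
  by case: (J i); rewrite ?expr1 ?expr0; ring.
by case: (J j); rewrite ?mulr0 ?addr0.
Qed.

Lemma scaling_continuous s x : {for (s, x), continuous (fun p : R * V => scaling p.1 p.2)}.
Proof.
have ce i : {for (s, x), continuous (fun p : R * V => scaling p.1 p.2 0 i)}.
  have c2 : {for (s, x), continuous (fun p : R * V => p.2 0 i)}.
    by apply: (@continuous_comp _ _ _ snd (fun y : V => y 0 i)); [exact: cvg_snd|exact: coord_continuous].
  have -> : (fun p : R * V => scaling p.1 p.2 0 i) =
     (fun p => if J i then c 0 i + p.1 * (p.2 0 i - c 0 i) else p.2 0 i).
    by apply/funext => p; rewrite mxE.
  case: (J i) => //.
  apply: continuousD; first exact: cst_continuous.
  apply: continuousM; first exact: cvg_fst.
  by apply: continuousB => //; exact: cst_continuous.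
apply/cvg_ballP => e e0.
have h : \forall p \near (s, x), forall i, ball (scaling s x 0 i) e (scaling p.1 p.2 0 i).
  apply: (@filter_forall (R * V)%type 'I_n
    (fun i p => ball (scaling s x 0 i) e (scaling p.1 p.2 0 i)) (nbhs (s, x)) _).
  by move=> i; have /cvg_ballP/(_ e e0) := ce i.
by apply: filterS h => p hp; rewrite /ball /= /mx_ball; split=> // a b; rewrite (ord1 a); exact: hp.
Qed.

Lemma scaling_continuousl s x : {for s, continuous (fun s => scaling s x)}.
Proof.
have cs := @scaling_continuous s x.
exact: (@continuous2_cvg _ _ _ _ (nbhs s) _ id (cst x) scaling s x cs cvg_id (cvg_cst x)).
Qed.

(** The tube lemma: compactness of [0, 1] makes the neighbourhood of x uniform in s. *)
Lemma near01 (Q : R -> V -> Prop) x :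
  (forall s, 0 <= s <= 1 -> \forall s' \near s & y \near x, Q s' y) ->
  \forall y \near x, forall s, 0 <= s <= 1 -> Q s y.
Proof.
move=> h; have /compact_near_coveringP cpt := @segment_compact R 0 1.
have := cpt V (nbhs x) (fun y s => Q s y) _ _.
move=> /(_ _) H; apply: filterS (H _) => [y hy s hs|s]; first by apply: hy; rewrite /= in_itv.
by rewrite /= in_itv /= => /h.
Qed.

Lemma is_derive_scaling s F x i : smooth_at F (scaling s x) ->
  is_derive x 'e_i (fun y => F (scaling s y)) (s ^+ J i * 'D_('e_i) F (scaling s x)).
Proof.
move=> sF; apply: (proj2 (is_derive_at _ _ _ _)).
have -> : (fun r : R => F (scaling s (x + r *: 'e_i))) =
          (fun r => F (scaling s x + r *: (s ^+ J i *: 'e_i))).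
  by apply/funext => r; rewrite scaling_shift scalerA.
apply: (proj1 (is_derive_at _ _ _ _)); apply: is_derive_scale; apply: derivableP.
exact: smooth_at_derivable.
Qed.

Variables (W : set V) (oW : open W).
Hypothesis starW : forall x s, W x -> 0 <= s <= 1 -> W (scaling s x).

Let smooth_on F := forall x, W x -> smooth_at F x.

Definition scaled_integral (w : nat) F x : R := int01 (fun s => s ^+ w * F (scaling s x)).

Lemma cont01_scaling F x : smooth_on F -> W x -> cont01 (fun s => F (scaling s x)).
Proof.
move=> sF Wx s hs; apply: continuous_comp; first exact: scaling_continuousl.
by apply/smooth_at_cont/sF/starW.
Qed.

Lemma cont01_integrand w F x : smooth_on F -> W x ->
  cont01 (fun s => s ^+ w * F (scaling s x)).
Proof. by move=> sF Wx; apply: cont01M; [exact: cont01X|exact: cont01_scaling]. Qed.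

Lemma near_scaling F x (e : R) : smooth_on F -> W x -> 0 < e ->
  \forall y \near x, forall s, 0 <= s <= 1 ->
    `|F (scaling s y) - F (scaling s x)| <= e.
Proof.
move=> sF Wx e0.
apply: (near01 (Q := fun s y => `|F (scaling s y) - F (scaling s x)| <= e)) => s hs.
have cF : {for scaling s x, continuous F} by apply/smooth_at_cont/sF/starW.
(* Halves, because the covering argument moves s too: both values at s' are compared with the one at
   the fixed s. *)
have e2 : 0 < e / 2 by rewrite divr_gt0.
have c0 := @scaling_continuous s x.
have c1 : (fun p : R * V => F (scaling p.1 p.2)) @ (s, x) --> F (scaling s x).
  exact: (cvg_comp _ _ c0 cF).
have c3 : (fun p : R * V => scaling p.1 x) @ (s, x) --> scaling s x.
  have f1 : (fst : R * V -> R) @ (s, x) --> s by exact: cvg_fst.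
  exact: (@cvg_comp _ _ _ fst (fun r => scaling r x) _ _ _ f1 (@scaling_continuousl s x)).
have c2 : (fun p : R * V => F (scaling p.1 x)) @ (s, x) --> F (scaling s x).
  exact: (cvg_comp _ _ c3 cF).
have /cvgrPdist_le/(_ _ e2) h1 := c1.
have /cvgrPdist_le/(_ _ e2) h2 := c2.
near=> p; rewrite [leRHS]splitr.
have -> : F (scaling p.1 p.2) - F (scaling p.1 x) =
  (F (scaling s x) - F (scaling p.1 x)) - (F (scaling s x) - F (scaling p.1 p.2)) by ring.
by rewrite (le_trans (ler_normB _ _)) // lerD //; near: p.
Unshelve. all: by end_near. Qed.

Lemma int01_weight_le w (g : R -> R) (e : R) : cont01 g ->
  (forall s, 0 <= s <= 1 -> `|g s| <= e) -> `|int01 (fun s => s ^+ w * g s)| <= e.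
Proof.
move=> cg ge; apply: int01_norm_le; first by apply: cont01M => //; exact: cont01X.
move=> s hs; rewrite normrM -[leRHS]mul1r ler_pM //; last exact: ge.
by case/andP: hs => s0 s1; rewrite ger0_norm ?exprn_ge0 // exprn_ile1.
Qed.

Lemma scaled_integral_cont w F x : smooth_on F -> W x ->
  {for x, continuous (scaled_integral w F)}.
Proof.
move=> sF Wx; apply/(@cvgrPdist_le _ _ _ (nbhs x) _ (scaled_integral w F)) => e e0.
have := near_scaling sF Wx e0; have := open_near oW Wx; apply: filterS2 => y Wy hy.
rewrite distrC /scaled_integral -mulN1r -int01Z; last exact: cont01_integrand.
rewrite -int01D; [|exact: cont01_integrand|]; last first.
  by apply: cont01M; [exact: cont01_cst|exact: cont01_integrand].
rewrite (@eq_int01 _ _ (fun s => s ^+ w * (F (scaling s y) - F (scaling s x)))) => [|s _]; last ring.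
apply: int01_weight_le => //; apply: cont01D; first exact: cont01_scaling.
move=> s hs; apply: continuousN; exact: cont01_scaling.
Qed.

(** Differentiation under the integral: the mean value theorem replaces the difference quotient by a
    derivative at a nearby point, and [near_scaling] bounds the error uniformly in s. The inner
    derivative s ^ J i raises the weight by one in the scaled coordinates. *)
Lemma scaled_integral_is_derive w F x i : smooth_on F -> W x ->
  is_derive x 'e_i (scaled_integral w F) (scaled_integral (w + J i) ('D_('e_i) F) x).
Proof.
move=> sF Wx.
have sD : smooth_on ('D_('e_i) F) by move=> y /sF; exact: smooth_at_derive.
suff h : (fun h => h^-1 *: ((scaled_integral w F \o shift x) (h *: 'e_i) - scaled_integral w F x)) @ 0^'
     --> scaled_integral (w + J i) ('D_('e_i) F) x.
  by apply: DeriveDef; [apply/cvg_ex; eexists; exact: h|exact/cvg_lim].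
apply/cvgrPdist_le => e e0.
have /nbhs_ballP[d /= d0 hd] : \forall y \near x, W y /\ forall s, 0 <= s <= 1 ->
    `|'D_('e_i) F (scaling s y) - 'D_('e_i) F (scaling s x)| <= e.
  have := near_scaling sD Wx e0; have := open_near oW Wx; exact: filterS2.
have ed : 0 < d / (`|'e_i : V| + 1) by rewrite divr_gt0 // ltr_wpDl.
near=> h.
have h0 : h != 0 by near: h; exact: nbhs_dnbhs_neq.
have hM : `|h| < d / (`|'e_i : V| + 1) by near: h; apply: dnbhs0_lt.
have inb (r : R) : `|r| <= `|h| -> ball x d (x + r *: 'e_i).
  move=> rh; rewrite -ball_normE /ball_ /= opprD addNKr normrN normrZ.
  rewrite ltr_pdivlMr in hM; last by rewrite ltr_wpDl.
  by apply: le_lt_trans hM; rewrite ler_pM // lerDl.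
have Wh : W (x + h *: 'e_i) by have [] := hd _ (inb h (lexx _)).
have cD := @cont01_integrand (w + J i) _ _ sD Wx.
have cD0 := @cont01_integrand (J i) _ _ sD Wx.
have ch := @cont01_integrand w _ _ sF Wh.
have cx := @cont01_integrand w _ _ sF Wx.
have -> : scaled_integral (w + J i) ('D_('e_i) F) x -
   h^-1 *: ((scaled_integral w F \o shift x) (h *: 'e_i) - scaled_integral w F x) =
   int01 (fun s => s ^+ w * (s ^+ J i * 'D_('e_i) F (scaling s x) -
                             h^-1 * (F (scaling s (x + h *: 'e_i)) - F (scaling s x)))).
  rewrite /= (addrC _ x) /scaled_integral.
  transitivity (int01 (fun s => s ^+ (w + J i) * 'D_('e_i) F (scaling s x) +
     ((- h^-1) * (s ^+ w * F (scaling s (x + h *: 'e_i))) + h^-1 * (s ^+ w * F (scaling s x))))).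
    have cz a f : cont01 f -> cont01 (fun s => a * f s).
      by move=> cf; apply: cont01M => //; exact: cont01_cst.
    rewrite (int01D cD (cont01D (cz _ _ ch) (cz _ _ cx))) (int01D (cz _ _ ch) (cz _ _ cx)).
    rewrite (int01Z _ ch) (int01Z _ cx).
    by rewrite [_ *: _]mulrBr; ring.
  by apply: eq_int01 => s _; rewrite exprD; ring.
apply: int01_weight_le.
  apply: (cont01D cD0) => s hs; apply: continuousN; apply: continuousM; first exact: cst_continuous.
  by apply: continuousB; exact: cont01_scaling.
move=> s hs; have [|r rh ->] := @mvt_line _ _ (fun y => F (scaling s y)) x 'e_i h.
  move=> r rh; have [Wr _] := hd _ (inb r rh).
  by have [] := is_derive_scaling i (sF _ (starW Wr hs)).
have [Wr hr] := hd _ (inb r rh).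
have [_ ->] := is_derive_scaling i (sF _ (starW Wr hs)).
rewrite mulKf // -mulrBr normrM -[leRHS]mul1r ler_pM //; last by rewrite distrC; exact: hr.
by case/andP: hs => s0 s1; rewrite ger0_norm ?exprn_ge0 // exprn_ile1.
Unshelve. all: by end_near. Qed.

Lemma scaled_integral_smooth w F : smooth_on F -> smooth_on (scaled_integral w F).
Proof.
move=> sF x Wx k; elim: k w F sF x Wx => [|k IH] w F sF x Wx; split=> //.
- exact: scaled_integral_cont.
- exact: scaled_integral_cont.
move=> i; have [d _] := scaled_integral_is_derive w i sF Wx; split=> //.
have sD : smooth_on ('D_('e_i) F) by move=> y /sF; exact: smooth_at_derive.
apply: CkAt_near (IH (w + J i)%N _ sD x Wx).
have := open_near oW Wx; apply: filterS => y Wy.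
by have [_ ->] := scaled_integral_is_derive w i sF Wy.
Qed.

Lemma is_derive_along F x s : smooth_on F -> W x -> 0 <= s <= 1 ->
  is_derive s 1 (fun r => F (scaling r x))
    (\sum_i scaling_dir x 0 i * 'D_('e_i) F (scaling s x)).
Proof.
move=> sF Wx hs; have -> : (fun r => F (scaling r x)) = (fun r => F (scaling 0 x + r *: scaling_dir x)).
  by apply/funext => r; rewrite scaling_line.
apply: (proj1 (is_derive_line F (scaling 0 x) (scaling_dir x) s _)).
rewrite -scaling_line; apply: is_derive_direction.
by have := open_near oW (starW Wx hs); apply: filterS => y /sF.
Qed.

Lemma cont01_along F x : smooth_on F -> W x ->
  cont01 (fun s => \sum_i scaling_dir x 0 i * 'D_('e_i) F (scaling s x)).
Proof.
move=> sF Wx; apply: cont01_sum => i; apply: cont01M; first exact: cont01_cst.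
by apply: (@cont01_scaling ('D_('e_i) F)) => // y /sF; exact: smooth_at_derive.
Qed.

(** Hadamard's lemma: integrate the derivative of s |-> F (scaling s x). *)
Lemma scaled_integral_div F x : smooth_on F -> W x ->
  \sum_i scaling_dir x 0 i * scaled_integral 0 ('D_('e_i) F) x = F x - F (scaling 0 x).
Proof.
move=> sF Wx; have sD i : smooth_on ('D_('e_i) F) by move=> y /sF; exact: smooth_at_derive.
have := int01_derive (cont01_along sF Wx) (fun s hs => is_derive_along sF Wx hs).
rewrite scaling1 => <-.
rewrite int01_sum => [|i]; last by apply: cont01M; [exact: cont01_cst|exact: (cont01_scaling (sD i) Wx)].
apply: eq_bigr => i _; rewrite int01Z; last exact: (cont01_scaling (sD i) Wx).
by congr (_ * _); apply: eq_int01 => s _; rewrite expr0 mul1r.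
Qed.

(** Integrate the derivative of s ^ (w + 1) F (scaling s x) over [0, 1]; the power of s kills the
    boundary term at 0. *)
Lemma scaled_integral_euler w F x : smooth_on F -> W x ->
  w.+1%:R * scaled_integral w F x
  + \sum_i scaling_dir x 0 i * scaled_integral w.+1 ('D_('e_i) F) x = F x.
Proof.
move=> sF Wx; have sD i : smooth_on ('D_('e_i) F) by move=> y /sF; exact: smooth_at_derive.
pose G s := s ^+ w.+1 * F (scaling s x).
pose g s := w.+1%:R * (s ^+ w * F (scaling s x)) +
  \sum_i scaling_dir x 0 i * (s ^+ w.+1 * 'D_('e_i) F (scaling s x)).
have c1 i : cont01 (fun s => scaling_dir x 0 i * (s ^+ w.+1 * 'D_('e_i) F (scaling s x))).
  have ci := cont01_integrand (w := w.+1) (sD i) Wx.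
  by apply: cont01M; [exact: cont01_cst|exact: ci].
have c2 : cont01 (fun s => w.+1%:R * (s ^+ w * F (scaling s x))).
  by apply: cont01M; [exact: cont01_cst|exact: cont01_integrand].
have c3 : cont01 (fun s => \sum_i scaling_dir x 0 i * (s ^+ w.+1 * 'D_('e_i) F (scaling s x))).
  exact: cont01_sum.
have cg : cont01 g by exact: cont01D.
have dG s : 0 <= s <= 1 -> is_derive s 1 G (g s).
  move=> hs; have d1 := is_derive_along sF Wx hs.
  have d2 : is_derive s 1 (fun r : R => r ^+ w.+1) (w.+1%:R * s ^+ w).
    have -> : (fun r : R => r ^+ w.+1) = (id : R -> R) ^+ w.+1.
      by apply/funext => r; rewrite exprfctE.
    by apply: is_derive_eq; rewrite /= [_ *: 1]mulr1 // mulr_natl.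
  have -> : G = (fun r : R => r ^+ w.+1) * (fun r => F (scaling r x)) by [].
  have d3 := is_deriveM d2 d1; apply: is_derive_eq.
  rewrite /g addrC; congr (_ + _); first by rewrite [LHS]mulrC; ring.
  by rewrite [LHS]mulr_sumr; apply: eq_bigr => i _; ring.
have := int01_derive cg dG; rewrite /G expr1n mul1r expr0n mul0r subr0 scaling1 => <-.
rewrite /g int01D // int01Z; last exact: cont01_integrand.
rewrite int01_sum //; congr (_ + _); apply: eq_bigr => i _.
by rewrite int01Z //; exact: (cont01_integrand (sD i) Wx).
Qed.

End Scaling.

Section ScaledIntegralRing.
Variables (R : realType) (n : nat) (J : pred 'I_n) (c : 'rV[R]_n).
Variables (W : set 'rV[R]_n) (oW : open W).
Hypothesis starW : forall x s, W x -> 0 <= s <= 1 -> W (scaling J c s x).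
Implicit Types (f g : smooth_fun oW) (i : 'I_n) (x : 'rV[R]_n).
Local Notation D := (@smooth_partial R n W oW).

Lemma zext1 x : W x -> zext (1 : smooth_fun oW) x = 1.
Proof. by move=> /mem_set Wx; rewrite /zext valL0E. Qed.

Lemma zext_nat k x : W x -> zext (k%:R : smooth_fun oW) x = k%:R.
Proof. by move=> Wx; elim: k => [|k IH]; rewrite ?zext0 // !mulrS zextD IH zext1. Qed.

Definition sint (w : nat) f : smooth_fun oW :=
  restr oW (scaled_integral_smooth oW starW w (@zext_smooth _ _ _ oW f)).

Lemma zext_sint w f x : W x -> zext (sint w f) x = scaled_integral J c w (zext f) x.
Proof. exact: zext_restr. Qed.

Lemma eq_scaled_integral w (F G : 'rV[R]_n -> R) x : W x -> (forall y, W y -> F y = G y) ->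
  scaled_integral J c w F x = scaled_integral J c w G x.
Proof. by move=> Wx e; apply: eq_int01 => s hs; rewrite e //; exact: starW. Qed.

Lemma sint_partial i w f : D i (sint w f) = sint (w + J i) (D i f).
Proof.
apply: smooth_fun_eq => x Wx; rewrite zext_smooth_partial // zext_sint //.
have sf := @zext_smooth _ _ _ oW f.
rewrite (@eq_scaled_integral _ _ ('D_('e_i) (zext f))) // => [|y Wy]; last exact: zext_smooth_partial.
have [_ <-] := scaled_integral_is_derive oW starW w i sf Wx.
by apply: near_eq_derive; have := open_near oW Wx; apply: filterS => y; exact: zext_sint.
Qed.

Definition centered i : smooth_fun oW := smooth_coordinate oW i - smooth_const oW (c 0 i).

Lemma zext_centered i x : W x -> J i -> zext (centered i) x = scaling_dir J c x 0 i.
Proof. by move=> Wx Ji; rewrite zextB zext_coordinate // zext_const // !mxE Ji. Qed.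

Lemma sum_scaling_dir x (g : 'I_n -> R) :
  \sum_i scaling_dir J c x 0 i * g i = \sum_(i | J i) scaling_dir J c x 0 i * g i.
Proof.
rewrite [RHS]big_mkcond; apply: eq_bigr => i _.
by case: ifP => Ji //; rewrite mxE Ji mul0r.
Qed.

Lemma sint_euler w f :
  w.+1%:R * sint w f + \sum_(i | J i) centered i * sint w.+1 (D i f) = f.
Proof.
apply: smooth_fun_eq => x Wx; rewrite zextD zextM zext_nat // zext_sint // zext_sum.
have sf := @zext_smooth _ _ _ oW f.
rewrite -[RHS](scaled_integral_euler oW starW w sf Wx) sum_scaling_dir; congr (_ + _).
apply: eq_bigr => i Ji; rewrite zextM zext_centered // zext_sint //; congr (_ * _).
by apply: eq_scaled_integral => // y; exact: zext_smooth_partial.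
Qed.

Lemma sint_div f x : W x ->
  zext (\sum_(i | J i) centered i * sint 0 (D i f)) x = zext f x - zext f (scaling J c 0 x).
Proof.
have sf := @zext_smooth _ _ _ oW f.
move=> Wx; rewrite -(scaled_integral_div oW starW sf Wx) sum_scaling_dir zext_sum.
apply: eq_bigr => i Ji; rewrite zextM zext_centered // zext_sint //; congr (_ * _).
by apply: eq_scaled_integral => // y; exact: zext_smooth_partial.
Qed.

(** Scaling multiplies a centred coordinate by s, which pays for one unit of weight. *)
Lemma sint_centered i w f : J i -> centered i * sint w.+1 f = sint w (centered i * f).
Proof.
move=> Ji; apply: smooth_fun_eq => x Wx; rewrite zextM zext_centered // !zext_sint //.
have sf := @zext_smooth _ _ _ oW f.
rewrite /scaled_integral -int01Z; last exact: (cont01_integrand starW sf Wx).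
apply: eq_int01 => s hs; rewrite zextM zext_centered //; last exact: starW.
by rewrite !mxE Ji exprS; ring.
Qed.

Lemma sintD w f g : sint w (f + g) = sint w f + sint w g.
Proof.
apply: smooth_fun_eq => x Wx; rewrite zextD !zext_sint // /scaled_integral.
have sf := @zext_smooth _ _ _ oW f; have sg := @zext_smooth _ _ _ oW g.
rewrite -int01D; [|exact: (cont01_integrand starW sf Wx)|exact: (cont01_integrand starW sg Wx)].
by apply: eq_int01 => s hs; rewrite zextD mulrDr.
Qed.

Lemma sint0 w : sint w 0 = 0.
Proof. by apply: (addIr (sint w 0)); rewrite -sintD !add0r. Qed.

End ScaledIntegralRing.

(** * Composition with functions of one variable, inverses *)

Section SmoothReal.
Variables (R : realType) (n : nat) (U : set 'rV[R]_n) (oU : open U).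
Implicit Types (f g : U -> R) (i : 'I_n).

Lemma CkN k f : Ck k f -> Ck k (- f).
Proof. by move=> cf; rewrite -sub0r; apply: CkB => //; exact: (smooth_cst oU 0). Qed.

Lemma zext_comp (h : R -> R) f x : U x ->
  'valL_(0 : R) (h \o f : U -> R) x = (h \o 'valL_(0 : R) f) x.
Proof. by move=> /mem_set Ux; rewrite /comp !valL0E. Qed.

Lemma zext_comp_near (h : R -> R) f x : U x ->
  \forall y \near x, (h \o 'valL_(0 : R) f) y = 'valL_(0 : R) (h \o f : U -> R) y.
Proof. by move=> Ux; have := open_near oU Ux; apply: filterS => y /(zext_comp h f) ->. Qed.

Lemma Ck_comp0 (h : R -> R) f :
  (forall x : U, {for f x, continuous h}) -> (forall x : U, {for \val x, continuous ('valL_(0 : R) f)}) ->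
  forall x : U, {for \val x, continuous ('valL_(0 : R) (h \o f : U -> R))}.
Proof.
move=> ch cf x; have e := zext_comp_near h f (set_valP x).
rewrite /prop_for /continuous_at -(nbhs_singleton e).
apply: cvg_trans (near_eq_cvg e) _.
have cx : h @ nbhs ('valL_(0 : R) f (\val x)) --> h ('valL_(0 : R) f (\val x)).
  by rewrite valL0_sub; exact: ch.
exact: (cvg_comp _ _ (cf x) cx).
Qed.

Lemma partial_comp (h dh : R -> R) f i (x : U) :
  is_derive (f x) 1 h (dh (f x)) -> derivable ('valL_(0 : R) f) (\val x) 'e_i ->
  is_derive (\val x) 'e_i ('valL_(0 : R) (h \o f : U -> R)) (dh (f x) * partial i f x).
Proof.
move=> dh1 df; have e := zext_comp_near h f (set_valP x).
have d : is_derive (\val x) 'e_i (h \o 'valL_(0 : R) f) (dh (f x) * partial i f x).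
  by apply: is_derive_comp; [exact: derivableP|rewrite valL0_sub].
case: d => d1 d2; apply: DeriveDef; first exact: near_eq_derivable e d1.
by rewrite -(near_eq_derive _ e).
Qed.

(** The derivative of 1/f is - (1/f)^2 D f, a product of functions that are already of class k, so
    the induction closes. *)
Lemma Ck_inv k f : (forall x, f x != 0) -> Ck k f -> Ck k ((@GRing.inv R) \o f).
Proof.
move=> f0; elim: k f f0 => [|k IH] f f0 cf.
  by split=> //; apply: Ck_comp0 => x; [exact: inv_continuous|exact: Ck_cont cf].
have d i (x : U) : is_derive (\val x) 'e_i ('valL_(0 : R) (GRing.inv \o f : U -> R))
    (- (f x) ^- 2 * partial i f x).
  apply: (partial_comp (dh := fun y => - y ^- 2)); last by case: cf => _ [].
  apply: DeriveDef; first exact: derivableV.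
  by rewrite (@deriveV _ _ id) // derive_id [_ *: 1]mulr1.
split; first by apply: Ck_comp0 => x; [exact: inv_continuous|exact: Ck_cont cf].
split=> i; first by move=> x; case: (d i x).
have -> : partial i (GRing.inv \o f) = - ((GRing.inv \o f) * (GRing.inv \o f) * partial i f).
  by apply/funext => x; rewrite /partial; case: (d i x) => _ ->; rewrite !fctE /= expr2 invfM mulNr.
have [_ [_ pf]] := cf; have ci := IH f f0 (CkW cf).
exact: (CkN (CkM (CkM ci ci) (pf i))).
Qed.

Lemma smooth_inv (f : smooth_fun oU) : (forall x, U x -> zext f x != 0) ->
  exists g : smooth_fun oU, g * f = 1.
Proof.
move=> f0; have f0' (x : U) : f x != 0 by rewrite -zext_val; exact/f0/set_valP.
have sg : ((@GRing.inv R) \o f : U -> R) \in smooth_pred oU.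
  by apply/asboolP => k; apply: Ck_inv => //; exact: smooth_funP.
exists (SmoothFun sg); apply: val_inj; apply/funext => x.
exact: (mulVf (f0' x)).
Qed.

End SmoothReal.

(** * Partitions of unity *)

Section Flat.
Variable R : realType.
Implicit Types (y z : R) (k : nat).

(** The cutoff is [flat 0]. Its derivatives involve y^(-k) exp(-1/y), and the whole family is closed
    under differentiation up to linear combinations, which makes smoothness an induction. *)
Definition flat k y : R := if 0 < y then y ^- k * expR (- y^-1) else 0.

Lemma flat_gt0 y : 0 < y -> 0 < flat 0 y.
Proof. by move=> y0; rewrite /flat y0 expr0 invr1 mul1r expR_gt0. Qed.

Lemma flat_le0 k y : y <= 0 -> flat k y = 0.
Proof. by move=> y0; rewrite /flat ltNge y0. Qed.

Lemma flat_ge0 k y : 0 <= flat k y.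
Proof.
rewrite /flat; case: ifP => // y0.
by rewrite mulr_ge0 ?expR_ge0 // invr_ge0 exprn_ge0 // ltW.
Qed.

Lemma flatS k y : flat k.+1 y = y^-1 * flat k y.
Proof. by rewrite /flat; case: ifP => _; rewrite ?mulr0 // exprS invfM mulrA. Qed.

(* exp z = exp (z / k) ^ k >= (z / k) ^ k. *)
Lemma expr_le_expR k z : 0 <= z -> (z / k.+1%:R) ^+ k.+1 <= expR z.
Proof.
move=> z0; have -> : expR z = expR (z / k.+1%:R) ^+ k.+1.
  by rewrite -expRM_natl mulrC divfK // pnatr_eq0.
rewrite lerXn2r ?nnegrE ?expR_ge0 ?divr_ge0 //.
by rewrite (le_trans _ (expR_ge1Dx _)) // lerDr.
Qed.

(** [expr_le_expR] at z = 1/y with exponent k + 1, one more than y^(-k) requires: the spare factor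
    |y| gives continuity at 0. *)
Lemma flat_le k y : flat k y <= k.+1%:R ^+ k.+1 * `|y|.
Proof.
have [y0|y0] := ltP 0 y; last by rewrite flat_le0 // mulr_ge0 // exprn_ge0.
have yn0 : y != 0 by rewrite gt_eqF.
rewrite /flat y0 expRN gtr0_norm // ler_pdivrMl ?exprn_gt0 //.
have h : (y^-1 / k.+1%:R) ^+ k.+1 <= expR y^-1 by apply: expr_le_expR; rewrite invr_ge0 ltW.
have p0 : 0 < (y^-1 / k.+1%:R) ^+ k.+1 by rewrite exprn_gt0 // divr_gt0 ?invr_gt0.
have -> : y ^+ k * (k.+1%:R ^+ k.+1 * y) = ((y^-1 / k.+1%:R) ^+ k.+1)^-1.
  by rewrite mulrCA -exprSr -exprMn -exprVn invfM !invrK mulrC.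
by rewrite lef_pV2 // posrE ?expR_gt0.
Qed.

Lemma flat_near0 k : flat k @ (0 : R) --> (0 : R).
Proof.
apply/(@cvgr0Pnorm_le _ _ _ (nbhs (0 : R)) _ (flat k)) => e e0.
have M0 : 0 < k.+1%:R ^+ k.+1 :> R by rewrite exprn_gt0.
have d0 : 0 < (k.+1%:R ^+ k.+1)^-1 * e by rewrite mulr_gt0 ?invr_gt0.
have := nbhsx_ballx (0 : R) _ d0; apply: filterS => y.
rewrite -ball_normE /ball_ /= sub0r normrN => /ltW yd.
by rewrite ger0_norm ?flat_ge0 // (le_trans (flat_le _ _)) // -ler_pdivlMl.
Unshelve. all: by end_near. Qed.

Lemma is_derive_flat k y : is_derive y 1 (flat k) (flat k.+2 y - k%:R * flat k.+1 y).
Proof.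
have [y0|y0|->] := ltrgtP y 0.
- rewrite !flat_le0 ?(ltW y0) // mulr0 subrr.
  have e : \forall z \near y, cst 0 z = flat k z.
    by near=> z; rewrite flat_le0 //; apply/ltW; near: z; exact: lt_nbhsl.
  exact: (near_eq_is_derive e (is_derive_cst _ _ _)).
- have yn0 : y != 0 by rewrite gt_eqF.
  have e : \forall z \near y,
      ((fun z : R => z^-1) ^+ k * (expR \o (fun z : R => - z^-1))) z = flat k z.
    near=> z; rewrite /flat ifT ?fctE ?exprfctE /= ?exprVn //.
    by near: z; exact: lt_nbhsr.
  have dV : is_derive y 1 (fun z : R => z^-1) (- y ^- 2).
    apply: DeriveDef; first exact: (derivableV (f := id)).
    by rewrite (@deriveV _ _ id) // derive_id [_ *: 1]mulr1.
  have dE : is_derive y 1 (expR \o (fun z : R => - z^-1)) (expR (- y^-1) * y ^- 2).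
    have dN : is_derive y 1 (fun z : R => - z^-1) (y ^- 2).
      by rewrite -[y ^- 2]opprK; exact: is_deriveN.
    exact: (is_derive_comp dN (is_derive_expR _)).
  apply: (near_eq_is_derive e); have d := is_deriveM (is_deriveX k dV) dE.
  apply: is_derive_eq; rewrite /flat y0 exprfctE /=.
  rewrite ![_ *: _]mulrC !exprS !invfM -!exprVn.
  by case: k {e d} => [|k]; [rewrite !mul0r|rewrite /= exprS]; ring.
rewrite !flat_le0 // mulr0 subrr.
(* At 0 the difference quotient of [flat k] is [flat k.+1], which tends to 0. *)
have h : (fun h => h^-1 *: ((flat k \o shift 0) (h *: 1) - flat k 0)) @ 0^' --> (0 : R).
  have c0 : flat k.+1 @ 0^' --> (0 : R).
    by apply: cvg_trans (@flat_near0 k.+1); apply: cvg_app; exact: cvg_within.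
  apply: cvg_trans c0; apply: near_eq_cvg; near=> h.
  by rewrite /= addr0 [h *: 1]mulr1 (flat_le0 _ (lexx 0)) subr0 flatS.
by apply: DeriveDef; [apply/cvg_ex; eexists; exact: h|exact/cvg_lim].
Unshelve. all: by end_near. Qed.

Lemma flat_continuous k : continuous (flat k).
Proof.
move=> y; apply: differentiable_continuous; apply/derivable1_diffP.
by case: (is_derive_flat k y).
Qed.

Variables (n : nat) (U : set 'rV[R]_n) (oU : open U).

Lemma Ck_flat k m (f : U -> R) : Ck k f -> Ck k (flat m \o f : U -> R).
Proof.
elim: k m f => [|k IH] m f cf.
  by split=> //; apply: (Ck_comp0 oU) => x; [exact: flat_continuous|exact: Ck_cont cf].
have d i (x : U) : is_derive (\val x) 'e_i ('valL_(0 : R) (flat m \o f : U -> R))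
    ((flat m.+2 (f x) - m%:R * flat m.+1 (f x)) * partial i f x).
  apply: (partial_comp oU (dh := fun y => flat m.+2 y - m%:R * flat m.+1 y)).
    exact: is_derive_flat.
  by case: cf => _ [].
split; first by apply: (Ck_comp0 oU) => x; [exact: flat_continuous|exact: Ck_cont cf].
split=> i; first by move=> x; case: (d i x).
have -> : partial i (flat m \o f) =
    ((flat m.+2 \o f : U -> R) - (fun=> m%:R) * (flat m.+1 \o f)) * partial i f.
  by apply/funext => x; rewrite /partial; case: (d i x) => _ ->.
have [_ [_ pf]] := cf; have c2 := IH m.+2 f (CkW cf); have c1 := IH m.+1 f (CkW cf).
exact: (CkM (CkB c2 (CkM (smooth_cst oU m%:R k) c1)) (pf i)).
Qed.

Lemma smooth_flat (f : smooth_fun oU) : (flat 0 \o f : U -> R) \in smooth_pred oU.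
Proof. by apply/asboolP => k; apply: Ck_flat; exact: smooth_funP. Qed.

Definition bump_fun (f : smooth_fun oU) : smooth_fun oU := SmoothFun (smooth_flat f).

Lemma zext_bump_fun f x : U x -> zext (bump_fun f) x = flat 0 (zext f x).
Proof. exact: zext_comp. Qed.

Lemma bump_fun_partial f i : exists g, smooth_partial i (bump_fun f) = g * smooth_partial i f.
Proof.
have s2 : (flat 2 \o f : U -> R) \in smooth_pred oU.
  by apply/asboolP => k; apply: Ck_flat; exact: smooth_funP.
exists (SmoothFun s2); apply: val_inj; apply/funext => x /=.
have d : is_derive (\val x) 'e_i ('valL_(0 : R) (flat 0 \o f : U -> R)) (flat 2 (f x) * partial i f x).
  apply: (partial_comp oU (dh := flat 2)); last by have [_ []] := smooth_funP f 1.
  by have := is_derive_flat 0 (f x); rewrite mul0r subr0.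
by case: d.
Qed.

End Flat.

Section Patch.
Variables (R : realType) (n : nat) (U : set 'rV[R]_n) (oU : open U).
Local Notation V := 'rV[R]_n.
Implicit Types (F G : V -> R) (x y : V) (f g : smooth_fun oU).

(** Both factors restrict to elements of the ring [smooth_fun] of one open neighbourhood of x, where
    products are already known to be smooth. *)
Lemma smooth_atM F G x : (\forall y \near x, smooth_at F y) -> (\forall y \near x, smooth_at G y) ->
  smooth_at (fun y => F y * G y) x.
Proof.
move=> sF sG.
have /nbhs_interior/nbhs_singleton Wx : nbhs x [set y | smooth_at F y /\ smooth_at G y].
  by apply: filterS2 sF sG => y.
set W := (_)° in Wx; have oW : open W := @open_interior _ _.
have sW y : W y -> smooth_at F y /\ smooth_at G y by move=> /interior_subset.
pose f := restr oW (fun y Wy => (sW y Wy).1); pose g := restr oW (fun y Wy => (sW y Wy).2).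
apply: smooth_at_near (zext_smooth (f * g) Wx).
by have := open_near oW Wx; apply: filterS => y Wy; rewrite zextM !zext_restr.
Qed.

Lemma smooth_at0 x : U x -> smooth_at (fun=> 0 : R) x.
Proof.
move=> Ux; apply: smooth_at_near (zext_smooth (0 : smooth_fun oU) Ux).
by near=> y; rewrite zext0.
Unshelve. all: by end_near. Qed.

Lemma locally_finite_sum (g : nat -> smooth_fun oU) :
  (forall x, U x -> exists M, \forall y \near x, forall k, (M <= k)%N -> zext (g k) y = 0) ->
  exists F : smooth_fun oU, forall x M, U x -> (forall k, (M <= k)%N -> zext (g k) x = 0) ->
    zext F x = \sum_(k < M) zext (g k) x.
Proof.
move=> lf.
have [M hM] : {M : V -> nat & forall x, U x -> forall k, (M x <= k)%N -> zext (g k) x = 0}.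
  apply: (@choice _ _ (fun x M => U x -> forall k, (M <= k)%N -> zext (g k) x = 0)) => x.
  have [Ux|nUx] := pselect (U x); last by exists 0%N.
  by have [M /nbhs_singleton hM] := lf x Ux; exists M.
(* The number of terms is chosen pointwise; by [FE] any sufficient number gives the same value, so
   near each point F is a single finite sum. *)
pose F x := \sum_(k < M x) zext (g k) x.
have FE x m : U x -> (forall k, (m <= k)%N -> zext (g k) x = 0) -> F x = \sum_(k < m) zext (g k) x.
  have cut p q : (p <= q)%N -> (forall k, (p <= k)%N -> zext (g k) x = 0) ->
      \sum_(k < p) zext (g k) x = \sum_(k < q) zext (g k) x.
    move=> pq h; rewrite (big_ord_widen _ (fun k => zext (g k) x) pq) [RHS](bigID (fun k : 'I_q => k < p)%N) /=.
    by rewrite [X in _ = _ + X]big1 ?addr0 // => k; rewrite -leqNgt; exact: h.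
  move=> Ux hm; rewrite /F; have [le|/ltnW le] := leqP (M x) m; first exact: cut (hM x Ux).
  by rewrite (cut _ _ le hm).
have sF x : U x -> smooth_at F x.
  move=> Ux; have [m hm] := lf x Ux.
  apply: smooth_at_near (zext_smooth (\sum_(k < m) g k) Ux).
  have := open_near oU Ux; apply: filterS2 hm => y hy Uy.
  by rewrite zext_sum; exact/esym/FE.
by exists (restr oU sF) => x m Ux hm; rewrite zext_restr //; exact: FE.
Qed.

Lemma smooth_partial0 i : smooth_partial i (0 : smooth_fun oU) = 0.
Proof. by apply: (addIr (smooth_partial i 0)); rewrite -smooth_partialD !add0r. Qed.

Lemma smooth_partialN i f : smooth_partial i (- f) = - smooth_partial i f.
Proof. by apply: (addIr (smooth_partial i f)); rewrite -smooth_partialD !addNr smooth_partial0. Qed.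

Lemma smooth_partial1 i : smooth_partial i (1 : smooth_fun oU) = 0.
Proof.
have := @smooth_partialM _ _ _ oU i 1 1; rewrite !mulr1 mul1r => /eqP.
by rewrite -subr_eq subrr eq_sym => /eqP.
Qed.

Lemma smooth_partial_sum i (T : Type) (r : seq T) (Q : pred T) (f : T -> smooth_fun oU) :
  smooth_partial i (\sum_(t <- r | Q t) f t) = \sum_(t <- r | Q t) smooth_partial i (f t).
Proof. by elim/big_rec2: _ => [|t a b _ <-]; rewrite ?smooth_partial0 ?smooth_partialD. Qed.

Lemma smooth_partial_prod0 i (T : Type) (r : seq T) (Q : pred T) (f : T -> smooth_fun oU) :
  (forall t, smooth_partial i (f t) = 0) -> smooth_partial i (\prod_(t <- r | Q t) f t) = 0.
Proof.
move=> h; elim/big_rec: _ => [|t a _ ha]; first exact: smooth_partial1.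
by rewrite smooth_partialM h ha mul0r mulr0 addr0.
Qed.

Lemma zext_prod (T : Type) (r : seq T) (Q : pred T) (f : T -> smooth_fun oU) x : U x ->
  zext (\prod_(t <- r | Q t) f t) x = \prod_(t <- r | Q t) zext (f t) x.
Proof. by move=> Ux; elim/big_rec2: _ => [|t a b _ <-]; rewrite ?zext1 ?zextM. Qed.

Lemma zext_smooth_partial_near i f F x : U x -> (\forall y \near x, zext f y = F y) ->
  zext (smooth_partial i f) x = 'D_('e_i) F x.
Proof. by move=> Ux e; rewrite zext_smooth_partial //; exact: near_eq_derive. Qed.

Variable P : nat -> smooth_fun oU.
Hypothesis cover : forall x, U x -> exists k, 2 < zext (P k) x.

Let two : smooth_fun oU := smooth_const oU 2.

(* Near a point where [P j > 2] all the weights of index k > j vanish, so the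
   family is locally finite; at x the weight of the first k with [P k x > 0] is
   positive. *)
Definition weight k : smooth_fun oU := bump_fun (P k) * \prod_(j < k) bump_fun (two - P j).

Lemma zext_weight k x : U x ->
  zext (weight k) x = flat 0 (zext (P k) x) * \prod_(j < k) flat 0 (2 - zext (P j) x).
Proof.
move=> Ux; rewrite zextM zext_bump_fun // zext_prod //; congr (_ * _).
by apply: eq_bigr => j _; rewrite zext_bump_fun // zextB zext_const.
Qed.

Lemma weight_ge0 k x : U x -> 0 <= zext (weight k) x.
Proof.
by move=> Ux; rewrite zext_weight // mulr_ge0 ?flat_ge0 // prodr_ge0 // => j _; exact: flat_ge0.
Qed.

Lemma weight_eq0 k x : U x -> zext (P k) x <= 0 -> zext (weight k) x = 0.
Proof. by move=> Ux h; rewrite zext_weight // flat_le0 // mul0r. Qed.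

Lemma weight_eq0_after j k x : U x -> 2 <= zext (P j) x -> (j < k)%N -> zext (weight k) x = 0.
Proof.
move=> Ux h jk; rewrite zext_weight // (bigD1 (Ordinal jk)) //=.
by rewrite (@flat_le0 _ 0 (2 - zext (P j) x)) ?subr_le0 // mul0r mulr0.
Qed.

Lemma weight_finite x : U x ->
  exists M, \forall y \near x, forall k, (M <= k)%N -> zext (weight k) y = 0.
Proof.
move=> Ux; have [j hj] := cover Ux; exists j.+1.
have c : {for x, continuous (zext (P j))} by apply/smooth_at_cont/zext_smooth.
have nj : \forall y \near x, 2 < zext (P j) y.
  exact: (@cvgr_gt _ _ (nbhs x) _ (zext (P j)) _ c _ hj).
apply: filterS2 (open_near oU Ux) nj => y Uy /ltW hy k jk; exact: weight_eq0_after hy jk.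
Qed.

Lemma weight_gt0 x : U x -> exists k, 0 < zext (weight k) x.
Proof.
move=> Ux; have [j hj] := cover Ux.
have ex : exists k, 0 < zext (P k) x by exists j; exact: lt_trans hj.
case: (ex_minnP ex) => k hk mink; exists k.
rewrite zext_weight // mulr_gt0 ?flat_gt0 // prodr_gt0 // => i _; apply: flat_gt0.
have : zext (P i) x <= 0 by rewrite leNgt; apply/negP => /mink; rewrite leqNgt ltn_ord.
lra.
Qed.

(** The weights divided by their sum. The last clause passes independence of a coordinate from the
    [P k] to the partition; for the coordinate t it yields a partition of unity in u. *)
Lemma partition_of_unity : exists mu : nat -> smooth_fun oU,
  [/\ forall x, U x -> exists M, \forall y \near x, forall k, (M <= k)%N -> zext (mu k) y = 0,
      forall x M, U x -> (forall k, (M <= k)%N -> zext (mu k) x = 0) ->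
        \sum_(k < M) zext (mu k) x = 1,
      forall k x, U x -> zext (P k) x <= 0 -> zext (mu k) x = 0 &
      forall i, (forall k, smooth_partial i (P k) = 0) -> forall k, smooth_partial i (mu k) = 0].
Proof.
have [S hS] := locally_finite_sum weight_finite.
have S0 x : U x -> zext S x != 0.
  move=> Ux; have [M /nbhs_singleton hM] := weight_finite Ux; rewrite (hS x M Ux hM).
  have [k hk] := weight_gt0 Ux.
  have kM : (k < M)%N by rewrite ltnNge; apply/negP => /hM e; move: hk; rewrite e ltxx.
  rewrite (bigD1 (Ordinal kM)) //=; apply: lt0r_neq0; rewrite ltr_wpDr //.
  by apply: sumr_ge0 => i _; exact: weight_ge0.
have [g gS] := smooth_inv S0.
have gS1 x : U x -> zext g x * zext S x = 1 by move=> Ux; rewrite -zextM gS zext1.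
exists (fun k => g * weight k); split.
- move=> x Ux; have [M hM] := weight_finite Ux; exists M; apply: filterS hM => y hy k /hy.
  by rewrite zextM => ->; rewrite mulr0.
- move=> x M Ux hM; rewrite -(gS1 x Ux) (hS x M Ux); last first.
    move=> k /hM; rewrite zextM => /eqP; rewrite mulf_eq0 => /orP[/eqP g0|/eqP //].
    by have := gS1 x Ux; rewrite g0 mul0r => /eqP; rewrite eq_sym oner_eq0.
  by rewrite mulr_sumr; apply: eq_bigr => k _; rewrite zextM.
- by move=> k x Ux h; rewrite zextM weight_eq0 // mulr0.
move=> i hP.
have hw k : smooth_partial i (weight k) = 0.
  have hb f : smooth_partial i f = 0 -> smooth_partial i (bump_fun f) = 0.
    by move=> f0; have [h ->] := bump_fun_partial f i; rewrite f0 mulr0.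
  rewrite smooth_partialM hb // mul0r add0r smooth_partial_prod0 ?mulr0 // => j; apply: hb.
  by rewrite smooth_partialD smooth_partialN hP smooth_partial_const subr0.
have dS : smooth_partial i S = 0.
  apply: smooth_fun_eq => x Ux; have [M hM] := weight_finite Ux; rewrite zext0.
  transitivity (zext (smooth_partial i (\sum_(k < M) weight k)) x); last first.
    by rewrite smooth_partial_sum big1 ?zext0.
  rewrite !zext_smooth_partial //; apply: near_eq_derive.
  by have := open_near oU Ux; apply: filterS2 hM => y hy Uy; rewrite zext_sum; exact: hS.
have dg : smooth_partial i g = 0.
  have : smooth_partial i (g * S) * g = 0 by rewrite gS smooth_partial1 mul0r.
  by rewrite smooth_partialM dS mulr0 addr0 -mulrA (mulrC S) gS mulr1.
by move=> k; rewrite smooth_partialM hw dg mul0r mulr0 addr0.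
Qed.

(** The data [c k] are smooth where P k > -1, while [mu k] vanishes unless P k > 0. Owing to this
    margin their product is smooth on U: the open sets P k > -1 and P k < 0 cover U, and the product
    is 0 on the second. *)
Lemma patch_smooth (I : Type) (c : nat -> I -> V -> R) :
  (forall k i x, U x -> -1 < zext (P k) x -> smooth_at (c k i) x) ->
  exists mu : nat -> smooth_fun oU, exists C : I -> smooth_fun oU,
  [/\ forall x, U x -> exists M, \forall y \near x,
        (forall i, zext (C i) y = \sum_(k < M) zext (mu k) y * c k i y) /\
        \sum_(k < M) zext (mu k) y = 1,
      forall k x, U x -> zext (P k) x <= 0 -> zext (mu k) x = 0 &
      forall i, (forall k, smooth_partial i (P k) = 0) -> forall k, smooth_partial i (mu k) = 0].
Proof.
move=> sc; have [mu [mu_fin mu_sum mu0 dmu]] := partition_of_unity.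
have sg k i x : U x -> smooth_at (fun y => zext (mu k) y * c k i y) x.
  move=> Ux; have cP : {for x, continuous (zext (P k))} by apply/smooth_at_cont/zext_smooth.
  have Unear := open_near oU Ux.
  have [h|h] := ltP (-1) (zext (P k) x).
    apply: smooth_atM; first by apply: filterS Unear => y; exact: zext_smooth.
    have : \forall y \near x, -1 < zext (P k) y.
      exact: (@cvgr_gt _ _ (nbhs x) _ (zext (P k)) _ cP _ h).
    by apply: filterS2 Unear => y Uy hy; exact: sc.
  apply: smooth_at_near (smooth_at0 Ux).
  have h0 : zext (P k) x < 0 by lra.
  have : \forall y \near x, zext (P k) y < 0.
    exact: (@cvgr_lt _ _ (nbhs x) _ (zext (P k)) _ cP _ h0).
  by apply: filterS2 Unear => y Uy /ltW hy; rewrite mu0 // mul0r.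
pose g i k := restr oU (fun x => @sg k i x).
have gE i k x : U x -> zext (g i k) x = zext (mu k) x * c k i x by exact: zext_restr.
have lf i x : U x -> exists M, \forall y \near x, forall k, (M <= k)%N -> zext (g i k) y = 0.
  move=> Ux; have [M hM] := mu_fin x Ux; exists M.
  have := open_near oU Ux; apply: filterS2 hM => y hy Uy k /hy e.
  by rewrite gE // e mul0r.
have [C hC] := choice (fun i => locally_finite_sum (lf i)).
exists mu, C; split=> // x Ux; have [M hM] := mu_fin x Ux; exists M.
have := open_near oU Ux; apply: filterS2 hM => y hy Uy; split; last exact: mu_sum.
move=> i; rewrite (hC i y M) // => [|k /hy e]; last by rewrite gE // e mul0r.
by apply: eq_bigr => k _; rewrite gE.
Qed.

End Patch.

(** * Countable covers by rational paraboloids *)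

Section RationalCover.
Variables (R : realType) (n : nat) (U : set 'rV[R]_n) (oU : open U) (A : pred 'I_n).
Local Notation V := 'rV[R]_n.

(** The peak value 3 leaves room for the thresholds of the patching: in the coordinates of [A], P >
    2 within squared distance 1 / (N + 1) of the centre, and P > -1 only within 4 / (N + 1).
    Rational centres make the family countable. *)
Definition paraboloid (N : nat) (q : 'rV[rat]_n) : smooth_fun oU :=
  smooth_const oU 3 - N.+1%:R *
    \sum_(i | A i) (smooth_coordinate oU i - smooth_const oU (ratr (q 0 i))) ^+ 2.

Lemma zext_paraboloid N q x : U x -> zext (paraboloid N q) x =
  3 - N.+1%:R * \sum_(i | A i) (x 0 i - ratr (q 0 i)) ^+ 2.
Proof.
move=> Ux; rewrite zextB zext_const // zextM zext_nat // zext_sum; congr (_ - _ * _).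
by apply: eq_bigr => i _; rewrite !expr2 zextM zextB zext_coordinate // zext_const.
Qed.

Lemma smooth_partial_paraboloid i N q : ~~ A i -> smooth_partial i (paraboloid N q) = 0.
Proof.
move=> nAi; rewrite smooth_partialD smooth_partialN smooth_partial_const sub0r.
have d k : smooth_partial i (k%:R : smooth_fun oU) = 0.
  by elim: k => [|k IH]; rewrite ?smooth_partial0 // mulrS smooth_partialD IH smooth_partial1 addr0.
rewrite smooth_partialM d mul0r add0r smooth_partial_sum big1 ?mulr0 ?oppr0 // => j Aj.
have ij : (i == j) = false by apply: contraNF nAi => /eqP ->.
rewrite expr2 smooth_partialM smooth_partialD smooth_partialN smooth_partial_coord ij.
by rewrite smooth_partial_const subr0 mul0r mulr0 addr0.
Qed.

(** Turns solvability near each point into a sequence of pieces. Paraboloids that are not good are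
    replaced by the constant -2, for which the region P > -1 is empty. With [A] the u-coordinates
    the pieces are cylinders in the direction t, with all coordinates they are small balls. *)
Lemma rational_cover (Good : smooth_fun oU -> Prop) :
  Good (smooth_const oU (-2)) ->
  (forall x, U x -> exists2 r : R, 0 < r & forall P,
    (forall y z, U y -> U z -> (forall i, A i -> y 0 i = z 0 i) -> zext P y = zext P z) ->
    (forall y, U y -> -1 < zext P y -> forall i, A i -> `|y 0 i - x 0 i| < r) -> Good P) ->
  exists P : nat -> smooth_fun oU,
  [/\ forall x, U x -> exists k, 2 < zext (P k) x,
      forall k, Good (P k) &
      forall k i, ~~ A i -> smooth_partial i (P k) = 0].
Proof.
move=> G0 hG.
pose P k := if @unpickle (nat * 'rV[rat]_n)%type k is Some p then
    if pselect (Good (paraboloid p.1 p.2)) then paraboloid p.1 p.2 else smooth_const oU (-2)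
  else smooth_const oU (-2).
exists P; split.
- move=> x Ux; have [r r0 hr] := hG x Ux.
  (* This N puts the region P > -1 within r / 2 of the rational centre. *)
  have [N hN] : exists N : nat, 4 / N.+1%:R < (r / 2) ^+ 2.
    have r2 : 0 < (r / 2) ^+ 2 by rewrite exprn_gt0 // divr_gt0.
    exists (Num.bound (4 / (r / 2) ^+ 2)).
    rewrite ltr_pdivrMr // mulrC -ltr_pdivrMr //.
    apply: lt_le_trans (archi_boundP _) _; first by rewrite divr_ge0 // ltW.
    by rewrite ler_nat.
  (* The centre is chosen within r / 2 of x; moreover d ^ 2 <= 1 / ((N + 1)(n + 1)) keeps a sum of
     at most n squares below 1 / (N + 1), whence P x > 2. *)
  pose d := Num.min (r / 2) (N.+1%:R^-1 * n.+1%:R^-1).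
  have d0 : 0 < d by rewrite lt_min divr_gt0 // mulr_gt0 // invr_gt0.
  have /choice[q hq] : forall i, exists q : rat, ratr q \in `]x 0 i - d, x 0 i + d[%R.
    by move=> i; apply: rat_in_itvoo; lra.
  have hqd i : `|x 0 i - ratr (q i)| < d.
    by have := hq i; rewrite in_itv /= ltr_norml => /andP[h1 h2]; apply/andP; split; lra.
  exists (pickle (N, \row_i q i)); rewrite /P pickleK /=.
  have qE i : (\row_i q i) 0 i = q i by rewrite mxE.
  have Gq : Good (paraboloid N (\row_i q i)).
    apply: hr => [y z Uy Uz yz|y Uy].
      by rewrite !zext_paraboloid //; congr (_ - _ * _); apply: eq_bigr => i /yz ->.
    rewrite zext_paraboloid // => hy i Ai.
    have h4 : \sum_(i | A i) (y 0 i - ratr ((\row_i q i) 0 i)) ^+ 2 < 4 / N.+1%:R.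
      by rewrite ltr_pdivlMr // mulrC; lra.
    have hi : (y 0 i - ratr (q i)) ^+ 2 < (r / 2) ^+ 2.
      apply: le_lt_trans hN; apply: le_trans (ltW h4); rewrite (bigD1 i) //= qE lerDl.
      by apply: sumr_ge0 => j _; exact: sqr_ge0.
    have hyi : `|y 0 i - ratr (q i)| < r / 2.
      rewrite -(@ltr_pXn2r _ 2) ?nnegrE ?normr_ge0 ?divr_ge0 ?ltW //.
      by rewrite -normrX ger0_norm ?sqr_ge0.
    have := hqd i; have dr : d <= r / 2 by rewrite ge_min lexx.
    rewrite distrC => hx; have -> : y 0 i - x 0 i = (y 0 i - ratr (q i)) + (ratr (q i) - x 0 i) by ring.
    by apply: le_lt_trans (ler_normD _ _) _; lra.
  case: pselect => [gq|/(_ Gq) //] /=.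
  rewrite zext_paraboloid //.
  suff : N.+1%:R * \sum_(i | A i) (x 0 i - ratr ((\row_i q i) 0 i)) ^+ 2 < 1 by lra.
  rewrite mulrC -ltr_pdivlMr // div1r.
  have dle : d ^+ 2 <= N.+1%:R^-1 * n.+1%:R^-1.
    have d1 : d <= 1.
      rewrite ge_min; apply/orP; right; rewrite -invfM -natrM invf_le1 ?ltr0n ?muln_gt0 //.
      by rewrite ler1n muln_gt0.
    apply: (@le_trans _ _ d); first by rewrite expr2 ger_pMl.
    by rewrite ge_min lexx orbT.
  apply: (@le_lt_trans _ _ (\sum_(i < n) N.+1%:R^-1 * n.+1%:R^-1)).
    rewrite big_mkcond; apply: ler_sum => i _; case: ifP => _.
      apply: le_trans dle; rewrite qE -[leLHS]ger0_norm ?sqr_ge0 // normrX.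
      by rewrite lerXn2r ?nnegrE ?normr_ge0 ?ltW.
    by rewrite mulr_ge0 // invr_ge0.
  rewrite sumr_const card_ord -[ltLHS]mulr_natr -mulrA gtr_pMr ?invr_gt0 //.
  by rewrite mulrC ltr_pdivrMr // mul1r ltr_nat.
- by move=> k; rewrite /P; case: unpickle => [p|//]; case: pselect.
move=> k i nAi; rewrite /P; case: unpickle => [p|]; last exact: smooth_partial_const.
by case: pselect => g /=; [exact: smooth_partial_paraboloid|exact: smooth_partial_const].
Qed.

Lemma open_box x : U x -> exists2 r : R, 0 < r & forall y : V, (forall i, `|y 0 i - x 0 i| < r) -> U y.
Proof.
move=> Ux; have /nbhs_ballP[r /= r0 hr] := open_nbhs_nbhs (conj oU Ux).
exists r => // y hy; apply: hr; split=> // i j; rewrite (ord1 i).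
by rewrite -ball_normE /ball_ /= distrC; exact: hy.
Qed.

Lemma open_superlevel (P : smooth_fun oU) (a : R) : open [set y | U y /\ a < zext P y].
Proof.
rewrite openE => x [Ux hx].
have c : {for x, continuous (zext P)} by apply/smooth_at_cont/zext_smooth.
have h : \forall y \near x, a < zext P y by exact: (@cvgr_gt _ _ (nbhs x) _ (zext P) _ c _ hx).
by apply: filterS2 (open_near oU Ux) h.
Qed.

End RationalCover.

Section ScaledPrimitive.
Variables (R : realType) (n : nat).
Local Notation V := 'rV[R]_n.

(** The product is the integral of g from c_i to x_i; its derivative is the left side of
    [sint_euler] for w = 0. *)
Lemma smooth_partial_sint (W : set V) (oW : open W) (c : V) i
    (star : forall x s, W x -> 0 <= s <= 1 -> W (scaling (pred1 i) c s x)) (g : smooth_fun oW) :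
  smooth_partial i (centered c oW i * sint star 0 g) = g.
Proof.
rewrite smooth_partialM smooth_partialD smooth_partialN smooth_partial_const subr0.
rewrite smooth_partial_coord eqxx mul1r sint_partial add0n /= eqxx.
by rewrite -[RHS](sint_euler star 0) mulr1n mul1r (big_pred1 i).
Qed.

End ScaledPrimitive.

(** * Primitives in time *)

Section TimePrimitive.
Variables (R : realType) (m : nat) (U : set 'rV[R]_m.+1) (oU : open U).
Local Notation V := 'rV[R]_m.+1.
Hypothesis fibers : forall v : 'rV[R]_m,
  (@proj_u R m @` U) v -> connected (U `&` [set x | proj_u x = v]).

Lemma row_split_eq (x y : V) : x 0 ord0 = y 0 ord0 -> proj_u x = proj_u y -> x = y.
Proof.
move=> e0 eu; apply/rowP => i; have [<-//|i0] := eqVneq ord0 i.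
have [j -> _] := unlift_some i0.
by have /rowP/(_ j) := eu; rewrite !mxE.
Qed.

(** The coordinate t maps the fibre injectively to a connected subset of R, that is, to an
    interval. *)
Lemma fiber_convex (x y z : V) (s : R) : U x -> U y -> proj_u x = proj_u y -> proj_u z = proj_u x ->
  0 <= s <= 1 -> z 0 ord0 = x 0 ord0 + s * (y 0 ord0 - x 0 ord0) -> U z.
Proof.
move=> Ux Uy xy zx /andP[s0 s1] z0.
set Z := U `&` [set w | proj_u w = proj_u x].
have cZ : connected Z by apply: fibers; exists x.
pose f (w : V) : R := w 0 ord0.
have cf : {within Z, continuous f} by apply: continuous_subspaceT; exact: coord_continuous.
have /connected_intervalP iZ := connected_continuous_connected cZ cf.
have fx : (f @` Z) (x 0 ord0) by exists x.
have fy : (f @` Z) (y 0 ord0) by exists y.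
have [w [Uw wx] wz] : (f @` Z) (z 0 ord0).
  have [xy0|yx0] := leP (x 0 ord0) (y 0 ord0).
    have d0 : 0 <= y 0 ord0 - x 0 ord0 by rewrite subr_ge0.
    by apply: (iZ _ _ fx fy); rewrite z0; have := ler_wpM2r d0 s1; have := mulr_ge0 s0 d0; lra.
  have d0 : 0 <= x 0 ord0 - y 0 ord0 by rewrite subr_ge0 ltW.
  by apply: (iZ _ _ fy fx); rewrite z0; have := ler_wpM2r d0 s1; have := mulr_ge0 s0 d0; lra.
by rewrite (@row_split_eq z w) // ?wx.
Qed.

Local Notation time := (pred1 (ord0 : 'I_m.+1)).

Lemma time_primitive (f : smooth_fun oU) : exists F, smooth_partial ord0 F = f.
Proof.
pose Good (P : smooth_fun oU) := exists c : V -> R, forall x, U x -> -1 < zext P x ->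
  smooth_at c x /\ 'D_('e_ord0) c x = zext f x.
have [||P [cover good dP]] := @rational_cover R _ U oU (predC time) Good.
- by exists (fun=> 0) => x Ux; rewrite zext_const //; lra.
- move=> x0 Ux0; have [r r0 hr] := open_box oU Ux0; exists r => // P indep near_x0.
  pose W := [set y | U y /\ -1 < zext P y].
  have oW : open W by exact: open_superlevel.
  have star x s : W x -> 0 <= s <= 1 -> W (scaling time x0 s x).
    move=> [Ux Px] hs.
    have Us : U (scaling time x0 s x).
      (* The point over the same u at the time of x0. It is in U because its u-coordinates are close
         to those of x0, and then the fibre contains the segment from x1 to x. *)
      pose x1 : V := scaling time x0 0 x.
      have Ux1 : U x1.
        apply: hr => i; rewrite mxE /=; case: eqP => [->|/eqP ni]; last exact: near_x0.
        by rewrite mul0r addr0 subrr normr0.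
      apply: (@fiber_convex x1 x _ s) => //.
      + by apply/rowP => j; rewrite !mxE.
      + by apply/rowP => j; rewrite !mxE.
      + by rewrite !mxE /=; ring.
    split=> //; rewrite (indep _ x) // => i /= /negPf ni; by rewrite mxE /= ni.
  have sf x : W x -> smooth_at (zext f) x by move=> [Ux _]; exact: zext_smooth.
  pose g := restr oW sf; pose G := centered x0 oW ord0 * sint star 0 g.
  have dG : smooth_partial ord0 G = g by exact: smooth_partial_sint.
  exists (zext G) => x Ux Px; have Wx : W x by [].
  split; first exact: zext_smooth.
  by rewrite -zext_smooth_partial // dG zext_restr.
have [c hc] := choice good.
have [|mu [C [hC mu0 dmu]]] := @patch_smooth R _ U oU P cover unit (fun k _ => c k).
  by move=> k _ x Ux /(hc k x Ux)[].
exists (C tt); apply: smooth_fun_eq => x Ux; have [M hM] := hC x Ux.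
rewrite (@zext_smooth_partial_near _ _ _ _ _ _ (fun y => \sum_(k < M) zext (mu k) y * c k y)) //; last first.
  by apply: filterS hM => y [/(_ tt)].
have [_ sum1] := nbhs_singleton hM.
(* The partition does not depend on t, so T (mu k c k) = mu k f. Where P k <= -1 the function [c k]
   is arbitrary, but [mu k] vanishes nearby. *)
have d (k : 'I_M) : is_derive x 'e_ord0 (fun y => zext (mu k) y * c k y) (zext (mu k) x * zext f x).
  have dm : is_derive x 'e_ord0 (zext (mu k)) 0.
    apply: DeriveDef; first by apply: smooth_at_derivable; exact: zext_smooth.
    by rewrite -zext_smooth_partial // dmu ?zext0 // => j; apply: dP.
  have [h|h] := ltP (-1) (zext (P k) x).
    have [sc dc] := hc k x Ux h.
    have dc' : is_derive x 'e_ord0 (c k) (zext f x).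
      by apply: DeriveDef; [exact: smooth_at_derivable|].
    by apply: is_derive_eq (is_deriveM dm dc') _; rewrite scaler0 addr0.
  rewrite mu0 // ?mul0r; last by lra.
  have cP : {for x, continuous (zext (P k))} by apply/smooth_at_cont/zext_smooth.
  have h0 : zext (P k) x < 0 by lra.
  have nP : \forall y \near x, zext (P k) y < 0.
    exact: (@cvgr_lt _ _ (nbhs x) _ (zext (P k)) _ cP _ h0).
  have e : \forall y \near x, cst 0 y = zext (mu k) y * c k y.
    by apply: filterS2 (open_near oU Ux) nP => y Uy /ltW hy; rewrite mu0 // mul0r.
  exact: (near_eq_is_derive e (is_derive_cst _ _ _)).
have -> : (fun y => \sum_(k < M) zext (mu k) y * c k y) = \sum_(k < M) (fun y => zext (mu k) y * c k y).
  by apply/funext => y; rewrite fct_sumE.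
have [_ ->] := is_derive_sum d.
by rewrite -mulr_suml sum1 mul1r.
Qed.

End TimePrimitive.

(** * Mixed partial derivatives *)

Section Translation.
Variables (R : realType) (n : nat).
Local Notation V := 'rV[R]_n.
Implicit Types (F : V -> R) (a v x : V).

Lemma derive_shift F a v : 'D_v (fun z => F (z + a)) = (fun z => 'D_v F (z + a)).
Proof.
apply/funext => x; rewrite /derive; apply: (congr1 (fun q => lim (q @ 0^'))).
by apply/funext => h /=; rewrite addrA.
Qed.

Lemma derivable_shift F a v x : derivable (fun z => F (z + a)) x v = derivable F (x + a) v.
Proof.
rewrite /derivable; apply: (congr1 (fun q => cvg (q @ 0^'))).
by apply/funext => h /=; rewrite addrA.
Qed.

Lemma smooth_at_shift F a x : smooth_at F (x + a) -> smooth_at (fun z => F (z + a)) x.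
Proof.
have ca (G : V -> R) : {for x + a, continuous G} -> {for x, continuous (fun z : V => G (z + a))}.
  move=> cG; have cs : {for x, continuous (fun z : V => z + a)}.
    by apply: continuousD; [exact: cvg_id|exact: cst_continuous].
  exact: (cvg_comp _ _ cs cG).
move=> sF k; elim: k F {sF}(sF k) => [|k IH] F [cF dF]; split=> //; [exact: ca|exact: ca|].
move=> i; have [d s] := dF i; split; first by rewrite derivable_shift.
by rewrite derive_shift; exact: (IH _ s).
Qed.

End Translation.

(** * Restriction and evaluation as ring morphisms *)

Section Restriction.
Variables (R : realType) (n : nat) (U W : set 'rV[R]_n) (oU : open U) (oW : open W).
Hypothesis WU : W `<=` U.
Implicit Types (f g : smooth_fun oU) (x : 'rV[R]_n) (i : 'I_n).

Definition res f : smooth_fun oW := restr oW (fun x Wx => zext_smooth f (WU Wx)).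

Lemma zext_res f x : W x -> zext (res f) x = zext f x.
Proof. exact: zext_restr. Qed.

Lemma res_zmod : zmod_morphism res.
Proof. by move=> f g; apply: smooth_fun_eq => x Wx; rewrite zextB !zext_res // zextB. Qed.

Lemma res_monoid : monoid_morphism res.
Proof.
split=> [|f g]; apply: smooth_fun_eq => x Wx; last by rewrite zextM !zext_res // zextM.
by rewrite zext_res // !zext1 //; exact: WU.
Qed.

HB.instance Definition _ := GRing.isZmodMorphism.Build (smooth_fun oU) (smooth_fun oW) res res_zmod.
HB.instance Definition _ := GRing.isMonoidMorphism.Build (smooth_fun oU) (smooth_fun oW) res res_monoid.

Lemma res_partial i f : res (smooth_partial i f) = smooth_partial i (res f).
Proof.
apply: smooth_fun_eq => x Wx; rewrite zext_res // !zext_smooth_partial //; last exact: WU.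
by apply: near_eq_derive; have := open_near oW Wx; apply: filterS => y /(zext_res f) ->.
Qed.

Lemma res_coordinate i : res (smooth_coordinate oU i) = smooth_coordinate oW i.
Proof. by apply: smooth_fun_eq => x Wx; rewrite zext_res // !zext_coordinate //; exact: WU. Qed.

End Restriction.

Section Evaluation.
Variables (R : realType) (n : nat) (U : set 'rV[R]_n) (oU : open U) (x : 'rV[R]_n) (Ux : U x).

(** The proof that x lies in U is an argument because the morphism instances depend on it. *)
Definition eval_at (_ : U x) (f : smooth_fun oU) : R := zext f x.

Lemma eval_at_zmod : zmod_morphism (eval_at Ux).
Proof. by move=> f g; rewrite /eval_at zextB. Qed.

Lemma eval_at_monoid : monoid_morphism (eval_at Ux).
Proof. by split=> [|f g]; rewrite /eval_at ?zext1 ?zextM. Qed.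

HB.instance Definition _ := GRing.isZmodMorphism.Build (smooth_fun oU) R (eval_at Ux) eval_at_zmod.
HB.instance Definition _ := GRing.isMonoidMorphism.Build (smooth_fun oU) R (eval_at Ux) eval_at_monoid.
End Evaluation.

Section MixedPartials.
Variables (R : realType) (n : nat).
Local Notation V := 'rV[R]_n.

Lemma constant_along (U : set V) (oU : open U) (f : smooth_fun oU) i x (s : R) :
  smooth_partial i f = 0 -> (forall r : R, `|r| <= `|s| -> U (x + r *: 'e_i)) ->
  zext f (x + s *: 'e_i) = zext f x.
Proof.
move=> f0 Uxr; have [|r rs e] := @mvt_line _ _ (zext f) x 'e_i s.
  by move=> r /Uxr Ur; apply: smooth_at_derivable; exact: zext_smooth.
apply/eqP; rewrite -subr_eq0 e -zext_smooth_partial; last exact: Uxr.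
by rewrite f0 zext0 mulr0.
Qed.

(** f is locally invariant under translation along e_i, hence so is its derivative along e_j. The
    symmetry of mixed partials is reduced to this case. *)
Lemma smooth_partial_eq0 (U : set V) (oU : open U) (f : smooth_fun oU) i j :
  smooth_partial i f = 0 -> smooth_partial i (smooth_partial j f) = 0.
Proof.
move=> f0; apply: smooth_fun_eq => x Ux; rewrite zext0 zext_smooth_partial //.
have [r r0 hr] := open_box oU Ux.
have r2 : 0 < r / 2 by rewrite divr_gt0.
have inU (y : V) (s : R) : (forall k, `|y 0 k - x 0 k| < r / 2) -> `|s| < r / 2 -> U (y + s *: 'e_i).
  move=> hy hs; apply: hr => k; rewrite !mxE eqxx /=.
  have -> : y 0 k + s * (k == i)%:R - x 0 k = (y 0 k - x 0 k) + s * (k == i)%:R by ring.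
  apply: le_lt_trans (ler_normD _ _) _; rewrite [ltRHS]splitr ltr_leD // normrM.
  by case: (k == i); rewrite ?normr1 ?mulr1 ?normr0 ?mulr0 // ltW.
have near_x (y : V) : (forall k, `|y 0 k - x 0 k| < r / 2) ->
    nbhs y (fun z : V => forall k, `|z 0 k - x 0 k| < r / 2).
  move=> hy; apply: (@filter_forall V 'I_n (fun k (z : V) => `|z 0 k - x 0 k| < r / 2) (nbhs y) _) => k.
  have c : {for y, continuous (fun z : V => `|z 0 k - x 0 k|)}.
    apply: (@continuous_comp _ _ _ (fun z : V => z 0 k - x 0 k) (fun t : R => `|t|)).
      by apply: continuousB; [exact: coord_continuous|exact: cst_continuous].
    exact: norm_continuous.
  exact: (@cvgr_lt _ _ (nbhs y) _ (fun z : V => `|z 0 k - x 0 k|) _ c _ (hy k)).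
have xx k : `|x 0 k - x 0 k| < r / 2 by rewrite subrr normr0.
have cst_f (s : R) : `|s| < r / 2 -> 'D_('e_j) (zext f) (x + s *: 'e_i) = 'D_('e_j) (zext f) x.
  move=> hs; have := derive_shift (zext f) (s *: 'e_i) 'e_j => /(congr1 (fun F => F x)) <-.
  apply: near_eq_derive; have := near_x x xx; apply: filterS => y hy.
  by apply: constant_along => // q qs; apply: inU => //; exact: le_lt_trans qs hs.
have sx : smooth_at (zext (smooth_partial j f)) x by exact: zext_smooth.
have e : \forall s \near (0 : R), cst ('D_('e_j) (zext f) x) s = zext (smooth_partial j f) (x + s *: 'e_i).
  have := nbhsx_ballx (0 : R) _ r2; apply: filterS => s.
  rewrite -ball_normE /ball_ /= sub0r normrN => hs.
  by rewrite zext_smooth_partial ?cst_f //; exact: inU.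
have d : is_derive (0 : R) 1 (fun s : R => zext (smooth_partial j f) (x + s *: 'e_i)) 0.
  exact: (near_eq_is_derive e (is_derive_cst _ _ _)).
by have [] := proj2 (is_derive_at _ _ _ _) d.
Qed.

(* With c_i S g the primitive of g in direction i, the function
   f - c_i S (D_i f) is killed by D_i, hence so is its D_j. *)
Lemma smooth_partialC (U : set V) (oU : open U) (f : smooth_fun oU) i j :
  smooth_partial i (smooth_partial j f) = smooth_partial j (smooth_partial i f).
Proof.
have [->//|ij] := eqVneq i j.
apply: smooth_fun_eq => x Ux; have [r r0 hr] := open_box oU Ux.
have [d d0 hd] : exists2 d : R, 0 < d & ball x d `<=` U.
  by have /nbhs_ballP[d /= d0 hd] := open_near oU Ux; exists d.
pose W := ball x d; have oW : open W by exact: ball_open.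
have Wx : W x by exact: ballxx.
have star y s : W y -> 0 <= s <= 1 -> W (scaling (pred1 i) x s y).
  move=> [_ Wy] /andP[s0 s1]; split=> // a b; have := Wy a b.
  rewrite (ord1 a) -!ball_normE /ball_ /= !mxE; case: (pred1 i b) => // hb.
  apply: le_lt_trans hb; rewrite opprD addNKr normrN normrM ger0_norm // distrC.
  by rewrite ler_piMl.
pose G := res oW hd f.
pose h := G - centered x oW i * sint star 0 (smooth_partial i G).
have dh : smooth_partial i h = 0.
  by rewrite smooth_partialD smooth_partialN smooth_partial_sint subrr.
have := smooth_partial_eq0 j dh.
rewrite [smooth_partial j h]smooth_partialD smooth_partialN smooth_partialM.
have -> : smooth_partial j (centered x oW i) = 0.
  rewrite smooth_partialD smooth_partialN smooth_partial_const subr0 smooth_partial_coord.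
  by rewrite eq_sym (negPf ij).
rewrite mul0r add0r sint_partial /= eq_sym (negPf ij) addn0 smooth_partialD smooth_partialN.
rewrite smooth_partial_sint => /eqP; rewrite subr_eq0 -!res_partial => /eqP e.
by have := congr1 (fun g => zext g x) e; rewrite !(zext_res oW hd _ Wx).
Qed.

End MixedPartials.

(** * Functions constant on the fibers *)

Section Radial.
Variables (R : realType) (m : nat) (U : set 'rV[R]_m.+1) (oU : open U).
Local Notation V := 'rV[R]_m.+1.
Local Notation uI j := (lift ord0 j : 'I_m.+1).
Local Notation u j := (smooth_coordinate oU (uI j)).
Local Notation D j := (@smooth_partial R m.+1 U oU (uI j)).
Implicit Types (f g : smooth_fun oU).

Definition vanishes0 f := forall x, U x -> proj_u x = 0 -> zext f x = 0.

(* [S w] inverts [Euler + w + 1] on the class C. *)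
Record radial (C : smooth_fun oU -> Prop) (S : nat -> smooth_fun oU -> smooth_fun oU) : Prop := Radial {
  radial_D : forall w f g, C f -> C g -> S w (f + g) = S w f + S w g;
  radial_u : forall w j f, C f -> u j * S w.+1 f = S w (u j * f);
  radial_euler : forall w f, C f -> w.+1%:R * S w f + \sum_(j < m) u j * S w.+1 (D j f) = f;
  radial_div : forall f, C f -> vanishes0 f -> \sum_(j < m) u j * S 0 (D j f) = f;
  radial_partial : forall w j f, C f -> D j (S w f) = S w.+1 (D j f);
  radial_S : forall w f, C f -> C (S w f) }.

Definition space : pred 'I_m.+1 := predC1 ord0.

Lemma sum_space (F : 'I_m.+1 -> smooth_fun oU) :
  \sum_(i | space i) centered 0 oU i * F i = \sum_(j < m) u j * F (uI j).
Proof.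
rewrite big_mkcond big_ord_recl /= add0r; apply: eq_bigr => j _; congr (_ * _).
apply: smooth_fun_eq => x Ux; rewrite zextB zext_const // mxE subr0 //.
Qed.

Lemma proj_u_scaling (s : R) (x : V) : proj_u (scaling space 0 s x) = s *: proj_u x.
Proof. by apply/rowP => j; rewrite !mxE /= add0r subr0. Qed.

(** Applied to a ball around a point with u = 0 and to R x p(U). *)
Lemma radial_sint (star : forall x s, U x -> 0 <= s <= 1 -> U (scaling space 0 s x)) :
  radial (fun=> True) (@sint R m.+1 space 0 U oU star).
Proof.
split=> //.
- by move=> w f g _ _; exact: sintD.
- move=> w j f _; have := @sint_centered _ _ space 0 U oU star (uI j) w f.
  have -> : centered 0 oU (uI j) = u j.
    by apply: smooth_fun_eq => x Ux; rewrite zextB zext_const // mxE subr0.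
  by apply.
- by move=> w f _; rewrite -[RHS](sint_euler star w) sum_space.
- move=> f _ f0; apply: smooth_fun_eq => x Ux.
  have := sint_div star f Ux; rewrite sum_space => ->.
  rewrite (f0 (scaling space 0 0 x)) ?subr0 //; last by rewrite proj_u_scaling scale0r.
  by apply: star => //; rewrite lexx ler01.
- by move=> w j f _; rewrite sint_partial /= addn1.
Qed.

End Radial.

Section Saturation.
Variables (R : realType) (m : nat) (U : set 'rV[R]_m.+1) (oU : open U).
Local Notation V := 'rV[R]_m.+1.
Local Notation uI j := (lift ord0 j : 'I_m.+1).
Hypothesis fibers : forall v : 'rV[R]_m,
  (@proj_u R m @` U) v -> connected (U `&` [set x | proj_u x = v]).
Hypothesis star : star_shaped0 (@proj_u R m @` U).

(* R x p(U); unlike U it is stable under scaling of u. *)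
Definition saturation : set V := [set x | (@proj_u R m @` U) (proj_u x)].

Lemma proj_uD (x y : V) : proj_u (x + y) = proj_u x + proj_u y.
Proof. by apply/rowP => j; rewrite !mxE. Qed.

Lemma proj_uB (x y : V) : proj_u (x - y) = proj_u x - proj_u y.
Proof. by apply/rowP => j; rewrite !mxE. Qed.

Lemma proj_u_time (s : R) : proj_u (s *: 'e_ord0 : V) = 0.
Proof. by apply/rowP => j; rewrite !mxE mulr0. Qed.

Lemma sub_saturation : U `<=` saturation.
Proof. by move=> x Ux; exists x. Qed.

Lemma open_saturation : open saturation.
Proof.
rewrite openE => x [y Uy yx].
have [r r0 hr] := open_box oU Uy.
have := nbhsx_ballx x _ r0; apply: filterS => z [_ hz].
exists (z + (y - x)); last by rewrite proj_uD proj_uB yx subrr addr0.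
apply: hr => i; rewrite !mxE; have := hz ord0 i; rewrite -ball_normE /ball_ /= distrC.
by congr (`|_| < _); ring.
Qed.
Local Notation oS := open_saturation.

Lemma star_saturation (x : V) (s : R) : saturation x -> 0 <= s <= 1 ->
  saturation (scaling (@space m) 0 s x).
Proof.
by move=> Sx hs; rewrite /saturation /= proj_u_scaling; case: star => _; apply.
Qed.

Lemma line_of_proj (x y : V) : proj_u x = proj_u y -> y = x + (y 0 ord0 - x 0 ord0) *: 'e_ord0.
Proof.
move=> xy; apply: row_split_eq; first by rewrite !mxE /=; ring.
by rewrite proj_uD proj_u_time addr0.
Qed.

Lemma fiber_constant (f : smooth_fun oU) (x y : V) : smooth_partial ord0 f = 0 ->
  U x -> U y -> proj_u x = proj_u y -> zext f x = zext f y.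
Proof.
move=> f0 Ux Uy xy; set s := y 0 ord0 - x 0 ord0.
pose v : V := s *: 'e_ord0.
have yE : y = x + 1 *: v by rewrite scale1r; exact: line_of_proj.
have Ur (r : R) : 0 <= r <= 1 -> U (x + r *: v).
  move=> hr; apply: (fiber_convex fibers Ux Uy xy _ hr); last by rewrite !mxE /= /s; ring.
  by rewrite proj_uD scalerA proj_u_time addr0.
have d (r : R) : 0 <= r <= 1 -> is_derive r 1 (fun r : R => zext f (x + r *: v)) 0.
  move=> hr; apply: (proj1 (is_derive_line _ _ _ _ _)).
  have -> : 0 = s * 'D_('e_ord0) (zext f) (x + r *: v).
    by rewrite -zext_smooth_partial ?f0 ?zext0 ?mulr0 //; exact: Ur.
  apply: is_derive_scale; apply: derivableP; apply: smooth_at_derivable; apply: zext_smooth.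
  exact: Ur.
have := int01_derive (@cont01_cst R 0) d.
rewrite -yE scale0r addr0 => /esym/eqP.
have -> : int01 (fun=> 0 : R) = 0.
  rewrite (@eq_int01 _ _ (fun s => 0 * 1)) => [|r _]; last by rewrite mul0r.
  by rewrite int01Z ?mul0r //; exact: cont01_cst.
by rewrite subr_eq0 => /eqP ->.
Qed.

Lemma saturation_constant (f : smooth_fun oS) (x y : V) : smooth_partial ord0 f = 0 ->
  saturation x -> proj_u x = proj_u y -> zext f x = zext f y.
Proof.
move=> f0 Sx xy; rewrite (line_of_proj xy); apply/esym/constant_along => // r _.
by rewrite /saturation /= proj_uD proj_u_time addr0.
Qed.

(** f is constant on the connected fibres, so it is the pullback of a function on p(U), which also
    makes sense on R x p(U). *)
Lemma extend (f : smooth_fun oU) : smooth_partial ord0 f = 0 ->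
  exists2 g : smooth_fun oS, res oU sub_saturation g = f & smooth_partial ord0 g = 0.
Proof.
move=> f0.
have [sel hsel] : {sel : V -> V & forall x, saturation x -> U (sel x) /\ proj_u (sel x) = proj_u x}.
  apply: (@choice _ _ (fun x y => saturation x -> U y /\ proj_u y = proj_u x)) => x.
  have [[y Uy yx]|nSx] := pselect (saturation x); first by exists y.
  by exists x.
pose F x := zext f (sel x).
have FE x y : U y -> proj_u y = proj_u x -> F x = zext f y.
  move=> Uy yx; have [|Us sx] := hsel x; first by rewrite /saturation /= -yx; exists y.
  by apply: fiber_constant => //; rewrite sx.
(* Smoothness of F: the vector a points along t and moves x to the chosen point of its fibre in U,
   so near x F is the translate of f by a. *)
have near_F x : saturation x -> exists2 a : V, U (x + a) & \forall z \near x, zext f (z + a) = F z.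
  move=> Sx; have [Us sx] := hsel x Sx; exists (sel x - x); first by rewrite subrKC.
  have [r r0 hr] := open_box oU Us.
  have := nbhsx_ballx x _ r0; apply: filterS => z [_ hz]; apply/esym/FE.
    apply: hr => i; rewrite !mxE; have := hz ord0 i; rewrite -ball_normE /ball_ /= distrC.
    by congr (`|_| < _); ring.
  by rewrite proj_uD proj_uB sx subrr addr0.
have sF x : saturation x -> smooth_at F x.
  move=> /near_F[a Ua e]; apply: smooth_at_near e _; apply: smooth_at_shift.
  exact: zext_smooth.
exists (restr oS sF).
  apply: smooth_fun_eq => x Ux; rewrite zext_res // zext_restr; last exact: sub_saturation.
  exact: FE.
apply: smooth_fun_eq => x Sx; rewrite zext0 zext_smooth_partial //.
have [a Ua e] := near_F x Sx.
transitivity ('D_('e_ord0) (fun z => zext f (z + a)) x).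
  apply: near_eq_derive; have := open_near oS Sx; apply: filterS2 e => z ez Sz.
  by rewrite zext_restr.
transitivity ('D_('e_ord0) (zext f) (x + a)).
  exact: (congr1 (fun G => G x) (derive_shift (zext f) a 'e_ord0)).
by rewrite -zext_smooth_partial // f0 zext0.
Qed.

Lemma extend_unique (f g : smooth_fun oS) : smooth_partial ord0 f = 0 -> smooth_partial ord0 g = 0 ->
  res oU sub_saturation f = res oU sub_saturation g -> f = g.
Proof.
move=> f0 g0 e; apply: smooth_fun_eq => x Sx; have [y Uy yx] := Sx.
rewrite !(@saturation_constant _ x y) //.
by rewrite -!(zext_res oU sub_saturation) // e.
Qed.

(** Extend to R x p(U), integrate there, restrict to U. The extension is obtained by choice; its
    uniqueness [extE] makes it compatible with sums, products by u_j and derivatives. *)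
Lemma radial_kernel : exists S, radial (fun f : smooth_fun oU => smooth_partial ord0 f = 0) S.
Proof.
have [ext hext] : {ext : smooth_fun oU -> smooth_fun oS & forall f, smooth_partial ord0 f = 0 ->
    res oU sub_saturation (ext f) = f /\ smooth_partial ord0 (ext f) = 0}.
  apply: (@choice _ _ (fun f g => smooth_partial ord0 f = 0 ->
    res oU sub_saturation g = f /\ smooth_partial ord0 g = 0)) => f.
  have [f0|nf0] := pselect (smooth_partial ord0 f = 0); last by exists 0.
  by have [g g1 g2] := extend f0; exists g.
have ext_res f : smooth_partial ord0 f = 0 -> res oU sub_saturation (ext f) = f by move=> /hext[].
have ext_0 f : smooth_partial ord0 f = 0 -> smooth_partial ord0 (ext f) = 0 by move=> /hext[].
have extE f g : smooth_partial ord0 f = 0 -> smooth_partial ord0 g = 0 ->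
    res oU sub_saturation g = f -> ext f = g.
  by move=> f0 g0 e; apply: extend_unique => //; [exact: ext_0|rewrite ext_res].
have CD f g : smooth_partial ord0 f = 0 -> smooth_partial ord0 g = 0 ->
    smooth_partial ord0 (f + g) = 0 :> smooth_fun oU.
  by move=> f0 g0; rewrite smooth_partialD f0 g0 addr0.
have CM f g : smooth_partial ord0 f = 0 -> smooth_partial ord0 g = 0 ->
    smooth_partial ord0 (f * g) = 0 :> smooth_fun oU.
  by move=> f0 g0; rewrite smooth_partialM f0 g0 mul0r mulr0 addr0.
have Cu j : smooth_partial ord0 (smooth_coordinate oU (uI j)) = 0 by exact: smooth_partial_coord.
have Cp j f : smooth_partial ord0 f = 0 -> smooth_partial ord0 (smooth_partial (uI j) f) = 0 :> smooth_fun oU.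
  exact: smooth_partial_eq0.
have ext_partial j f : smooth_partial ord0 f = 0 ->
    ext (smooth_partial (uI j) f) = smooth_partial (uI j) (ext f).
  move=> f0; apply: extE; [exact: Cp|by apply: smooth_partial_eq0; exact: ext_0|].
  by rewrite res_partial ext_res.
have rad := radial_sint oS star_saturation.
exists (fun w f => res oU sub_saturation (sint star_saturation w (ext f))); split=> //.
- move=> w f g f0 g0; rewrite -rmorphD /= -sintD; congr (res _ _ (sint _ _ _)).
  apply: extE; [exact: CD|by rewrite smooth_partialD !ext_0 // addr0|].
  by rewrite rmorphD /= !ext_res.
- move=> w j f f0; rewrite -(res_coordinate oS oU sub_saturation) -rmorphM /= (radial_u rad) //.
  congr (res _ _ (sint _ _ _)); apply/esym/extE; last by rewrite rmorphM /= ext_res.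
    by rewrite res_coordinate; exact: (CM _ _ (Cu j) f0).
  by rewrite smooth_partialM ext_0 // mulr0 addr0 smooth_partial_coord mul0r.
- move=> w f f0; rewrite -[RHS]ext_res // -[in RHS](radial_euler rad w (f := ext f)) //.
  rewrite rmorphD rmorphM rmorph_nat rmorph_sum /=; congr (_ + _); apply: eq_bigr => j _.
  by rewrite rmorphM /= res_coordinate ext_partial.
- move=> f f0 v0; rewrite -[RHS]ext_res // -[in RHS](radial_div rad (f := ext f)) //.
    rewrite rmorph_sum /=; apply: eq_bigr => j _.
    by rewrite rmorphM /= res_coordinate ext_partial.
  move=> x Sx x0; have [y Uy yx] := Sx.
  rewrite (@saturation_constant _ x y) ?ext_0 // -(zext_res oU sub_saturation) // ext_res //.
  by apply: v0 => //; rewrite yx.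
- by move=> w j f f0; rewrite -res_partial (radial_partial rad) // ext_partial.
- by move=> w f f0; rewrite -res_partial sint_partial ext_0 // sint0 rmorph0.
Qed.

Lemma vanishes0_kernel (f : smooth_fun oU) x0 : U x0 -> proj_u x0 = 0 ->
  smooth_partial ord0 f = 0 -> zext f x0 = 0 -> vanishes0 f.
Proof.
by move=> Ux0 x00 f0 fx x Ux px; rewrite (@fiber_constant f x x0) // px x00.
Qed.

End Saturation.

(** * The Koszul complex of the Euler field *)

Section Instance.
Variables (R : realType) (m : nat) (U : set 'rV[R]_m.+1) (oU : open U).
Local Notation V := 'rV[R]_m.+1.
Local Notation K := (smooth_fun oU).
Local Notation D := (@smooth_partial R m.+1 U oU).
Local Notation uI j := (lift ord0 j : 'I_m.+1).
Local Notation u := (fun j : 'I_m => smooth_coordinate oU (uI j)).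
Local Notation Z := (@vanishes0 R m U oU).

Lemma vanishes0_0 : Z 0.
Proof. by move=> x _ _; rewrite zext0. Qed.

Lemma vanishes0D f g : Z f -> Z g -> Z (f + g).
Proof. by move=> hf hg x Ux x0; rewrite zextD hf // hg // addr0. Qed.

Lemma vanishes0N f : Z f -> Z (- f).
Proof. by move=> hf x Ux x0; rewrite zextN hf // oppr0. Qed.

Lemma vanishes0M f g : Z f -> Z (g * f).
Proof. by move=> hf x Ux x0; rewrite zextM hf // mulr0. Qed.

Lemma vanishes0_u j : Z (u j).
Proof. by move=> x Ux /rowP/(_ j); rewrite zext_coordinate // !mxE. Qed.

(** A line in direction t through a point with u = 0 keeps u = 0, where f vanishes. *)
Lemma vanishes0_time f : Z f -> Z (D ord0 f).
Proof.
move=> hf x Ux x0; rewrite zext_smooth_partial //.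
have d : is_derive (0 : R) 1 (fun s : R => zext f (x + s *: 'e_ord0)) 0.
  have e : \forall s \near (0 : R), cst 0 s = zext f (x + s *: 'e_ord0).
    have c : {for (0 : R), continuous (fun s : R => x + s *: 'e_ord0 : V)}.
      apply: continuousD; first exact: cst_continuous.
      by apply: continuousZl; exact: cvg_id.
    have nU : nbhs (x + (0 : R) *: 'e_ord0) U by rewrite scale0r addr0; exact: open_near.
    have nU' : \forall s \near (0 : R), U (x + s *: 'e_ord0) by exact: (c _ nU).
    apply: filterS nU' => s Us.
    by rewrite hf //; apply/rowP => j; have /rowP/(_ j) := x0; rewrite !mxE mulr0 addr0.
  exact: (near_eq_is_derive e (is_derive_cst _ _ _)).
by have [] := proj2 (is_derive_at _ _ _ _) d.
Qed.

Lemma natr_inv p : exists r : K, (forall i, D i r = 0) /\ r * p.+1%:R = 1.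
Proof.
exists (smooth_const oU (p.+1%:R^-1)); split; first by move=> i; exact: smooth_partial_const.
apply: smooth_fun_eq => x Ux; rewrite zextM zext_const // zext_nat // zext1 //.
by rewrite mulVf // pnatr_eq0.
Qed.

(** The right derivatives of d_t E are - E in the variable d_t and u_j d_t in d_u_j; inserted in the
    coordinate formula of the bracket they give d_t L - E T. *)
Lemma d_book_dbook (a : multivector oU) : d_book a = dbook D u a.
Proof.
rewrite d_bookE !big_ord_recl /dbook.
have b0 : rcontract ord0 (book oU) = - euler oU.
  rewrite rcontract_book eqxx mul1r rcontract_euler big1 ?mulr0 ?add0r => [|j _].
    exact: (grade_inv_eu u).
  by rewrite (negPf (neq_lift _ _)) mulr0.
have bj j : rcontract (uI j) (book oU) = d_t oU * u_ oU j.
  rewrite rcontract_book eq_sym (negPf (neq_lift _ _)) mul0r addr0 rcontract_euler.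
  rewrite (bigD1 j) //= eqxx mulr1 big1 ?addr0 // => k kj.
  by rewrite (inj_eq lift_inj) eq_sym (negPf kj) mulr0.
have c0 : cderiv D ord0 (book oU) = 0.
  by rewrite cderiv_book big1 ?mulr0 // => j _; rewrite (negPf (neq_lift _ _)) mul0r.
have cj j : cderiv D (uI j) (book oU) = d_t oU * d_u oU j.
  rewrite cderiv_book; congr (_ * _); rewrite (bigD1 j) //= eqxx mul1r big1 ?addr0 // => k kj.
  by rewrite (inj_eq lift_inj) eq_sym (negPf kj) mul0r.
rewrite b0 c0 mulr0 add0r mulNr -addrA addrC; congr (_ + _).
rewrite (lie_expand D u a) [RHS]mulrBr; congr (_ - _); rewrite mulr_sumr; apply: eq_bigr => j _.
  by rewrite bj mulrA.
rewrite cj mulrA; have := @d_tK R m U oU (rcontract (uI j) a) => <-.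
by rewrite mulrA.
Qed.

End Instance.

Section KoszulGlobal.
Variables (R : realType) (m : nat) (U : set 'rV[R]_m.+1) (oU : open U).
Local Notation V := 'rV[R]_m.+1.
Local Notation uI j := (lift ord0 j : 'I_m.+1).

Lemma ext_map_eu (W : set V) (oW : open W) (phi : {rmorphism smooth_fun oU -> smooth_fun oW}) :
  (forall j, phi (smooth_coordinate oU (uI j)) = smooth_coordinate oW (uI j)) ->
  ext_map phi (euler oU) = euler oW.
Proof.
move=> e; rewrite ext_map_sum; apply: eq_bigr => j _.
by rewrite ext_mapM ext_map_fun ext_map_basis e.
Qed.

(** Local solutions belong to function rings of different open sets; their values lie in one
    exterior algebra over R, where they can be compared and summed. *)
Definition ev (z : V) (x : multivector oU) : extalg m.+1 R :=
  [ffun M => zext (x M) z].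

Definition euler_at (z : V) : extalg m.+1 R :=
  \sum_(j < m) ext_fun m.+1 (z 0 (uI j)) * ext_basis R (uI j).

Lemma ev_ext_map z (Uz : U z) x : ev z x = ext_map (@eval_at R m.+1 U oU z Uz) x.
Proof. by apply/ffunP => M; rewrite !ffunE. Qed.

Lemma ev_mul z x y : U z -> ev z (x * y) = ev z x * ev z y.
Proof. by move=> Uz; rewrite !(ev_ext_map Uz) ext_mapM. Qed.

Lemma ev_euler z : U z -> ev z (euler oU) = euler_at z.
Proof.
move=> Uz; rewrite (ev_ext_map Uz) ext_map_sum; apply: eq_bigr => j _.
by rewrite ext_mapM ext_map_fun ext_map_basis /= /eval_at zext_coordinate.
Qed.

End KoszulGlobal.

Section KoszulPatch.
Variables (R : realType) (m : nat) (U : set 'rV[R]_m.+1) (oU : open U).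
Local Notation V := 'rV[R]_m.+1.
Local Notation uI j := (lift ord0 j : 'I_m.+1).
Local Notation top := (finset.setC (finset.set1 (ord0 : 'I_m.+1))).

(* At a point with u = 0 a ball is stable under scaling of u, elsewhere one
   divides by a coordinate u_j that does not vanish. *)
Lemma koszul_local (x : multivector oU) (x0 : V) : omits ord0 x -> euler oU * x = 0 ->
  vanishes0 (x top) -> U x0 ->
  exists W (oW : open W) (y : multivector oW),
    [/\ W x0, W `<=` U & forall z, W z -> ev z x = euler_at z * ev z y].
Proof.
move=> ox Ex Zx Ux0.
have solve W (oW : open W) (WU : W `<=` U) (y : multivector oW) :
    ext_map (res oW WU) x = euler oW * y -> forall z, W z -> ev z x = euler_at z * ev z y.
  move=> e z Wz; rewrite -(ev_euler oW Wz) -ev_mul // -e.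
  by apply/ffunP => M; rewrite !ffunE zext_res.
have resE W (oW : open W) (WU : W `<=` U) : ext_map (res oW WU) (euler oU) = euler oW.
  by apply: ext_map_eu => j; exact: res_coordinate.
have [x00|] := eqVneq (proj_u x0) 0.
  have [d d0 dU] : exists2 d : R, 0 < d & ball x0 d `<=` U.
    by have /nbhs_ballP[d /= d0 hd] := open_near oU Ux0; exists d.
  pose W := ball x0 d; have oW : open W by exact: ball_open.
  have star z s : W z -> 0 <= s <= 1 -> W (scaling (@space m) 0 s z).
    move=> [_ Wz] /andP[s0 s1]; split=> // a i; have := Wz a i.
    rewrite (ord1 a) -!ball_normE /ball_ /=; have [<-|i0] := eqVneq ord0 i; first by rewrite !mxE.
    have [j -> _] := unlift_some i0; have /rowP/(_ j) := x00; rewrite !mxE => -> /=.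
    rewrite !add0r subr0 !normrN normrM ger0_norm // => hz.
    by apply: le_lt_trans hz; rewrite ler_piMl.
  have rad := radial_sint oW star.
  pose xW := ext_map (res oW dU) x.
  have [|||||y [_ _ yE]] := @koszul m (smooth_fun oW) (@smooth_partial R m.+1 W oW)
    (fun j => smooth_coordinate oW (uI j)) (@smooth_partialD R m.+1 W oW)
    (@smooth_partialM R m.+1 W oW) (fun i j => @smooth_partial_coord R m.+1 W oW i (uI j))
    (fun=> True) (@sint _ _ _ _ _ oW star) (@vanishes0 R m W oW)
    I (fun _ _ => I) (fun _ _ _ _ => I) (fun=> I) (fun _ _ _ _ => I) (fun _ _ _ => I) (fun _ _ _ => I)
    (radial_D rad) (radial_u rad) (radial_euler rad) (radial_div rad) xW.
  - by move=> M tM; rewrite ffunE ox // rmorph0.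
  - by move=> M.
  - by have := congr1 (ext_map (res oW dU)) Ex; rewrite ext_mapM resE ext_map0.
  - by move=> z Wz z0; rewrite ffunE zext_res //; exact: (Zx z (dU z Wz) z0).
  - exact: vanishes0N.
  exists W, oW, y; split=> //; first exact: ballxx.
  exact: solve.
move=> x0n; have [j xj] : exists j, x0 0 (uI j) != 0.
  apply/existsP; apply: contraNT x0n; rewrite negb_exists => /forallP h.
  by apply/eqP/rowP => j; rewrite !mxE; apply/eqP; have := h j; rewrite negbK.
pose c := smooth_coordinate oU (uI j).
(* The square turns the condition u_j <> 0 into a superlevel set. *)
pose W := [set z | U z /\ 0 < zext (c * c) z].
have oW : open W by exact: open_superlevel.
have WU : W `<=` U by move=> z [].
have cE z : U z -> zext (c * c) z = z 0 (uI j) ^+ 2.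
  by move=> Uz; rewrite zextM zext_coordinate.
have [|g gc] := @smooth_inv R m.+1 W oW (smooth_coordinate oW (uI j)).
  move=> z [Uz]; rewrite cE // => h; rewrite zext_coordinate //; last by split=> //; rewrite cE.
  by apply: contraTneq h => ->; rewrite expr0n /= ltxx.
exists W, oW, (ext_fun m.+1 g * ext_map (res oW WU) (- rcontract (uI j) (grade_inv x))).
split=> //; first by split=> //; rewrite cE // lt_def sqr_ge0 sqrf_eq0 xj.
apply: solve; rewrite mulrA -ext_fun_comm -mulrA -(resE W oW WU) -ext_mapM.
have <- := koszul_divide (u := fun j => smooth_coordinate oU (uI j)) j Ex.
by rewrite ext_mapM ext_map_fun /= res_coordinate mulrA -ext_funM gc ext_fun1 mul1r.
Qed.

(** The equation E y = x is linear over functions, so a combination of local solutions with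
    coefficients of sum 1 is again a solution. *)
Lemma koszul_global (x : multivector oU) : omits ord0 x -> euler oU * x = 0 ->
  vanishes0 (x top) -> exists y : multivector oU, omits ord0 y /\ x = euler oU * y.
Proof.
move=> ox Ex Zx.
pose Good (P : smooth_fun oU) := exists c : {set 'I_m.+1} -> V -> R,
  forall z, U z -> -1 < zext P z -> (forall M, smooth_at (c M) z) /\
    ev z x = euler_at z * ([ffun M => c M z] : extalg m.+1 R).
have [||P [cover good _]] := @rational_cover R _ U oU predT Good.
- by exists (fun _ _ => 0) => z Uz; rewrite zext_const // ltrN2 ltNge ler1n.
- move=> x0 Ux0; have [W [oW [y [Wx0 WU hy]]]] := koszul_local ox Ex Zx Ux0.
  have [r r0 hr] := open_box oW Wx0; exists r => // P _ near_x0.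
  exists (fun M => zext (y M)) => z Uz Pz.
  have Wz : W z by apply: hr => i; exact: near_x0.
  by split; [move=> M; exact: zext_smooth|exact: hy].
have [c hc] := choice good.
have [|mu [C [hC mu0 _]]] := @patch_smooth R _ U oU P cover _ c.
  by move=> k M z Uz /(hc k z Uz)[].
pose y : multivector oU := [ffun M => C M].
have yE : x = euler oU * y.
  apply/ffunP => M; apply: smooth_fun_eq => z Uz.
  have [N /nbhs_singleton[hN sum1]] := hC z Uz.
  suff : ev z x = ev z (euler oU * y).
    by move=> /ffunP/(_ M); rewrite [LHS]ffunE [RHS]ffunE.
  rewrite ev_mul // ev_euler //.
  have -> : ev z y = \sum_(k < N) ext_fun m.+1 (zext (mu k) z) * [ffun M => c k M z].
    apply/ffunP => I; rewrite sum_ffunE !ffunE hN; apply: eq_bigr => k _.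
    by rewrite ext_fun_mull ffunE.
  rewrite mulr_sumr (eq_bigr (fun k : 'I_N => ext_fun m.+1 (zext (mu k) z) * ev z x)).
    by rewrite -mulr_suml -ext_fun_sum sum1 ext_fun1 mul1r.
  move=> k _; rewrite mulrA -ext_fun_comm -mulrA.
  have [h|h] := ltP (-1) (zext (P k) z); first by have [_ <-] := hc k z Uz h.
  by rewrite mu0 ?ext_fun0 ?mul0r // (le_trans h) // oppr_le0 ler01.
(* The glued y may contain d_t. Dropping these terms preserves the equation, since x and E are free
   of d_t. *)
exists (without ord0 y); split; first exact: without_omits.
rewrite -[LHS](omits_without ox) yE; have /= oddE := @eu_odd m _ (fun j : 'I_m => smooth_coordinate oU (uI j)).
rewrite [euler oU * y]oddE without_mul; last exact: eu_omits.
rewrite [RHS]oddE; congr (_ * _).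
by apply/ffunP => M; rewrite !ffunE; case: ifP; rewrite ?mulr0.
Qed.

End KoszulPatch.

(** * Book cohomology *)

Section QuotientLift.
Variables (A B : pzRingType) (f : {rmorphism A -> B}) (I : tsideal A).
Hypothesis fI : forall x, I x -> f x = 0.

Definition tsquot_lift (_ : forall x, I x -> f x = 0) (q : tsquot I) : B := f (repr q).

Lemma tsquot_lift_pi x : tsquot_lift fI (tsquot_pi I x) = f x.
Proof.
apply/eqP; rewrite -subr_eq0 -rmorphB; apply/eqP/fI/tsquot_eq.
by rewrite /tsquot_pi reprK.
Qed.

Lemma tsquot_lift_zmod : zmod_morphism (tsquot_lift fI).
Proof.
move=> p q; have [x <-] := tsquot_surj p; have [y <-] := tsquot_surj q.
by rewrite -tsquot_piB !tsquot_lift_pi rmorphB.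
Qed.

Lemma tsquot_lift_monoid : monoid_morphism (tsquot_lift fI).
Proof.
split=> [|p q]; first by rewrite -[1]/(tsquot_pi I 1) tsquot_lift_pi rmorph1.
have [x <-] := tsquot_surj p; have [y <-] := tsquot_surj q.
by rewrite -rmorphM !tsquot_lift_pi rmorphM.
Qed.

HB.instance Definition _ :=
  GRing.isZmodMorphism.Build (tsquot I) B (tsquot_lift fI) tsquot_lift_zmod.
HB.instance Definition _ :=
  GRing.isMonoidMorphism.Build (tsquot I) B (tsquot_lift fI) tsquot_lift_monoid.

End QuotientLift.

Section BookCohomology.
Variables (R : realType) (m : nat) (U : set 'rV[R]_m.+1) (oU : open U).
Local Notation K := (smooth_fun oU).
Local Notation D := (@smooth_partial R m.+1 U oU).
Local Notation uI j := (lift ord0 j : 'I_m.+1).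
Local Notation u := (fun j : 'I_m => smooth_coordinate oU (uI j)).
Local Notation Z := (@vanishes0 R m U oU).
Local Notation DD := (@smooth_partialD R m.+1 U oU).
Local Notation DM := (@smooth_partialM R m.+1 U oU).
Local Notation DC := (fun i j f => @smooth_partialC R m.+1 U oU f i j).
Local Notation Du := (fun i j => @smooth_partial_coord R m.+1 U oU i (uI j)).
Implicit Types (a : multivector oU).

Lemma linear_dtime a : linear_multivector a -> dtime D a = 0.
Proof.
have dD := DD; have dM := DM.
elim=> [c||i j|b c _ hb _ hc|b c _ hb _ hc].
- by rewrite /dtime cderiv_fun // smooth_partial_const ext_fun0.
- by rewrite /dtime cderiv_basis.
- rewrite /dtime cderivM // cderiv_basis // mulr0 addr0 cderiv_fun // smooth_partial_coord.
  by rewrite (negPf (neq_lift _ _)) ext_fun0 mul0r.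
- by rewrite (dtimeD DD) hb hc addr0.
- by rewrite /dtime cderivM // -/(dtime D b) -/(dtime D c) hb hc mul0r mulr0 addr0.
Qed.

Lemma linear_lie a : linear_multivector a -> lie D u a = 0.
Proof.
elim=> [c||i j|b c _ hb _ hc|b c _ hb _ hc].
- rewrite (lie_fun u DD) /eul big1 ?ext_fun0 // => j _.
  by rewrite smooth_partial_const mulr0.
- exact: (lie_et u DD DM).
- exact: (lie_linear DD DM Du).
- by rewrite (lieD u DD) hb hc addr0.
- by rewrite (lieM u DD DM) hb hc mul0r mulr0 addr0.
Qed.

(** Since L t = 0 and T t = 1, the formula d_t L - E T gives d_book t = - E. *)
Lemma euler_exact : d_book (- ext_fun _ (smooth_coordinate oU ord0)) = euler oU.
Proof.
have dD := DD; rewrite d_bookN d_book_dbook /dbook (lie_fun u DD) /eul big1 ?ext_fun0 => [|j _].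
  rewrite mulr0 sub0r opprK /dtime cderiv_fun // smooth_partial_coord eqxx ext_fun1.
  by rewrite mulr1.
by rewrite smooth_partial_coord eq_sym (negPf (neq_lift _ _)) mulr0.
Qed.

Hypothesis m_gt0 : (0 < m)%N.
Hypothesis fibers : forall v : 'rV[R]_m,
  (@proj_u R m @` U) v -> connected (U `&` [set x | proj_u x = v]).
Hypothesis star : star_shaped0 (@proj_u R m @` U).

Lemma constant_part (f : K) : D ord0 f = 0 -> exists c, (forall i, D i c = 0) /\ Z (f - c).
Proof.
move=> f0; have [[x0 Ux0 x00] _] := star.
exists (smooth_const oU (zext f x0)); split; first by move=> i; exact: smooth_partial_const.
apply: (vanishes0_kernel fibers Ux0 x00).
  by rewrite smooth_partialD smooth_partialN smooth_partial_const subr0.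
by rewrite zextB zext_const // subrr.
Qed.

(** [radial_div] recovers c minus its value over u = 0 from its derivatives, which all vanish. *)
Lemma smooth_const_eq (c : K) : (forall i, D i c = 0) -> exists r, c = smooth_const oU r.
Proof.
move=> Dc; have [S rad] := radial_kernel oU fibers star.
have [[x0 Ux0 x00] _] := star; exists (zext c x0); apply/eqP; rewrite -subr_eq0; apply/eqP.
have f0 : D ord0 (c - smooth_const oU (zext c x0)) = 0.
  by rewrite smooth_partialD smooth_partialN smooth_partial_const subr0.
rewrite -(radial_div rad f0) ?big1 // => [j _|].
  rewrite smooth_partialD smooth_partialN smooth_partial_const subr0 Dc.
  by rewrite (S0 (C := fun f => D ord0 f = 0) (smooth_partial0 oU ord0) (radial_D rad)) mulr0.
apply: (vanishes0_kernel fibers Ux0 x00) => //.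
by rewrite zextB zext_const // subrr.
Qed.

Lemma linear_kernel a : dtime D a = 0 -> lie D u a = 0 -> linear_multivector a.
Proof.
have [S rad] := radial_kernel oU fibers star.
apply: (Lin_kernel DD DM DC Du (radial_D rad) (radial_u rad) (radial_euler rad)
  (radial_div rad) constant_part (@natr_inv _ _ _ oU)).
- exact: linear_add.
- exact: linear_mul.
- by move=> c /smooth_const_eq[r ->]; exact: linear_const.
- exact: linear_t.
- exact: linear_u.
Qed.

Lemma cocycle_decomposition a : d_book a = 0 ->
  exists x z : multivector oU, linear_multivector x /\ a = x + d_book z.
Proof.
have [S rad] := radial_kernel oU fibers star; rewrite d_book_dbook => da.
have [x [z [Tx Lx e]]] := book_cocycle DD DM DC Du m_gt0 (radial_S rad) (radial_D rad)
  (radial_u rad) (radial_euler rad) (radial_div rad) (radial_partial rad)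
  (@vanishes0_0 _ _ _ oU) (@vanishes0D _ _ _ oU) (@vanishes0M _ _ _ oU) (@vanishes0_u _ _ _ oU)
  (@vanishes0_time _ _ _ oU) constant_part (@natr_inv _ _ _ oU) (fun f : K => time_primitive fibers f)
  (@koszul_global _ _ _ oU) da.
by exists x, z; split; [exact: linear_kernel|rewrite d_book_dbook].
Qed.

Lemma linear_boundary a z : linear_multivector a -> a = d_book z ->
  exists2 h, linear_multivector h & a = euler oU * h.
Proof.
have [S rad] := radial_kernel oU fibers star; rewrite d_book_dbook => la e.
have Dtau i : D i (smooth_coordinate oU ord0) = (i == ord0)%:R by exact: smooth_partial_coord.
have [h [Th Lh aE]] := book_boundary DD DM DC Du m_gt0 (radial_S rad) (radial_D rad)
  (radial_u rad) (radial_euler rad) (radial_div rad) (radial_partial rad)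
  (@vanishes0_0 _ _ _ oU) (@vanishes0D _ _ _ oU) (@vanishes0M _ _ _ oU) (@vanishes0_u _ _ _ oU)
  (@vanishes0_time _ _ _ oU) constant_part (@natr_inv _ _ _ oU) Dtau (fun f : K => time_primitive fibers f)
  (@koszul_global _ _ _ oU) (linear_dtime la) (linear_lie la) e.
by exists h => //; exact: linear_kernel.
Qed.

Lemma book_class_surj (h : H_book oU) : exists mu : linear_alg oU, book_class mu = h.
Proof.
have [z <-] := tsquot_surj h; have [x [w [lx e]]] := cocycle_decomposition (d_cocycle z).
have xP : x \in linear_pred oU by exact/asboolP.
exists (LinearAlg xP); apply/tsquot_eq; exists (- w).
by rewrite d_bookN /= e opprD addNKr.
Qed.

Lemma book_class_ideal (mu : linear_alg oU) :
  generated_tsideal (linear_euler oU) mu -> book_class mu = 0.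
Proof.
elim=> [||x y _ hx _ hy|r x _ hx|r x _ hx].
- rewrite -(rmorph0 (tsquot_pi (boundary oU))); apply/tsquot_eq.
  by exists (- ext_fun _ (smooth_coordinate oU ord0)); rewrite euler_exact /= subr0.
- exact: rmorph0.
- by rewrite rmorphB /= hx hy subrr.
- by rewrite rmorphM /= hx mulr0.
- by rewrite rmorphM /= hx mul0r.
Qed.

Lemma book_class_kernel (mu : linear_alg oU) :
  book_class mu = 0 -> generated_tsideal (linear_euler oU) mu.
Proof.
rewrite -(rmorph0 (tsquot_pi (boundary oU))) => /tsquot_eq[z]; rewrite subr0 /= => e.
have [h lh muE] := linear_boundary (asboolW (linear_valP mu)) e.
have hP : h \in linear_pred oU by exact/asboolP.
have -> : mu = linear_euler oU * LinearAlg hP by exact: val_inj.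
exact/generated_tsideal_r/generated_tsideal_self.
Qed.

End BookCohomology.

(* The dimension of the statement is n = m.+1, so that n >= 2 is 0 < m. *)
Theorem theorem2p3 (R : realType) (m : nat) (hm : (0 < m)%N)
    (U : set 'rV[R]_m.+1) (oU : open U)
    (fibers : forall v : 'rV[R]_m,
       (@proj_u R m @` U) v -> connected (U `&` [set x | proj_u x = v]))
    (star : star_shaped0 (@proj_u R m @` U)) :
  (forall h : H_book oU, exists mu : linear_alg oU, book_class mu = h) /\
  (forall mu : linear_alg oU,
     book_class mu = 0 <-> generated_tsideal (linear_euler oU) mu) /\
  (exists phi : {rmorphism linear_mod_euler oU -> H_book oU},
     bijective phi /\
     forall mu : linear_alg oU,
       phi (tsquot_pi (generated_tsideal (linear_euler oU)) mu) = book_class mu).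
Proof.
have surj := @book_class_surj R m U oU hm fibers star.
have ker := @book_class_kernel R m U oU hm fibers star.
split=> //; split=> [mu|]; first by split; [exact: ker|exact: book_class_ideal].
pose phi : {rmorphism linear_mod_euler oU -> H_book oU} := tsquot_lift (@book_class_ideal R m U oU).
have phiE mu : phi (tsquot_pi _ mu) = book_class mu by exact: tsquot_lift_pi.
exists phi; split=> //.
have [g hg] := choice surj.
exists (fun h => tsquot_pi _ (g h)) => [q|h]; last by rewrite phiE.
have [mu <-] := tsquot_surj q; rewrite phiE; apply/tsquot_eq/ker.
by rewrite rmorphB /= hg subrr.
Qed.
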